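(* Let $\mathcal{D}_r^*(\mathbb{C})$ be the set of diagonalizable and invertible matrices in $\mathcal{M}_r(\mathbb{C})$ with $r$ different eigenvalues. The map $\Delta^\infty(\cdot)$ is of class $C^\infty$ on $\mathcal{D}_r^*(\mathbb{C})$, and the sequence $\{\Delta^n(\cdot)\}_{n\in\mathbb{N}}$, restricted to $\mathcal{D}_r^*(\mathbb{C})$, converges uniformly on compact sets to $\Delta^\infty(\cdot)$.
   Context: $\mathcal{M}_r(\mathbb{C})$ is the algebra of complex $r\times r$ matrices. For $T\in\mathcal{M}_r(\mathbb{C})$ with polar decomposition $T=U|T|$, where $|T|=(T^*T)^{1/2}$, the Aluthge transform is $\Delta(T)=|T|^{1/2}U|T|^{1/2}$; $\Delta^0(T)=T$ and $\Delta^n(T)=\Delta(\Delta^{n-1}(T))$. For a diagonalizable matrix $T$, $\Delta^\infty(T)=\lim_{n\to\infty}\Delta^n(T)$ (this limit exists for every diagonalizable $T$). The set $\mathcal{D}_r^*(\mathbb{C})$ (every eigenvalue is nonzero and has algebraic multiplicity one) is an open dense subset of $\mathcal{M}_r(\mathbb{C})$ which is invariant under $\Delta$; smoothness is in the sense of maps between open subsets of real vector spaces. *)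

(* Defs.v *)
From HB Require Import structures.
From mathcomp Require Import all_boot all_order all_algebra.
From mathcomp Require Import all_classical all_reals all_analysis.
From mathcomp.real_closed Require Export complex.

Set Implicit Arguments.
Unset Strict Implicit.
Unset Printing Implicit Defensive.

Import Order.TTheory GRing.Theory Num.Theory.
Import numFieldNormedType.Exports.

Local Open Scope classical_set_scope.
Local Open Scope sesquilinear_scope.
Local Open Scope ring_scope.

(* The usual topology of the complex numbers (given by the modulus), from which
   'M[R[i]]_r inherits its topology. *)
HB.instance Definition _ (R : realType) := NormedModule.copy R[i] R[i]^o.

Section aluthge_transform.
Variables (C : numClosedFieldType) (r : nat).
Implicit Types A S T U : 'M[C]_r.

(* In a numClosedFieldType, [0 <= z] implies that z is real. *)
Definition psdmx A :=
  A \is hermsymmx /\ forall v : 'rV[C]_r, 0 <= (v *m A *m v ^t*) 0 0.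

(* The square root of a positive semidefinite matrix, by functional calculus
   on a unitary diagonalization (see [sqrtmxP]). *)
Definition sqrtmx A : 'M[C]_r :=
  invmx (spectralmx A) *m diag_mx (map_mx sqrtC (spectral_diag A))
    *m spectralmx A.

Definition absmx T := sqrtmx (T ^t* *m T).

Definition is_polar_factor T U := U \is unitarymx /\ T = U *m absmx T.

(* A unitary U such that T = U|T|. It is unique when T is invertible;
   in general |T|^(1/2) U |T|^(1/2) does not depend on the choice of U. *)
Definition polar_factor T : 'M[C]_r := xget 1%:M (is_polar_factor T).

Definition aluthge T : 'M[C]_r :=
  sqrtmx (absmx T) *m polar_factor T *m sqrtmx (absmx T).

Lemma psdmx_gram T : psdmx (T ^t* *m T).
Proof.
split.
  apply/is_hermitianmxP.
  by rewrite expr0 scale1r trmx_mul map_mxM trmxCK.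
move=> v; rewrite !mulmxA -mulmxA.
have -> : T *m v ^t* = (v *m T ^t*) ^t*.
  by rewrite trmx_mul map_mxM trmxCK.
by rewrite -dotmxE; apply: dnorm_ge0.
Qed.

Lemma sqrtmxP A : psdmx A -> psdmx (sqrtmx A) /\ sqrtmx A *m sqrtmx A = A.
Proof.
move=> [hA pA]; rewrite /sqrtmx.
set M := spectralmx A; set d := spectral_diag A.
have MU : M \is unitarymx := spectral_unitarymx A.
have MV : invmx M = M ^t* by rewrite invmx_unitary.
have Mu : M \in unitmx := spectral_unit A.
have Ae : A = invmx M *m diag_mx d *m M.
  exact: (orthomx_spectralP (hermitian_normalmx hA)).
have d0 j : 0 <= d 0 j.
  have := pA (delta_mx 0 j *m M).
  rewrite Ae trmx_mul map_mxM -MV !mulmxA !(mulmxK Mu).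
  rewrite -mulmxA -rowE -map_trmx map_delta_mx trmx_delta.
  by rewrite -colE !mxE eqxx mulr1n.
split; last first.
  rewrite -!mulmxA (mulKVmx Mu) [in RHS]Ae -!mulmxA; congr (_ *m _).
  rewrite mulmxA; congr (_ *m _); rewrite mulmx_diag; congr diag_mx.
  by apply/rowP => j; rewrite !mxE -expr2 sqrtCK.
have -> : diag_mx (map_mx sqrtC d) =
  diag_mx (map_mx sqrtC (map_mx sqrtC d)) ^t* *m
  diag_mx (map_mx sqrtC (map_mx sqrtC d)).
  rewrite tr_diag_mx map_diag_mx mulmx_diag; congr diag_mx.
  apply/rowP => j; rewrite !mxE.
  have e : (sqrtC (sqrtC (d 0 j)))^* = sqrtC (sqrtC (d 0 j)).
    by rewrite geC0_conj ?sqrtC_ge0.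
  by rewrite [X in _ = X * _]e -expr2 sqrtCK.
rewrite MV mulmxA -map_mxM -trmx_mul -mulmxA.
exact: psdmx_gram.
Qed.

Lemma polar_factorP T : T \in unitmx -> is_polar_factor T (polar_factor T).
Proof.
move=> uT; apply: (@xgetPex _ 1%:M (is_polar_factor T)).
have [[hS _]] := sqrtmxP (psdmx_gram T).
rewrite -/(absmx T) => S2.
have {}hS : (absmx T) ^t* = absmx T.
  by have /is_hermitianmxP := hS; rewrite expr0 scale1r.
have uS : absmx T \in unitmx.
  have : absmx T *m absmx T \in unitmx.
    rewrite S2 unitmx_mul uT andbT.
    by rewrite unitmxE det_map_mx det_tr fmorph_unit -unitfE -unitmxE.
  by rewrite unitmx_mul => /andP[].
exists (T *m invmx (absmx T)); split; last by rewrite mulmxKV.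
rewrite -trmxC_unitary; apply/unitarymxP.
rewrite trmxCK trmx_mul map_mxM trmx_inv map_invmx hS.
by rewrite -!mulmxA (mulmxA (_ ^t*)) -S2 -mulmxA mulKmx// mulmxV.
Qed.

End aluthge_transform.

Section smooth.
Variables (K : numFieldType) (V W : normedModType K).

(* C^k on an open set U, for finite-dimensional V: the differentials of f up to
   order k exist and are continuous along all tuples of fixed directions. *)
Fixpoint Ck_on (k : nat) (U : set V) (f : V -> W) : Prop :=
  if k is k'.+1 then
    (forall x, U x -> differentiable f x) /\
    (forall v, Ck_on k' U (fun x => 'd f x v))
  else forall x, U x -> {for x, continuous f}.

Definition smooth_on (U : set V) (f : V -> W) := forall k, Ck_on k U f.

End smooth.

Section complex_matrices.
Variables (R : realType) (r : nat).
Local Notation MC := 'M[R[i]]_r.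

(* The identification of M_r(C) with the real normed space M_r(R) x M_r(R);
   smoothness of maps on M_r(C) is understood over the reals. *)
Definition reim_mx (T : MC) : 'M[R]_r * 'M[R]_r :=
  (map_mx (@complex.Re R) T, map_mx (@complex.Im R) T).

Definition mx_of_reim (p : 'M[R]_r * 'M[R]_r) : MC :=
  \matrix_(i, j) Complex (p.1 i j) (p.2 i j).

Definition real_smooth_on (U : set MC) (f : MC -> MC) :=
  smooth_on (mx_of_reim @^-1` U) (reim_mx \o f \o mx_of_reim).

Definition aluthge_lim (T : MC) : MC :=
  lim (iter n (@aluthge R[i] r) T @[n --> \oo]).

Definition Dstar : set MC :=
  [set T | [/\ diagonalizable T, T \in unitmx &
    exists s : seq R[i],
      [/\ size s = r, uniq s & {in s, forall a, eigenvalue T a}]]].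

End complex_matrices.

(* Main.v *)
(* Write T = U P with P = |T| and h = P^(1/2), so that Delta(T) = h U h, and let
   y(T) = T^* T - T T^* be the self-commutator of T.  The commutator q = P U - U P
   solves the Sylvester equation P q + q P = y(T) U, and both Delta(T) - T and
   y(Delta(T)) are linear in q with coefficients depending smoothly on T.  Hence
   Delta(T) = T + a(T, y(T)) and y(Delta(T)) = b(T, y(T)) with a, b linear in the
   second argument.  Since y(T) is trace-orthogonal to the polynomials in T, b can
   be modified so that at T = diag(d), with distinct nonzero d_i, it multiplies the
   off-diagonal entry (i, j) by a number of modulus < 1 and kills the diagonal.

   A map of this form converges geometrically near such a fixed point, and its
   tangent map is again of this form; by induction on k the limit is C^k.

   Globally, |q|^2 = 2 (|T|^2 - |Delta(T)|^2) in Frobenius norm, so q tends to 0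
   along orbits, which therefore accumulate at a normal matrix with the same
   eigenvalues, i.e. at a unitary conjugate of some diag(d).  As Delta commutes with
   unitary conjugation, the local analysis applies after finitely many steps. *)

Require Import Defs.
From HB Require Import structures.
From mathcomp Require Import all_boot all_order all_algebra ssrAC.
From mathcomp Require Import ring lra.
From mathcomp Require Import all_classical all_reals all_analysis.
Import Order.TTheory GRing.Theory Num.Theory.
Import numFieldNormedType.Exports.
Local Open Scope classical_set_scope.
Local Open Scope sesquilinear_scope.
Local Open Scope ring_scope.

Set Implicit Arguments.
Unset Strict Implicit.
Unset Printing Implicit Defensive.

(** Normal matrices near diag(d) are all fixed points, so the limit is not isolated and Delta is no
    contraction: its differential there has the eigenvalue 1. Only the defect contracts, which is
    why the displacement and the new defect are both written as linear maps of the defect. The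
    tangent system keeps the same rate, since at (p, 0) the derivative in the base direction drops
    out; no formula for higher derivatives is ever needed. The modification of b is forced: before
    it, the diagonal entries of the defect are multiplied by exactly 1. An off-diagonal entry is
    multiplied, up to a phase, by sqrt(|d_i d_j|) (u_i + u_j) / (|d_i| + |d_j|) with u_i = d_i /
    |d_i|; the modulus is at most 1 by the inequality of the means, with equality only for d_i =
    d_j. Two obstacles shape the rest. Adjoints make Delta non-holomorphic, so calculus is done over
    the reals, on pairs of real matrices. Square roots are defined by a chosen diagonalization, from
    which no regularity can be read; their smoothness comes from differentiating s^2 = g, which is
    again a Sylvester equation. *)

(** * Differentials and the classes C^k in normed spaces *)

Definition bounded_map (R : realType) (V W : normedModType R) (A : V -> W) :=
  exists C : R, forall v, `|A v| <= C * `|v|.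

Lemma bounded_map_pos (R : realType) (V W : normedModType R) (A : V -> W) :
  bounded_map A -> exists2 C : R, 0 < C & forall v, `|A v| <= C * `|v|.
Proof.
move=> [C hC]; exists (Num.max C 1); first by rewrite lt_max ltr01 orbT.
move=> v; apply: le_trans (hC v) _; apply: ler_wpM2r => //.
by rewrite le_max lexx.
Qed.

Lemma bounded_map_continuous (R : realType) (V W : normedModType R)
    (A : V -> W) : linear A -> bounded_map A -> continuous A.
Proof.
move=> lA /bounded_map_pos [C C0 hC] x.
pose AL : {linear V -> W} := HB.pack A (GRing.isLinear.Build _ _ _ _ _ lA).
apply/cvgrPdist_lt => e e0; near=> y.
rewrite -[A]/(AL : V -> W) -raddfB.
apply: (le_lt_trans (hC _)); rewrite mulrC -ltr_pdivlMr//.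
near: y; apply: (@cvgr_dist_lt _ _ _ _ _ id x) => //.
exact: divr_gt0.
Unshelve. all: by end_near. Qed.

(** Works from an explicit candidate [A], so that later proofs handle inequalities instead of
    little-o terms. Boundedness of [A] is assumed because the spaces may be infinite-dimensional. *)
Lemma is_diff_eps (R : realType) (V W : normedModType R) (f : V -> W) x
    (A : V -> W) : linear A -> bounded_map A ->
  (forall e : R, 0 < e ->
     \forall h \near (0 : V), `|f (x + h) - f x - A h| <= e * `|h|) ->
  is_diff x f A.
Proof.
move=> lA bA He.
pose AL : {linear V -> W} := HB.pack A (GRing.isLinear.Build _ _ _ _ _ lA).
have cA : continuous AL by exact: bounded_map_continuous.
have E : f \o shift x = cst (f x) + AL +o_ (0 : V) id.
  apply/eqaddoP => e e0 /=; near=> h.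
  have -> : (f \o shift x - (cst (f x) + AL)) h = f (x + h) - f x - A h.
    by rewrite -[LHS]/(f (h + x) - (f x + A h)) opprD addrA [h + x]addrC.
  near: h; exact: He.
have dE := diff_unique cA E.
apply: DiffDef; last by rewrite dE.
by apply/diff_locallyP; rewrite dE.
Unshelve. all: by end_near. Qed.

Lemma differentiable_eps (R : realType) (V W : normedModType R) (f : V -> W)
    x : differentiable f x -> forall e : R, 0 < e ->
  \forall h \near (0 : V), `|f (x + h) - f x - 'd f x h| <= e * `|h|.
Proof.
move=> /diff_locallyP [_ /eqaddoP E] e e0.
near=> h; have : `|(f \o shift x - (cst (f x) + 'd f x)) h| <= e * `|h|.
  by near: h; exact: E.
by rewrite -[(_ - _) h]/(f (h + x) - (f x + 'd f x h)) opprD addrA [h + x]addrC.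
Unshelve. all: by end_near. Qed.

Lemma diff_bounded (R : realType) (V W : normedModType R) (f : V -> W) x :
  differentiable f x -> bounded_map ('d f x).
Proof.
move=> /diff_continuous /linear_lipschitz [k _ hk]; by exists k.
Qed.

Lemma near_eq_is_diff (R : realType) (V W : normedModType R) (f g : V -> W) x :
  (\forall y \near x, f y = g y) -> differentiable f x ->
  is_diff x g ('d f x).
Proof.
move=> fg df; apply: is_diff_eps.
- exact: linearP.
- exact: diff_bounded.
- move=> e e0; near=> h.
  have <- : f x = g x by exact: (nbhs_singleton fg).
  have <- : f (x + h) = g (x + h).
    near: h.
    have c : (fun h : V => x + h) @ (0 : V) --> x.
      rewrite -[X in _ --> X]addr0.
      by apply: cvgD; [exact: cvg_cst|exact: cvg_id].
    exact: c fg.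
  near: h; exact: differentiable_eps.
Unshelve. all: by end_near. Qed.

(* C^k at a point, through the tangent map rather than along fixed directions:
   in this form stability under composition is an induction on [k]. *)
Fixpoint smooth_at (R : realType) (k : nat) :
    forall V W : normedModType R, (V -> W) -> V -> Prop :=
  match k with
  | 0 => fun V W f x => {for x, continuous f}
  | k'.+1 => fun V W f x =>
     (\forall y \near x, differentiable f y) /\
     forall v : V, @smooth_at R k' (V * V)%type W (fun p => 'd f (p.1) p.2) (x, v)
  end.
Arguments smooth_at {R} k {V W} f x.

Section Smooth.
Variable R : realType.

Lemma smooth_at_continuous k (V W : normedModType R) (f : V -> W) x :
  smooth_at k f x -> {for x, continuous f}.
Proof.
case: k => [//|k] /= [/nbhs_singleton df _].
exact: differentiable_continuous.
Qed.

Lemma smooth_at_pred k (V W : normedModType R) (f : V -> W) x :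
  smooth_at k.+1 f x -> smooth_at k f x.
Proof.
elim: k V W f x => [|k IH] V W f x; first exact: smooth_at_continuous.
by move=> [df Sf]; split => // v; exact: IH.
Qed.

Lemma near_fst (V W : topologicalType) (P : V -> Prop) x v :
  (\forall y \near x, P y) -> \forall p \near ((x, v) : V * W), P p.1.
Proof. by move=> Px; exact: (cvg_fst Px). Qed.

Lemma smooth_at_ext k (V W : normedModType R) (f g : V -> W) x :
  (\forall y \near x, f y = g y) -> smooth_at k f x -> smooth_at k g x.
Proof.
elim: k V W f g x => [|k IH] V W f g x fg.
  move=> cf; have {}cf : f @ x --> f x by exact: cf.
  suff : g @ x --> g x by [].
  rewrite -(nbhs_singleton fg); move: cf; apply: cvg_trans; apply: near_eq_cvg.
  by near=> y; near: y.
move=> [df Sf]; have dfg : \forall y \near x, is_diff y g ('d f y).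
  near=> y; apply: near_eq_is_diff; last by near: y.
  by near: y; apply: near_join.
split; first by near=> y; have [] : is_diff y g ('d f y) by near: y.
move=> v; apply: IH (Sf v).
near=> p; have [_ ->//] : is_diff (p.1) g ('d f (p.1)).
near: p; exact: (near_fst v dfg).
Unshelve. all: by end_near. Qed.

Lemma smooth_at_near1 k (V W : normedModType R) (f : V -> W) x :
  smooth_at k.+1 f x -> \forall y \near x, differentiable f y.
Proof. by case. Qed.

Lemma smooth_at_diff k (V W : normedModType R) (f : V -> W) x :
  smooth_at k.+1 f x -> differentiable f x.
Proof. by case=> /nbhs_singleton. Qed.

Lemma linearmapD (V W : normedModType R) (A : V -> W) : linear A ->
  {morph A : u v / u + v}.
Proof. by move=> lA u v; have := lA 1 u v; rewrite !scale1r. Qed.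

Lemma linearmap0 (V W : normedModType R) (A : V -> W) : linear A -> A 0 = 0.
Proof.
move=> lA; have := linearmapD lA 0 0; rewrite addr0 => /eqP.
by rewrite -subr_eq0 opprD addrA subrr add0r oppr_eq0 => /eqP.
Qed.

Lemma linearmapZ (V W : normedModType R) (A : V -> W) : linear A ->
  forall t u, A (t *: u) = t *: A u.
Proof. by move=> lA t u; have := lA t u 0; rewrite (linearmap0 lA) !addr0. Qed.

Lemma linearmapN (V W : normedModType R) (A : V -> W) : linear A ->
  {morph A : u / - u}.
Proof. by move=> lA u; rewrite -scaleN1r (linearmapZ lA) scaleN1r. Qed.

Lemma linearmapB (V W : normedModType R) (A : V -> W) : linear A ->
  {morph A : u v / u - v}.
Proof. by move=> lA u v; rewrite linearmapD// linearmapN. Qed.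

Lemma bounded_map_linear_diff (V W : normedModType R) (A : V -> W) x :
  linear A -> bounded_map A -> is_diff x A A.
Proof.
move=> lA bA; apply: is_diff_eps => // e e0; near=> h.
rewrite (linearmapD lA) [A x + A h]addrC addrK subrr normr0.
by rewrite mulr_ge0// ltW.
Unshelve. all: by end_near. Qed.

Lemma smooth_at_linear k (V W : normedModType R) (A : V -> W) x :
  linear A -> bounded_map A -> smooth_at k A x.
Proof.
elim: k V W A x => [|k IH] V W A x lA bA; first exact: bounded_map_continuous.
have dA y : is_diff y A A by exact: bounded_map_linear_diff.
split; first by near=> y; have [] := dA y.
move=> v; apply: (@smooth_at_ext _ _ _ (fun p : V * V => A p.2)).
  by near=> p; have [_ ->] := dA (p.1).
apply: IH => [t p q /=|]; first exact: lA.
have [C C0 hC] := bounded_map_pos bA.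
exists C => -[u w]; apply: (le_trans (hC _)); rewrite ler_pM2l//.
by rewrite prod_normE /= le_max lexx orbT.
Unshelve. all: by end_near. Qed.

Lemma smooth_at_fst k (V W : normedModType R) (p : V * W) :
  smooth_at k (fun q : V * W => q.1) p.
Proof.
apply: smooth_at_linear => [//|]; exists 1 => -[u w].
by rewrite mul1r prod_normE /= le_max lexx.
Qed.

Lemma smooth_at_snd k (V W : normedModType R) (p : V * W) :
  smooth_at k (fun q : V * W => q.2) p.
Proof.
apply: smooth_at_linear => [//|]; exists 1 => -[u w].
by rewrite mul1r prod_normE /= le_max lexx orbT.
Qed.

Lemma smooth_at_id k (V : normedModType R) (x : V) : smooth_at k id x.
Proof. by apply: smooth_at_linear => [//|]; exists 1 => v; rewrite mul1r. Qed.

Lemma smooth_at_cst k (V W : normedModType R) (c : W) (x : V) :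
  smooth_at k (fun=> c) x.
Proof.
elim: k V W c x => [|k IH] V W c x; first exact: cvg_cst.
split; first by near=> y; exact: differentiable_cst.
move=> v; apply: (@smooth_at_ext _ _ _ (fun=> 0)); last exact: IH.
by near=> p; rewrite (diff_cst c p.1).
Unshelve. all: by end_near. Qed.

Lemma smooth_at_pair k (U V W : normedModType R) (f : U -> V) (g : U -> W) x :
  smooth_at k f x -> smooth_at k g x -> smooth_at k (fun y => (f y, g y)) x.
Proof.
elim: k U V W f g x => [|k IH] U V W f g x; first by move=> cf cg; apply: cvg_pair.
move=> [df Sf] [dg Sg]; split.
  by near=> y; apply: differentiable_pair; near: y.
move=> v.
apply: (@smooth_at_ext _ _ _ (fun p : U * U => ('d f (p.1) p.2, 'd g (p.1) p.2))).
  near=> p; rewrite diff_pair//; near: p;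
    [exact: (near_fst v df)|exact: (near_fst v dg)].
by apply: IH; [exact: Sf|exact: Sg].
Unshelve. all: by end_near. Qed.

(** By the chain rule, the differential of the composite is that of [g], as a function of point and
    direction, after the tangent map of [f]. Both are of class k, so the induction hypothesis
    applies to them. *)
Lemma smooth_at_comp k (U V W : normedModType R) (f : U -> V) (g : V -> W) x :
  smooth_at k f x -> smooth_at k g (f x) -> smooth_at k (fun y => g (f y)) x.
Proof.
elim: k U V W f g x => [|k IH] U V W f g x.
  by move=> cf cg; exact: continuous_comp cf cg.
move=> Sf [dg Sg].
have cf : {for x, continuous f} := smooth_at_continuous Sf.
have dgf : \forall y \near x, differentiable g (f y) by exact: cf dg.
have Sf' := smooth_at_pred Sf.
move: Sf => [df Sf]; split.
  by near=> y; apply: differentiable_comp; near: y.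
move=> v.
pose h (p : U * U) := (f p.1, 'd f (p.1) p.2).
apply: (@smooth_at_ext _ _ _ (fun p : U * U => (fun q => 'd g (q.1) q.2) (h p))).
  near=> p; rewrite [in RHS](@diff_comp _ _ _ _ f g)//; near: p;
    [exact: (near_fst v df)|exact: (near_fst v dgf)].
apply: (@IH _ _ _ h (fun q : V * V => 'd g (q.1) q.2)); last exact: Sg.
apply: smooth_at_pair; last exact: Sf.
by apply: (@IH _ _ _ fst f); [exact: smooth_at_fst|].
Unshelve. all: by end_near. Qed.

Lemma smooth_atD k (V W : normedModType R) (f g : V -> W) x :
  smooth_at k f x -> smooth_at k g x -> smooth_at k (fun y => f y + g y) x.
Proof.
move=> Sf Sg.
apply: (@smooth_at_comp _ _ _ _ (fun y => (f y, g y)) (fun p : W * W => p.1 + p.2)).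
  exact: smooth_at_pair.
apply: smooth_at_linear => [t p q /=|]; first by rewrite scalerDr addrACA.
exists 2 => -[u v] /=; apply: (le_trans (ler_normD _ _)).
by rewrite prod_normE/= mulr_natl mulr2n lerD// le_max lexx ?orbT.
Qed.

Lemma smooth_atZ k (V W : normedModType R) (f : V -> W) (t : R) x :
  smooth_at k f x -> smooth_at k (fun y => t *: f y) x.
Proof.
move=> Sf; apply: (@smooth_at_comp _ _ _ _ f ( *:%R t)) => //.
apply: smooth_at_linear => [s p q /=|].
  by rewrite scalerDr !scalerA mulrC.
by exists `|t| => v; rewrite normrZ.
Qed.

Lemma smooth_atN k (V W : normedModType R) (f : V -> W) x :
  smooth_at k f x -> smooth_at k (fun y => - f y) x.
Proof.
move=> Sf; have /smooth_at_ext := smooth_atZ (-1) Sf; apply.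
by near=> y; rewrite scaleN1r.
Unshelve. all: by end_near. Qed.

Lemma smooth_atB k (V W : normedModType R) (f g : V -> W) x :
  smooth_at k f x -> smooth_at k g x -> smooth_at k (fun y => f y - g y) x.
Proof. by move=> Sf Sg; apply: smooth_atD => //; exact: smooth_atN. Qed.

Definition bilinear_map (U V W : normedModType R) (B : U -> V -> W) :=
  [/\ forall v, linear (B^~ v), forall u, linear (B u) &
     exists C : R, forall u v, `|B u v| <= C * `|u| * `|v|].

Lemma bilinear_map_pos (U V W : normedModType R) (B : U -> V -> W) :
  bilinear_map B -> exists2 C : R, 0 < C &
     forall u v, `|B u v| <= C * `|u| * `|v|.
Proof.
move=> [_ _ [C hC]]; exists (Num.max C 1); first by rewrite lt_max ltr01 orbT.
move=> u v; apply: le_trans (hC u v) _; apply: ler_wpM2r => //.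
by apply: ler_wpM2r => //; rewrite le_max lexx.
Qed.

(** The remainder at the increment [h] is [B h.1 h.2], which is quadratic. *)
Lemma is_diff_bilinear (U V W : normedModType R) (B : U -> V -> W) (p : U * V) :
  bilinear_map B ->
  is_diff p (fun q => B q.1 q.2) (fun q => B p.1 q.2 + B q.1 p.2).
Proof.
move=> bB; have [C C0 hC] := bilinear_map_pos bB.
case: bB => [lBl lBr _]; apply: is_diff_eps.
- by move=> t u v /=; rewrite lBr lBl scalerDr addrACA.
- exists (2 * C * `|p|) => -[u v] /=.
  have h1 : `|p.1| <= `|p| by rewrite prod_normE le_max lexx.
  have h2 : `|p.2| <= `|p| by rewrite prod_normE le_max lexx orbT.
  have h3 : `|u| <= `|(u, v)| by rewrite prod_normE le_max lexx.
  have h4 : `|v| <= `|(u, v)| by rewrite prod_normE le_max lexx orbT.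
  apply: (le_trans (ler_normD _ _)).
  rewrite -!mulrA mulr_natl mulr2n lerD//.
    apply: (le_trans (hC _ _)); rewrite -mulrA ler_pM2l//.
    by rewrite ler_pM.
  apply: (le_trans (hC _ _)); rewrite -mulrA ler_pM2l//.
  by rewrite mulrC ler_pM.
- move=> e e0; near=> h.
  rewrite (linearmapD (lBr _)) !(linearmapD (lBl _)).
  have -> : B p.1 p.2 + B h.1 p.2 + (B p.1 h.2 + B h.1 h.2) - B p.1 p.2 -
    (B p.1 h.2 + B h.1 p.2) = B h.1 h.2.
    by apply/eqP; rewrite !subr_eq (AC (2*2) (4*(3*2)*1)).
  apply: (le_trans (hC _ _)).
  have h1 : `|h.1| <= `|h| by rewrite prod_normE le_max lexx.
  have h2 : `|h.2| <= `|h| by rewrite prod_normE le_max lexx orbT.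
  apply: ler_pM => //; first by rewrite mulr_ge0// ltW.
  rewrite mulrC -ler_pdivlMr//; apply: (le_trans h1); near: h.
  apply: (@cvgr0_norm_le _ _ _ _ _ id) => //; exact: divr_gt0.
Unshelve. all: by end_near. Qed.

(** The differential is a sum of two copies of [B] precomposed with projections, so the induction
    closes on [B] itself. *)
Lemma smooth_at_bilinear k (U V W : normedModType R) (B : U -> V -> W) p :
  bilinear_map B -> smooth_at k (fun q : U * V => B q.1 q.2) p.
Proof.
move=> bB; elim: k p => [|k IH] p.
  apply: differentiable_continuous; by have [] := is_diff_bilinear p bB.
split; first by near=> y; have [] := is_diff_bilinear y bB.
move=> v; apply: (@smooth_at_ext _ _ _
    (fun q : (U * V) * (U * V) => B q.1.1 q.2.2 + B q.2.1 q.1.2)).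
  by near=> q; have [_ ->] := is_diff_bilinear (q.1) bB.
have S11 (q : (U * V) * (U * V)) : smooth_at k (fun q : (U * V) * (U * V) => q.1.1) q.
  by apply: (@smooth_at_comp _ _ _ _ fst fst); exact: smooth_at_fst.
have S12 (q : (U * V) * (U * V)) : smooth_at k (fun q : (U * V) * (U * V) => q.1.2) q.
  by apply: (@smooth_at_comp _ _ _ _ fst snd);[exact: smooth_at_fst|exact: smooth_at_snd].
have S21 (q : (U * V) * (U * V)) : smooth_at k (fun q : (U * V) * (U * V) => q.2.1) q.
  by apply: (@smooth_at_comp _ _ _ _ snd fst);[exact: smooth_at_snd|exact: smooth_at_fst].
have S22 (q : (U * V) * (U * V)) : smooth_at k (fun q : (U * V) * (U * V) => q.2.2) q.
  by apply: (@smooth_at_comp _ _ _ _ snd snd); exact: smooth_at_snd.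
apply: smooth_atD.
  apply: (@smooth_at_comp _ _ _ _ (fun q : (U * V) * (U * V) => (q.1.1, q.2.2))
    (fun q => B q.1 q.2)); last exact: IH.
  exact: smooth_at_pair.
apply: (@smooth_at_comp _ _ _ _ (fun q : (U * V) * (U * V) => (q.2.1, q.1.2))
    (fun q => B q.1 q.2)); last exact: IH.
exact: smooth_at_pair.
Unshelve. all: by end_near. Qed.

Lemma smooth_at_bil k (X U V W : normedModType R) (B : U -> V -> W)
    (f : X -> U) (g : X -> V) x : bilinear_map B ->
  smooth_at k f x -> smooth_at k g x -> smooth_at k (fun y => B (f y) (g y)) x.
Proof.
move=> bB Sf Sg.
apply: (@smooth_at_comp _ _ _ _ (fun y => (f y, g y)) (fun q => B q.1 q.2)).
  exact: smooth_at_pair.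
exact: smooth_at_bilinear.
Qed.

Lemma smooth_at_lin k (X U W : normedModType R) (A : U -> W) (f : X -> U) x :
  linear A -> bounded_map A ->
  smooth_at k f x -> smooth_at k (fun y => A (f y)) x.
Proof.
by move=> lA bA Sf; apply: (@smooth_at_comp _ _ _ _ f A) => //; exact: smooth_at_linear.
Qed.

(** Freezing the direction, that is precomposing the tangent form with [x -> (x, v)], gives the
    directional form used by [Ck_on]. *)
Lemma smooth_at_Ck_on k (V W : normedModType R) (U : set V) (f : V -> W) :
  (forall x, U x -> smooth_at k f x) -> Ck_on k U f.
Proof.
elim: k f => [//|k IH] f Sf /=; split.
  by move=> x Ux; have [/nbhs_singleton] := Sf x Ux.
move=> v; apply: IH => x Ux.
apply: (@smooth_at_comp _ _ _ _ (fun x => (x, v)) (fun p => 'd f (p.1) p.2)).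
  by apply: smooth_at_pair; [exact: smooth_at_id|exact: smooth_at_cst].
by have [_] := Sf x Ux; apply.
Qed.

End Smooth.

(** * Mean value inequality and limits of differentials *)

Section MeanValue.
Variable R : realType.

Lemma cvg_norm_le (W : normedModType R) (u : nat -> W) l (c : R) :
  u @ \oo --> l -> (\forall n \near \oo, `|u n| <= c) -> `|l| <= c.
Proof.
move=> ul uc; apply/ler_addgt0Pr => e e0.
near \oo => n.
have h1 : `|l - u n| <= e by near: n; exact: cvgr_dist_le.
have h2 : `|u n| <= c by near: n.
rewrite -(subrK (u n) l); apply: (le_trans (ler_normD _ _)).
by rewrite addrC lerD.
Unshelve. all: by end_near. Qed.

(* The supremum of the times at which the bound holds is attained and equals 1. *)
Lemma lipschitz_path (W : normedModType R) (g : R -> W) (k : R) : 0 <= k ->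
  (forall t : R, 0 <= t <= 1 -> \forall s \near t, `|g s - g t| <= k * `|s - t|) ->
  `|g 1 - g 0| <= k.
Proof.
move=> k0 H.
pose A : set R := [set t | 0 <= t <= 1 /\ `|g t - g 0| <= k * t].
have A0 : A 0 by split; rewrite ?lexx ?ler01// subrr normr0 mulr0.
have supA : has_sup A.
  split; first by exists 0.
  by exists 1 => t [/andP[]].
set c := sup A.
have /ubP ubA := sup_upper_bound supA; rewrite -/c in ubA.
have c0 : 0 <= c by apply: ubA _ A0.
have c1 : c <= 1 by apply: ge_sup; [exists 0|move=> t [/andP[]]].
have /nbhs_ballP [e /= e0 he] := H c (introT andP (conj c0 c1)).
have Ac : A c.
  split; first by rewrite c0.
  have [s As cs] := sup_adherent e0 supA.
  have sc : s <= c by apply: ubA _ As.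
  have : `|g s - g c| <= k * `|s - c|.
    by apply: he; rewrite /ball /= ger0_norm ?subr_ge0// ltrBlDr -ltrBlDl.
  rewrite ler0_norm ?subr_le0// opprB => h.
  rewrite -(subrK (g s) (g c)) -addrA; apply: (le_trans (ler_normD _ _)).
  apply: (@le_trans _ _ (k * (c - s) + k * s)); last first.
    by rewrite -mulrDr subrK.
  by rewrite lerD//; [rewrite distrC|case: As].
case: (ltrP c 1) => [c1'|c1']; last first.
  have c1E : c = 1 by apply/le_anti; rewrite c1.
  by case: Ac => _; rewrite c1E mulr1.
(* Half the radius [e] keeps [t] in the ball around [c], and [1 - c] keeps it in [0, 1]; as [t]
   exceeds the supremum [c], membership in [A] is absurd. *)
pose t := c + Num.min (e / 2) (1 - c).
have t0 : c < t by rewrite ltrDl lt_min divr_gt0//= subr_gt0.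
suff : A t by move=> /ubA; rewrite leNgt t0.
have tc0 : 0 <= t - c by rewrite subr_ge0 ltW.
split.
  rewrite (le_trans c0 (ltW t0))/= /t -lerBrDl ge_min lexx orbT//.
rewrite -(subrK (g c) (g t)) -addrA; apply: (le_trans (ler_normD _ _)).
apply: (@le_trans _ _ (k * (t - c) + k * c)); last by rewrite -mulrDr subrK.
rewrite lerD//; last by case: Ac.
rewrite -[in leRHS](ger0_norm tc0); apply: he; rewrite /ball /= distrC.
rewrite (ger0_norm tc0) /t addrAC subrr add0r.
by rewrite gt_min ltr_pdivrMr// ltr_pMr// ltr1n.
Qed.

(** The segment from [y] to [x] stays in the ball by convexity. Differentiability gives along it the
    local slope [M + e'] for every [e' > 0], which is what [lipschitz_path] consumes; [e'] is chosen
    so that the excess is at most [e]. *)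
Lemma mvt_ball (V W : normedModType R) (g : V -> W) p (d M : R) : 0 <= M ->
  (forall x, `|p - x| < d -> differentiable g x) ->
  (forall x, `|p - x| < d -> forall v, `|'d g x v| <= M * `|v|) ->
  forall x y, `|p - x| < d -> `|p - y| < d -> `|g x - g y| <= M * `|x - y|.
Proof.
move=> M0 dg gM x y px py; apply/ler_addgt0Pr => e e0.
pose n := `|x - y| + 1.
have n0 : 0 < n by rewrite ltr_wpDl.
pose e' := e / n.
have e'0 : 0 < e' by rewrite divr_gt0.
pose z t := y + t *: (x - y).
have zd t : 0 <= t <= 1 -> `|p - z t| < d.
  move=> /andP[t0 t1].
  have -> : p - z t = (1 - t) *: (p - y) + t *: (p - x).
    rewrite /z scalerBl scale1r -[RHS]addrA [in LHS]opprD [in LHS]addrA.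
    congr (_ + _); rewrite -!scalerN -scalerDr !opprB; congr (_ *: _).
    by rewrite addrA subrK.
  apply: (le_lt_trans (ler_normD _ _)); rewrite !normrZ.
  rewrite (ger0_norm t0) ger0_norm ?subr_ge0//.
  have : exists2 m, m < d & `|p - y| <= m /\ `|p - x| <= m.
    exists (Num.max `|p - y| `|p - x|); first by rewrite gt_max px py.
    by rewrite !le_max !lexx orbT.
  move=> [m md [ym xm]]; apply: le_lt_trans md.
  apply: (@le_trans _ _ ((1 - t) * m + t * m)); last by rewrite -mulrDl subrK mul1r.
  by rewrite lerD// ler_wpM2l// subr_ge0.
have z1 : z 1 = x by rewrite /z scale1r addrC subrK.
have z0 : z 0 = y by rewrite /z scale0r addr0.
have xy : `|g x - g y| <= (M + e') * `|x - y|; last first.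
  apply: (le_trans xy); rewrite mulrDl lerD2l /e' -mulrA ger_pMr//.
  by rewrite mulrC ler_pdivrMr// mul1r /n lerDl.
rewrite -[in leLHS]z1 -[in leLHS]z0; apply: (@lipschitz_path _ (g \o z)).
- by rewrite mulr_ge0// addr_ge0// ltW.
- move=> t t01.
  have c : (fun s : R => (s - t) *: (x - y)) @ t --> (0 : V).
    rewrite -[X in _ --> X](scale0r (x - y)) -(subrr t).
    apply: cvgZr_tmp; apply: cvgB; [exact: cvg_id|exact: cvg_cst].
  near=> s; have hs : `|g (z t + (s - t) *: (x - y)) - g (z t) -
      'd g (z t) ((s - t) *: (x - y))| <= e' * `|(s - t) *: (x - y)|.
    by near: s; exact: c _ (differentiable_eps (dg _ (zd t t01)) e'0).
  have zs : z s = z t + (s - t) *: (x - y).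
    by rewrite /z -addrA -scalerDl [t + _]addrC subrK.
  rewrite /= zs -(subrK ('d g (z t) ((s - t) *: (x - y))) (_ - _)).
  apply: (le_trans (ler_normD _ _)).
  apply: (le_trans (lerD hs (gM _ (zd t t01) _))).
  by rewrite -mulrDl normrZ [e' + _]addrC -mulrA [`|s - t| * _]mulrC.
Unshelve. all: by end_near. Qed.

(** The mean value inequality for [f n - f m] compares increments uniformly in [m]; letting [m] go
    to infinity replaces [f m] by [phi]. Linearity and boundedness of [psi x] are inherited from the
    differentials that converge to it. *)
Lemma diff_limit (V W : normedModType R) (f : nat -> V -> W) (phi : V -> W)
    (psi : V -> V -> W) p (d : R) :
  (forall n x, `|p - x| < d -> differentiable (f n) x) ->
  (forall x, `|p - x| < d -> f n x @[n --> \oo] --> phi x) ->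
  (forall e : R, 0 < e -> \forall n \near \oo, forall x, `|p - x| < d ->
     forall v, `|'d (f n) x v - psi x v| <= e * `|v|) ->
  forall x, `|p - x| < d -> is_diff x phi (psi x).
Proof.
move=> df fphi fpsi x px.
have psil v : 'd (f n) x v @[n --> \oo] --> psi x v.
  apply/cvgrPdist_le => e e0.
  have n0 : 0 < `|v| + 1 by rewrite ltr_wpDl.
  near=> n; rewrite distrC.
  apply: (@le_trans _ _ (e / (`|v| + 1) * `|v|)); last first.
    by rewrite -mulrA ger_pMr// mulrC ler_pdivrMr// mul1r lerDl.
  have : forall x, `|p - x| < d ->
     forall w, `|'d (f n) x w - psi x w| <= e / (`|v| + 1) * `|w|.
    near: n.
    have ep : 0 < e / (`|v| + 1) by rewrite divr_gt0.
    exact: fpsi ep.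
  by apply.
have lpsi : linear (psi x).
  move=> t u v.
  have h1 := psil (t *: u + v).
  have h2 : 'd (f n) x (t *: u + v) @[n --> \oo] --> t *: psi x u + psi x v.
    under eq_fun do rewrite linearP.
    by apply: cvgD => //; exact: cvgZl_tmp.
  exact: (cvg_unique (@norm_hausdorff _ _) h1 h2).
have [N _ hN] := fpsi 1 ltr01.
have bpsi : bounded_map (psi x).
  have [C hC] := diff_bounded (df N x px).
  exists (1 + C) => v.
  rewrite -(subrK ('d (f N) x v) (psi x v)) mulrDl.
  apply: (le_trans (ler_normD _ _)); rewrite lerD//.
  by rewrite distrC; apply: (hN N) => /=.
apply: is_diff_eps => // e e0.
(* Two quarters for comparing [f n] with [phi], one for the differentiability of [f n], one for
   replacing its differential by [psi x]. *)
pose e' := e / 4.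
have e'0 : 0 < e' by rewrite divr_gt0.
have [n _ hn] := fpsi e' e'0.
have Hn (m : nat) : (n <= m)%N -> forall x y, `|p - x| < d -> `|p - y| < d ->
    `|(f n x - f m x) - (f n y - f m y)| <= (e' + e') * `|x - y|.
  move=> nm; apply: (@mvt_ball _ _ (f n \- f m)).
  - by rewrite addr_ge0// ltW.
  - by move=> z pz; apply: differentiableB; exact: df.
  - move=> z pz v; rewrite (@diffB _ _ _ (f n) (f m)); [|exact: df..].
    have -> : ('d (f n) z \- 'd (f m) z) v =
        ('d (f n) z v - psi z v) - ('d (f m) z v - psi z v).
      by rewrite /= opprB addrA subrK.
    apply: (le_trans (ler_normB _ _)); rewrite mulrDl lerD//.
      exact: (hn n (leqnn n) z pz v).
    exact: (hn m nm z pz v).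
have Hphi y : `|p - y| < d -> 
    `|(f n y - phi y) - (f n x - phi x)| <= (e' + e') * `|y - x|.
  move=> py.
  apply: (@cvg_norm_le _ (fun m => (f n y - f m y) - (f n x - f m x))).
    by apply: cvgB; (apply: cvgB; [exact: cvg_cst|exact: fphi]).
  by exists n => // m /= nm; exact: Hn.
near=> h.
have pxh : `|p - (x + h)| < d.
  rewrite opprD addrA; apply: (le_lt_trans (ler_normB _ _)).
  rewrite -ltrBrDl; near: h.
  by apply: (@cvgr0_norm_lt _ _ _ _ _ id) => //; rewrite subr_gt0.
have h1 := Hphi _ pxh.
have h2 : `|f n (x + h) - f n x - 'd (f n) x h| <= e' * `|h|.
  by near: h; exact: differentiable_eps (df n x px) _ e'0.
have h3 : `|'d (f n) x h - psi x h| <= e' * `|h| by apply: (hn n) => /=.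
have -> : phi (x + h) - phi x - psi x h =
  - ((f n (x + h) - phi (x + h)) - (f n x - phi x)) +
  (f n (x + h) - f n x - 'd (f n) x h) + ('d (f n) x h - psi x h).
  rewrite [RHS]addrA; congr (_ - _).
  rewrite -[RHS]addrA subrK !opprB.
  by rewrite (AC (2*2*2) ((1*6)*(4*5)*(3*2)))/= subrr addNr !add0r.
rewrite (_ : e = (e' + e') + e' + e'); last first.
  by rewrite /e'; lra.
rewrite mulrDl; apply: (le_trans (ler_normD _ _)); rewrite lerD//.
rewrite mulrDl; apply: (le_trans (ler_normD _ _)); rewrite lerD//.
by rewrite normrN; move: h1; rewrite [x + h - x]addrC addKr.
Unshelve. all: by end_near. Qed.
End MeanValue.

(** * Attracting systems *)

Section Attracting.
Variable R : realType.

(** A nonzero vector is rescaled to norm [d / 2], strictly inside the ball, hence the factor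
    [2 / d]. *)
Lemma homogeneous_bound (V W : normedModType R) (A : V -> W) (d M : R) :
  0 < d -> (forall t v, A (t *: v) = t *: A v) ->
  (forall v, `|v| < d -> `|A v| <= M) -> forall v, `|A v| <= M * (2 / d) * `|v|.
Proof.
move=> d0 hA bA v; have [->|v0] := eqVneq v 0.
  by have := hA 0 0; rewrite !scale0r => ->; rewrite !normr0 mulr0.
have nv0 : 0 < `|v| by rewrite normr_gt0.
pose t := d / 2 / `|v|.
have t0 : 0 < t by rewrite !divr_gt0.
have tv : `|t *: v| < d.
  by rewrite normrZ gtr0_norm// /t divfK ?gt_eqF// gtr_pMr// invf_lt1// ltr1n.
have := bA _ tv; rewrite hA normrZ gtr0_norm// mulrC -ler_pdivlMr// => /le_trans.
by apply; rewrite /t !invf_div -mulrA [`|v| * _]mulrC.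
Qed.

Lemma pair_norm_fst (V W : normedModType R) (p : V * W) : `|p.1| <= `|p|.
Proof. by rewrite prod_normE le_max lexx. Qed.

Lemma pair_norm_snd (V W : normedModType R) (p : V * W) : `|p.2| <= `|p|.
Proof. by rewrite prod_normE le_max lexx orbT. Qed.

Lemma pair_norm_lt (V W : normedModType R) (p : V * W) d :
  `|p.1| < d -> `|p.2| < d -> `|p| < d.
Proof. by move=> h1 h2; rewrite prod_normE gt_max h1. Qed.

Lemma nearP_norm (V : normedModType R) (p : V) (P : V -> Prop) :
  (\forall x \near p, P x) <->
  exists2 d : R, 0 < d & forall x, `|p - x| < d -> P x.
Proof.
split.
  move=> /nbhs_ballP [d /= d0 hd]; exists d => // x px; apply: hd.
  by rewrite -ball_normE.
move=> [d d0 hd]; apply/nbhs_ballP; exists d => //= x; rewrite -ball_normE.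
exact: hd.
Qed.

Lemma diff_cvg (V W : normedModType R) (g : V -> W) x v : differentiable g x ->
  h^-1 *: (g (x + h *: v) - g x) @[h --> (0 : R)^'] --> 'd g x v.
Proof.
move=> dg; rewrite -deriveE//.
rewrite (_ : (fun h => _) = (fun h => h^-1 *: ((g \o shift x) (h *: v) - g x))).
  exact: (@diff_derivable _ _ _ g x v dg).
by apply/funext => h; rewrite /= [x + _]addrC.
Qed.

Lemma cvg_near_eq (T : Type) (F : set_system T) (FF : Filter F)
    (U : topologicalType) (f g : T -> U) (l : U) :
  (\forall h \near F, f h = g h) -> f @ F --> l -> g @ F --> l.
Proof.
move=> fg fl; apply: cvg_trans fl; apply: near_eq_cvg.
by near=> h; near: h.
Unshelve. all: by end_near. Qed.

Section LinearSecond.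
Variables (V W U : normedModType R) (g : V * W -> U) (x : V).
Hypothesis lg : \forall x' \near x, linear (fun w => g (x', w)).
Hypothesis dg : forall w, differentiable g (x, w).

(** Base point and direction vary together: the difference quotients of [g] are linear in the pair
    [(w, omega)], and so is their limit. This is what keeps tangent systems linear in the defect. *)
Lemma diff_snd_linear xi :
  linear (fun q : W * W => 'd g (x, q.1) (xi, q.2)).
Proof.
move=> t q q'.
have H (s : W * W) := @diff_cvg _ _ g (x, s.1) (xi, s.2) (dg s.1).
have h1 := H (t *: q + q').
have h2 := cvgD (cvgZl_tmp (k := t) (H q)) (H q').
apply: (cvg_unique (@norm_hausdorff _ _) h1).
suff : (fun h => h^-1 *: (g ((x, (t *: q + q').1) + h *: (xi, (t *: q + q').2)) -
   g (x, (t *: q + q').1))) @ (0 : R)^' -->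
   (t *: 'd g (x, q.1) (xi, q.2) + 'd g (x, q'.1) (xi, q'.2)) by [].
have c : (fun h : R => x + h *: xi) @ (0 : R)^' --> x.
  rewrite -[X in _ --> X]addr0 -(scale0r xi).
  apply: cvgD; first exact: cvg_cst.
  by apply: cvgZr_tmp; exact: nbhs_dnbhs.
have FF : Filter (0 : R)^' by exact: dnbhs_filter.
apply: cvg_near_eq (h2 FF FF); near=> h.
have l0 : linear (fun w => g (x, w)) by exact: nbhs_singleton lg.
have l1 : linear (fun w => g (x + h *: xi, w)).
  near: h; exact: c lg.
rewrite /= -[RHS]/(h^-1 *: (g (x + h *: xi, t *: q.1 + q'.1 + h *: (t *: q.2 + q'.2)) -
  g (x, t *: q.1 + q'.1))).
have -> : t *: q.1 + q'.1 + h *: (t *: q.2 + q'.2) =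
    t *: (q.1 + h *: q.2) + (q'.1 + h *: q'.2).
  by rewrite !scalerDr addrACA !scalerA [h * t]mulrC.
rewrite [g (x + _, _ + _)]l1 [g (x, _ + _)]l0 /= opprD addrACA -scalerBr scalerDr.
by rewrite !scalerA [h^-1 * t]mulrC -scalerA.
Unshelve. all: by end_near. Qed.

Lemma diff_snd0 w om : 'd g (x, w) (0, om) = g (x, om).
Proof.
have h1 := @diff_cvg _ _ g (x, w) (0, om) (dg w).
have l0 : linear (fun w => g (x, w)) by exact: nbhs_singleton lg.
have h2 : (fun=> g (x, om)) @ (0 : R)^' --> g (x, om) by exact: cvg_cst.
apply: (cvg_unique (@norm_hausdorff _ _) h1).
apply: cvg_near_eq h2; near=> h.
rewrite -[RHS]/(h^-1 *: (g (x + h *: 0, w + h *: om) - g (x, w))).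
rewrite scaler0 addr0 [w + _]addrC [g (x, _ + _)]l0 addrK scalerA mulVf ?scale1r//.
by near: h; exact: nbhs_dnbhs_neq.
Unshelve. all: by end_near. Qed.

End LinearSecond.

Lemma near_norm_le1 (V W : normedModType R) (g : V -> W) p : g p = 0 ->
  {for p, continuous g} -> \forall q \near p, `|g q| <= 1.
Proof.
move=> g0 cg; have /cvgrPdist_le /(_ 1 ltr01) : g @ p --> g p by exact: cg.
by rewrite g0; apply: filterS => q; rewrite sub0r normrN.
Qed.

(** Continuity at [(p, 0)], where [g] vanishes, bounds [g] by 1 on a ball; homogeneity in [w] turns
    this into an operator bound uniform in [x]. *)
Lemma linear_snd_bound (V W U : normedModType R) (g : V * W -> U) p :
  (\forall x \near p, linear (fun w => g (x, w))) ->
  {for (p, 0), continuous g} ->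
  exists2 C : R, 0 < C & \forall x \near p, forall w, `|g (x, w)| <= C * `|w|.
Proof.
move=> lg cg.
have g0 : g (p, 0) = 0 by exact: (linearmap0 (nbhs_singleton lg)).
have : \forall q \near (p, 0 : W), `|g q| <= 1 by exact: near_norm_le1.
move=> /nearP_norm [d d0 hd].
exists (2 / d); first by rewrite divr_gt0.
near=> x => w; rewrite -[X in X * `|w|]mul1r.
have lx : linear (fun w => g (x, w)) by near: x.
apply: (@homogeneous_bound _ _ (fun w => g (x, w))) => //.
  by move=> t v; rewrite (linearmapZ lx).
move=> v vd; apply: hd; apply: pair_norm_lt => /=; last by rewrite sub0r normrN.
near: x; apply/nearP_norm; by exists d.
Unshelve. all: by end_near. Qed.

(** The quantity is linear in [xi] and in [w] separately, so continuity of the differential at the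
    zero direction over [(p, 0)], followed by two rescalings, gives a bound uniform in [x]. *)
Lemma linear_snd_diff_bound (V W U : normedModType R) (g : V * W -> U) p :
  (\forall x \near p, linear (fun w => g (x, w))) ->
  (\forall x \near p, forall w, differentiable g (x, w)) ->
  smooth_at 1 g (p, 0) ->
  exists2 C : R, 0 < C & \forall x \near p, forall w xi,
    `|'d g (x, w) (xi, 0)| <= C * `|xi| * `|w|.
Proof.
move=> lg dg [_ /(_ (0, 0)) cg].
have : \forall q \near ((p, 0 : W), (0 : V, 0 : W)), `|'d g (q.1) q.2| <= 1.
  by apply: (near_norm_le1 _ cg); rewrite /= linear0.
move=> /nearP_norm [d d0 hd].
exists ((2 / d) * (2 / d)); first by rewrite mulr_gt0// divr_gt0.
have lgg : \forall x \near p, \forall x' \near x, linear (fun w => g (x', w)).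
  exact: near_join.
near=> x => w xi.
have lx : \forall x' \near x, linear (fun w => g (x', w)) by near: x.
have dx : forall w, differentiable g (x, w) by near: x.
have px : `|p - x| < d by near: x; apply/nearP_norm; exists d.
pose D := 2 / d; rewrite -/D.
have lw (z : V) : linear (fun w => 'd g (x, w) (z, 0)).
  move=> t u v; have := diff_snd_linear lx dx z t (u, 0) (v, 0).
  by rewrite /= scaler0 addr0.
have lxi (v : W) : linear (fun xi => 'd g (x, v) (xi, 0)).
  move=> t u z; rewrite -linearP; congr ('d g _ _).
  by rewrite -[RHS]/(t *: u + z, t *: 0 + 0) scaler0 addr0.
have -> : D * D * `|xi| * `|w| = (1 * D * `|w|) * D * `|xi| by ring.
apply: (@homogeneous_bound _ _ (fun xi => 'd g (x, w) (xi, 0))) => //.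
  by move=> t v; rewrite (linearmapZ (lxi w)).
move=> z zd.
apply: (@homogeneous_bound _ _ (fun w => 'd g (x, w) (z, 0))) => //.
  by move=> t v; rewrite (linearmapZ (lw z)).
move=> v vd; apply: (hd ((x, v), (z, 0))).
by apply: pair_norm_lt => /=; apply: pair_norm_lt => //=;
  rewrite ?sub0r ?normrN ?normr0.
Unshelve. all: by end_near. Qed.

(** Mean value inequality in [x] at fixed [w]: the linear maps [g (x, _)] approach [g (p, _)] in
    operator norm, so that a contraction at [p] persists nearby. *)
Lemma linear_snd_lipschitz (V W U : normedModType R) (g : V * W -> U) p :
  (\forall x \near p, linear (fun w => g (x, w))) ->
  (\forall x \near p, forall w, differentiable g (x, w)) ->
  smooth_at 1 g (p, 0) ->
  exists2 C : R, 0 < C & \forall x \near p, forall w,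
    `|g (x, w) - g (p, w)| <= C * `|x - p| * `|w|.
Proof.
move=> lg dg sg; have [C C0] := linear_snd_diff_bound lg dg sg.
move=> /nearP_norm [d1 d10 hC]; move/nearP_norm: dg => [d2 d20 dg].
pose d := Num.min d1 d2; have d0 : 0 < d by rewrite lt_min d10.
have gE w x : `|p - x| < d ->
    is_diff x (fun x => g (x, w)) (fun xi => 'd g (x, w) (xi, 0)).
  rewrite lt_min => /andP[x1 x2].
  have i1 : is_diff x (fun x : V => (x, w)) (fun xi : V => (xi, 0 : W)).
    have := @is_diff_pair R V V W id id (fun=> w) 0 x _ _.
    exact.
  by have := @is_diff_comp R V _ U (fun x : V => (x, w)) _ g _ x i1
    (differentiableP (dg _ x2 w)).
exists C => //; apply/nearP_norm; exists d => // x px w.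
rewrite -mulrA [`|x - p| * _]mulrC mulrA.
apply: (@mvt_ball _ _ _ (fun x => g (x, w)) p d) => //.
- by rewrite mulr_ge0// ltW.
- by move=> y py; have [] := gE w y py.
- move=> y py v; have [_ ->] := gE w y py.
  rewrite -mulrA [`|w| * _]mulrC mulrA; apply: hC.
  by move: py; rewrite lt_min => /andP[].
- by rewrite subrr normr0.
Qed.
End Attracting.

(** * Orbits near an attracting point *)

Section AttractingSystem.
Variable R : realType.

(* [f] moves [x] by an amount linear in a defect [y x], which vanishes at [p] and
   is itself mapped linearly and contractingly (at [p], for the norm [N]). *)
Record attracting (V W : normedModType R) (f : V -> V) (y : V -> W)
    (a : V * W -> V) (b : V * W -> W) (p : V) (N : W -> R) (rho : R) : Prop :=
  Attracting {
    att_f : forall k, \forall x \near p, smooth_at k f x;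
    att_y : forall k, \forall x \near p, smooth_at k y x;
    att_a : forall k, \forall x \near p, forall w, smooth_at k a (x, w);
    att_b : forall k, \forall x \near p, forall w, smooth_at k b (x, w);
    att_fE : \forall x \near p, f x = x + a (x, y x);
    att_yE : \forall x \near p, y (f x) = b (x, y x);
    att_la : \forall x \near p, linear (fun w => a (x, w));
    att_lb : \forall x \near p, linear (fun w => b (x, w));
    att_y0 : y p = 0;
    att_N1 : forall w, `|w| <= N w;
    att_N2 : exists C : R, forall w, N w <= C * `|w|;
    att_ND : forall u v, N (u + v) <= N u + N v;
    att_rho : 0 <= rho < 1;
    att_b_contr : forall w, N (b (p, w)) <= rho * N w }.

(** While the orbit stays in a small ball, the defect decays like [s ^+ n] and the steps have a
    geometric sum; a small initial defect makes that sum at most half the radius, so the orbit never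
    leaves. The constant [K] does not depend on the starting point. *)
Lemma attract_orbit (V W : normedModType R) (f : V -> V) (y : V -> W) a b p N
    rho : attracting f y a b p N rho -> forall e : R, 0 < e ->
  exists (d K s : R), [/\ 0 < d, 0 <= K, 0 <= s < 1 & forall x, `|p - x| < d ->
    forall n, `|p - iter n f x| < e /\
      forall m, `|iter (n + m) f x - iter n f x| <= K * s ^+ n].
Proof.
move=> H e e0; have /andP[rho0 rho1] := att_rho H.
have [CN hCN] := att_N2 H.
have N0 w : 0 <= N w by apply: le_trans (att_N1 H w).
(* The gap [s - rho] pays for replacing [b (p, _)] by [b (x, _)]. *)
pose s := (rho + 1) / 2.
have rs : rho < s by rewrite /s; lra.
have s1 : s < 1 by rewrite /s; lra.
have s0 : 0 < s by apply: le_lt_trans rs.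
have [C C0 hC] := linear_snd_bound (att_la H)
  (smooth_at_continuous ((nbhs_singleton (att_a H 0)) 0)).
have db : \forall x \near p, forall w, differentiable b (x, w).
  near=> x => w; apply: (@smooth_at_diff _ 0).
  have : forall w, smooth_at 1 b (x, w) by near: x; exact: att_b H 1%N.
  exact.
have [D D0 hD] := linear_snd_lipschitz (att_lb H) db
  ((nbhs_singleton (att_b H 1%N)) 0).
pose CN' := Num.max CN 1.
have CN'0 : 0 < CN' by rewrite lt_max ltr01 orbT.
have hCN' w : N w <= CN' * `|w|.
  by apply: (le_trans (hCN w)); rewrite ler_wpM2r// le_max lexx.
have hb : \forall x \near p, forall w, N (b (x, w)) <= s * N w.
  near=> x => w.
  have h1 : `|b (x, w) - b (p, w)| <= D * `|x - p| * `|w|.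
    have : forall w, `|b (x, w) - b (p, w)| <= D * `|x - p| * `|w| by near: x.
    exact.
  have h2 : `|x - p| <= (s - rho) / (CN' * D).
    rewrite distrC; apply/ltW; near: x; apply/nearP_norm.
    by exists ((s - rho) / (CN' * D)) => //; rewrite divr_gt0 ?subr_gt0// mulr_gt0.
  rewrite -(subrK (b (p, w)) (b (x, w))).
  apply: (le_trans (att_ND H _ _)).
  rewrite -[s](subrK rho) mulrDl lerD//; last exact: att_b_contr H w.
  apply: (le_trans (hCN' _)).
  apply: (@le_trans _ _ (CN' * (D * `|x - p| * `|w|))).
    by rewrite ler_pM2l.
  rewrite !mulrA; apply: ler_pM => //; last exact: att_N1 H w.
    by rewrite !mulr_ge0// ltW.
  by rewrite mulrC -ler_pdivlMr// mulr_gt0.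
have : \forall x \near p, [/\ f x = x + a (x, y x), y (f x) = b (x, y x),
    forall w, `|a (x, w)| <= C * `|w| & forall w, N (b (x, w)) <= s * N w].
  near=> x; split; near: x => //; [exact: att_fE H|exact: att_yE H].
move=> /nearP_norm [d0 d00 hd0].
pose d1 := Num.min e d0; have d10 : 0 < d1 by rewrite lt_min e0.
have {}hd0 x : `|p - x| < d1 -> [/\ f x = x + a (x, y x), y (f x) = b (x, y x),
    forall w, `|a (x, w)| <= C * `|w| & forall w, N (b (x, w)) <= s * N w].
  by rewrite lt_min => /andP[_]; exact: hd0.
have yc : {for p, continuous y} by exact: smooth_at_continuous (nbhs_singleton (att_y H 0)).
(* Solves [C * (CN' * r) / (1 - s) = d1 / 2]: below this size of defect, the whole orbit has length
   at most [d1 / 2]. *)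
pose r := d1 / 2 * (1 - s) / C / CN'.
have r0 : 0 < r by rewrite !divr_gt0// mulr_gt0// ?divr_gt0// subr_gt0.
have : \forall x \near p, `|y x| < r.
  have /cvgrPdist_lt /(_ r r0) : y @ p --> y p by exact: yc.
  by rewrite (att_y0 H); apply: filterS => x; rewrite sub0r normrN.
move=> /nearP_norm [d2 d20 hd2].
exists (Num.min d2 (d1 / 2)), (d1 / 2), s; split.
- by rewrite lt_min d20 divr_gt0.
- by rewrite divr_ge0// ltW.
- by rewrite s1 ltW.
move=> x; rewrite lt_min => /andP[/hd2 yr px].
(* The sum of the geometric bounds on all steps. In this form step [n] is at most
   [A * (s ^+ n - s ^+ n.+1)], and the bounds telescope. *)
pose A := C * N (y x) / (1 - s).
have s10 : 0 < 1 - s by rewrite subr_gt0.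
have A0 : 0 <= A by rewrite mulr_ge0// ?mulr_ge0 ?invr_ge0// ltW.
have AK : A <= d1 / 2.
  rewrite ler_pdivrMr// mulrC -ler_pdivlMr//.
  apply: (le_trans (hCN' _)); rewrite mulrC -ler_pdivlMr//; exact: ltW.
have step n : `|p - iter n f x| < d1 -> N (y (iter n f x)) <= s ^+ n * N (y x) ->
    `|iter n.+1 f x - iter n f x| <= A * (s ^+ n - s ^+ n.+1).
  move=> h1 h2; have [fE _ aE _] := hd0 _ h1.
  rewrite iterS fE addrC addKr; apply: (le_trans (aE _)).
  have -> : A * (s ^+ n - s ^+ n.+1) = C * (s ^+ n * N (y x)).
    by rewrite /A exprS; field; rewrite gt_eqF.
  by rewrite ler_pM2l//; apply: le_trans h2; exact: att_N1 H _.
have P n : [/\ `|p - iter n f x| < d1, N (y (iter n f x)) <= s ^+ n * N (y x) &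
    `|iter n f x - x| <= A * (1 - s ^+ n)].
  elim: n => [|n [h1 h2 h3]].
    rewrite expr0 mul1r /= !subrr mulr0 normr0; split=> //.
    by apply: (lt_trans px); rewrite ltr_pdivrMr// ltr_pMr// ltr1n.
  have h4 : `|iter n.+1 f x - x| <= A * (1 - s ^+ n.+1).
    rewrite -(subrK (iter n f x) (iter n.+1 f x)) -addrA.
    apply: (le_trans (ler_normD _ _)); apply: (le_trans (lerD (step _ h1 h2) h3)).
    by rewrite -mulrDr addrC subrKA.
  split=> //; last first.
    have [_ yE _ bE] := hd0 _ h1.
    rewrite iterS yE; apply: (le_trans (bE _)).
    by rewrite exprS -mulrA ler_pM2l.
  rewrite -(subrK x p) -addrA; apply: (le_lt_trans (ler_normD _ _)).
  have -> : d1 = d1 / 2 + d1 / 2 by lra.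
  rewrite ltr_leD// distrC; apply: (le_trans h4); apply: le_trans AK.
  by rewrite ler_piMr// gerBl exprn_ge0// ltW.
move=> n; split; first by have [+ _ _] := P n; rewrite lt_min => /andP[].
move=> m; apply: (@le_trans _ _ (A * (s ^+ n - s ^+ (n + m)))).
  elim: m => [|m IH]; first by rewrite addn0 !subrr normr0 mulr0.
  rewrite addnS -(subrK (iter (n + m) f x) (iter (n + m).+1 f x)) -addrA.
  have [h1 h2 _] := P (n + m)%N.
  apply: (le_trans (ler_normD _ _)); apply: (le_trans (lerD (step _ h1 h2) IH)).
  by rewrite -mulrDr addrC subrKA.
apply: ler_pM => //; last by rewrite gerBl exprn_ge0// ltW.
by rewrite subr_ge0 ler_wiXn2l ?leq_addr// ltW.
Unshelve. all: by end_near. Qed.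

End AttractingSystem.

(** * Tangent systems *)

Section TangentSystem.
Variable R : realType.

Definition tan1 (V W : normedModType R) (f : V -> W) (q : V * V) : W * W :=
  (f q.1, 'd f (q.1) q.2).

(** The tangent map of [g] with its coordinates regrouped: base point and base direction come first,
    defect and defect direction second, so that the new system has the shape of the old one. *)
Definition tan2 (V W U : normedModType R) (g : V * W -> U)
    (q : (V * V) * (W * W)) : U * U :=
  tan1 g ((q.1.1, q.2.1), (q.1.2, q.2.2)).

Lemma smooth_at_tan1 k (V W : normedModType R) (f : V -> W) x v :
  smooth_at k.+1 f x -> smooth_at k (tan1 f) (x, v).
Proof.
move=> Sf; apply: smooth_at_pair; last by case: Sf => _; apply.
apply: (@smooth_at_comp _ _ _ _ _ (fun q : V * V => q.1) f).
  exact: smooth_at_fst.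
exact: smooth_at_pred.
Qed.

Lemma smooth_at_tan2 k (V W U : normedModType R) (g : V * W -> U) x v w o :
  smooth_at k.+1 g (x, w) -> smooth_at k (tan2 g) ((x, v), (w, o)).
Proof.
move=> Sg; apply: (@smooth_at_comp _ _ _ _ _
  (fun q : (V * V) * (W * W) => ((q.1.1, q.2.1), (q.1.2, q.2.2))) (tan1 g)).
  have F1 := @smooth_at_fst R k (V * V)%type (W * W)%type ((x, v), (w, o)).
  have F2 := @smooth_at_snd R k (V * V)%type (W * W)%type ((x, v), (w, o)).
  apply: smooth_at_pair; apply: smooth_at_pair.
  - exact: smooth_at_comp F1 (smooth_at_fst _ _).
  - exact: smooth_at_comp F2 (smooth_at_fst _ _).
  - exact: smooth_at_comp F1 (smooth_at_snd _ _).
  - exact: smooth_at_comp F2 (smooth_at_snd _ _).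
exact: smooth_at_tan1.
Qed.

Lemma is_diff_unique (V W : normedModType R) (f g g' : V -> W) x :
  is_diff x f g -> is_diff x f g' -> g = g'.
Proof. by move=> [_ <-] [_ <-]. Qed.

Lemma attracting_fp (V W : normedModType R) (f : V -> V) (y : V -> W) a b p N
    rho : attracting f y a b p N rho -> f p = p.
Proof.
move=> H; rewrite (nbhs_singleton (att_fE H)) (att_y0 H).
by rewrite (linearmap0 (nbhs_singleton (att_la H))) addr0.
Qed.

(** The two functional equations hold on a neighbourhood, so they can be differentiated by the chain
    rule. At [(p, 0)] the base direction is zero, hence [tan2 b] sends [(w, omega)] to
    [(b (p, w), b (p, omega))] and contracts the maximum of the two norms at the old rate. *)
Lemma attracting_tan (V W : normedModType R) (f : V -> V) (y : V -> W) a b p N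
    rho : attracting f y a b p N rho ->
  attracting (tan1 f) (tan1 y) (tan2 a) (tan2 b) (p, 0)
    (fun w => Num.max (N w.1) (N w.2)) rho.
Proof.
move=> H; have fp := attracting_fp H.
have df : \forall x \near p, differentiable f x.
  by apply: filterS (att_f H 1%N) => x; exact: smooth_at_diff.
have dy : \forall x \near p, differentiable y x.
  by apply: filterS (att_y H 1%N) => x; exact: smooth_at_diff.
have da : \forall x \near p, forall w, differentiable a (x, w).
  by apply: filterS (att_a H 1%N) => x h w; exact: smooth_at_diff (h w).
have db : \forall x \near p, forall w, differentiable b (x, w).
  by apply: filterS (att_b H 1%N) => x h w; exact: smooth_at_diff (h w).
have dyf : \forall x \near p, differentiable y (f x).
  have fpp : f @ p --> p.
    by rewrite -[X in _ --> X]fp; exact: differentiable_continuous (nbhs_singleton df).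
  exact: fpp _ dy.
split.
- move=> k; apply: filterS (near_fst (0 : V) (att_f H k.+1)) => -[x v] /=.
  exact: smooth_at_tan1.
- move=> k; apply: filterS (near_fst (0 : V) (att_y H k.+1)) => -[x v] /=.
  exact: smooth_at_tan1.
- move=> k; apply: filterS (near_fst (0 : V) (att_a H k.+1)) => -[x v] /= h [w o].
  exact: smooth_at_tan2.
- move=> k; apply: filterS (near_fst (0 : V) (att_b H k.+1)) => -[x v] /= h [w o].
  exact: smooth_at_tan2.
- suff K : \forall x \near p, f x = x + a (x, y x) /\
      forall v, 'd f x v = v + 'd a (x, y x) (v, 'd y x v).
    apply: filterS (near_fst (0 : V) K) => -[x v] /= [h1 h2].
    by rewrite /tan1 /tan2 /= h2 [in LHS]h1.
  have fE := att_fE H; near=> x.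
  have dax : forall w, differentiable a (x, w) by near: x.
  have dyx : differentiable y x by near: x.
  have dfx : differentiable f x by near: x.
  have fEx : \forall x \near x, f x = x + a (x, y x) by near: x; exact: near_join.
  split; first exact: nbhs_singleton fEx.
  have i1 := near_eq_is_diff fEx dfx.
  have i2 : is_diff x (fun z => (z, y z)) (fun v => (v, 'd y x v)).
    exact: is_diff_pair (is_diff_id x) (differentiableP dyx).
  have i3 := @is_diff_comp _ _ _ _ (fun z => (z, y z)) _ a _ x i2
    (differentiableP (dax (y x))).
  have i4 := is_diffD (is_diff_id x) i3.
  by move=> v; rewrite (is_diff_unique i1 i4).
- suff K : \forall x \near p, y (f x) = b (x, y x) /\
      forall v, 'd y (f x) ('d f x v) = 'd b (x, y x) (v, 'd y x v).
    apply: filterS (near_fst (0 : V) K) => -[x v] /= [h1 h2].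
    by rewrite /tan1 /tan2 /= h2 h1.
  have yE := att_yE H; near=> x.
  have dbx : forall w, differentiable b (x, w) by near: x.
  have dyx : differentiable y x by near: x.
  have dfx : differentiable f x by near: x.
  have dyfx : differentiable y (f x) by near: x.
  have yEx : \forall x \near x, y (f x) = b (x, y x) by near: x; exact: near_join.
  split; first exact: nbhs_singleton yEx.
  have i0 := @is_diff_comp _ _ _ _ f _ y _ x (differentiableP dfx)
    (differentiableP dyfx).
  have i1 := near_eq_is_diff yEx (@ex_diff _ _ _ _ _ _ _ i0).
  have i2 : is_diff x (fun z => (z, y z)) (fun v => (v, 'd y x v)).
    exact: is_diff_pair (is_diff_id x) (differentiableP dyx).
  have i3 := @is_diff_comp _ _ _ _ (fun z => (z, y z)) _ b _ x i2
    (differentiableP (dbx (y x))).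
  move=> v; have := is_diff_unique i1 i3; rewrite diff_val => /(congr1 (@^~ v)).
  exact.
- have la := att_la H.
  have K : \forall x \near p, (\forall z \near x, linear (fun w => a (z, w))) /\
      forall w, differentiable a (x, w).
    by near=> x; split; near: x => //; exact: near_join.
  apply: filterS (near_fst (0 : V) K) => -[x v] /= [h1 h2] t q q'.
  congr pair; first exact: (nbhs_singleton h1).
  exact: diff_snd_linear h1 h2 v t q q'.
- have lb := att_lb H.
  have K : \forall x \near p, (\forall z \near x, linear (fun w => b (z, w))) /\
      forall w, differentiable b (x, w).
    by near=> x; split; near: x => //; exact: near_join.
  apply: filterS (near_fst (0 : V) K) => -[x v] /= [h1 h2] t q q'.
  congr pair; first exact: (nbhs_singleton h1).
  exact: diff_snd_linear h1 h2 v t q q'.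
- by rewrite /tan1 /= linear0 (att_y0 H).
- move=> w; rewrite prod_normE ge_max !le_max (att_N1 H)/= (att_N1 H).
  by rewrite orbT.
- have [C hC] := att_N2 H; exists (Num.max C 1) => w.
  have hC' v : N v <= Num.max C 1 * `|v|.
    by apply: (le_trans (hC v)); rewrite ler_wpM2r// le_max lexx.
  rewrite ge_max; apply/andP; split; apply: (le_trans (hC' _)).
    by apply: ler_wpM2l (pair_norm_fst w); rewrite le_max ler01 orbT.
  by apply: ler_wpM2l (pair_norm_snd w); rewrite le_max ler01 orbT.
- move=> u v; rewrite ge_max; apply/andP; split; apply: (le_trans (att_ND H _ _));
    by rewrite lerD// le_max lexx ?orbT.
- exact: att_rho H.
- move=> w; have rho0 : 0 <= rho by have /andP[] := att_rho H.
  rewrite /tan2 /tan1 /= diff_snd0; [|exact: att_lb H|exact: nbhs_singleton db].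
  by rewrite maxr_pMr// ge_max !le_max !(att_b_contr H) orbT.
Unshelve. all: by end_near. Qed.
End TangentSystem.

(** * Smoothness of the limit map *)

Section AttractingLimit.
Variable R : realType.

(** Completeness for geometrically Cauchy sequences, the kind that orbits produce. It passes to
    products componentwise, as required by tangent systems, which live on [V * V]. *)
Definition geom_complete (V : normedModType R) :=
  forall (u : nat -> V) (K s : R), 0 <= s < 1 ->
    (forall n m, `|u (n + m)%N - u n| <= K * s ^+ n) ->
    exists l : V, u n @[n --> \oo] --> l.

Lemma geom_small (K s e : R) : 0 <= s < 1 -> 0 < e ->
  \forall n \near \oo, K * s ^+ n <= e.
Proof.
move=> /andP[s0 s1] e0.
have /cvgrPdist_le /(_ e e0) : geometric K s @ \oo --> (0 : R).
  by apply: cvg_geometric; rewrite ger0_norm.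
apply: filterS => n /=; rewrite sub0r normrN; apply: le_trans; exact: ler_norm.
Qed.

Lemma geom_complete_pair (V W : normedModType R) :
  geom_complete V -> geom_complete W -> geom_complete (V * W)%type.
Proof.
move=> cV cW u K s s01 hu.
have [l1 h1] : exists l : V, (u n).1 @[n --> \oo] --> l.
  apply: (cV _ K s) => // n m; apply: le_trans (hu n m).
  exact: (pair_norm_fst (u (n + m)%N - u n)).
have [l2 h2] : exists l : W, (u n).2 @[n --> \oo] --> l.
  apply: (cW _ K s) => // n m; apply: le_trans (hu n m).
  exact: (pair_norm_snd (u (n + m)%N - u n)).
exists (l1, l2).
have h : ((u n).1, (u n).2) @[n --> \oo] --> ((l1, l2) : V * W).
  exact: cvg_pair h1 h2.
by apply: cvg_near_eq h; near=> n; rewrite -surjective_pairing.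
Unshelve. all: by end_near. Qed.

Lemma geom_complete_cauchy (V : normedModType R) :
  (forall F : set_system V, ProperFilter F -> cauchy F -> cvg F) ->
  geom_complete V.
Proof.
move=> cV u K s s01 hu.
suff : cvg (u @ \oo) by move=> h; exists (lim (u @ \oo)).
apply: cV; apply: cauchy_exP => e e0.
have e20 : 0 < e / 2 by rewrite divr_gt0.
have [N _ /(_ N (leqnn N)) hN] := geom_small K s01 e20.
exists (u N), N => // n /= nN; rewrite -ball_normE /= distrC -(subnKC nN).
apply: (le_lt_trans (hu _ _)); apply: (le_lt_trans hN); lra.
Qed.

Lemma attract_limit (V W : normedModType R) (f : V -> V) (y : V -> W) a b p N
    rho phi : attracting f y a b p N rho ->
  (\forall x \near p, iter n f x @[n --> \oo] --> phi x) ->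
  exists (d K s : R), [/\ 0 < d, 0 <= s < 1 & forall x, `|p - x| < d ->
    forall n, `|phi x - iter n f x| <= K * s ^+ n].
Proof.
move=> H /nearP_norm [d0 d00 hphi].
have [d [K [s [d1 K0 s01 hd]]]] := attract_orbit H ltr01.
exists (Num.min d d0), K, s; split=> //; first by rewrite lt_min d1.
move=> x; rewrite lt_min => /andP[xd xd0] n.
apply: (@cvg_norm_le _ _ (fun m => iter m f x - iter n f x)).
  by apply: cvgB; [exact: hphi|exact: cvg_cst].
exists n => // m /= nm; rewrite -(subnKC nm).
by have [_] := hd _ xd n; apply.
Qed.

(** One neighbourhood serves for all [n], because orbits starting in it never leave the ball where
    [f] is of class k. *)
Lemma attract_smooth_iter (V W : normedModType R) (f : V -> V) (y : V -> W) a b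
    p N rho k : attracting f y a b p N rho ->
  \forall x \near p, forall n, smooth_at k (iter n f) x.
Proof.
move=> H; have /nearP_norm [e e0 he] := att_f H k.
have [d [K [s [d1 K0 s01 hd]]]] := attract_orbit H e0.
apply/nearP_norm; exists d => // x px; elim=> [|n IH].
  exact: smooth_at_id.
apply: (smooth_at_comp IH); apply: he; by have [] := hd x px n.
Qed.

(** Orbits of the tangent map carry the differentials of the iterates, so estimates on tangent
    orbits are estimates on these differentials. *)
Lemma attract_iter_tan (V W : normedModType R) (f : V -> V) (y : V -> W) a b
    p N rho : attracting f y a b p N rho ->
  \forall x \near p, forall n v,
    iter n (tan1 f) (x, v) = (iter n f x, 'd (iter n f) x v).
Proof.
move=> H; have /nearP_norm [e e0 he] := att_f H 1%N.
have [d [K [s [d1 K0 s01 hd]]]] := attract_orbit H e0.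
near=> x => n v; elim: n => [|n IH].
  by have [_ ->] := is_diff_id x.
rewrite iterS IH /tan1 /=; congr pair.
rewrite -[iter n.+1 f]/(f \o iter n f) (@diff_comp _ _ _ _ (iter n f) f)//.
  have h : forall n, smooth_at 1 (iter n f) x by near: x; exact: attract_smooth_iter H.
  exact: smooth_at_diff (h n).
have px : `|p - x| < d by near: x; apply/nearP_norm; exists d.
by apply: (@smooth_at_diff _ 0); apply: he; have [] := hd x px n.
Unshelve. all: by end_near. Qed.

(* The inductive hypothesis is applied to the tangent system at [(p, 0)], which only
   controls small vectors; homogeneity of the differential extends it to all. *)
Theorem attract_smooth k (V W : normedModType R) (f : V -> V) (y : V -> W) a b
    p N rho phi : geom_complete V -> attracting f y a b p N rho ->
  (\forall x \near p, iter n f x @[n --> \oo] --> phi x) ->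
  \forall x \near p, smooth_at k phi x.
Proof.
elim: k V W f y a b p N rho phi => [|k IH] V W f y a b p N rho phi cV H hphi.
  have [d [K [s [d0 s01 hd]]]] := attract_limit H hphi.
  have /nearP_norm [d' d'0 hd'] := attract_smooth_iter 0 H.
  apply/nearP_norm; exists (Num.min d d'); first by rewrite lt_min d0.
  move=> x; rewrite lt_min => /andP[xd xd'].
  apply/cvgrPdist_le => e e0.
  have e30 : 0 < e / 3 by rewrite divr_gt0.
  have [n _ /(_ n (leqnn n)) hn] := geom_small K s01 e30.
  have := hd' x xd' n => /cvgrPdist_le /(_ _ e30) hc.
  near=> z.
  have h1 : `|phi x - iter n f x| <= e / 3 by exact: le_trans (hd _ xd n) hn.
  have h2 : `|iter n f z - phi z| <= e / 3.
    rewrite distrC; apply: le_trans (hd _ _ n) hn; near: z.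
    apply/nearP_norm; exists (d - `|p - x|); first by rewrite subr_gt0.
    move=> z; rewrite ltrBrDl => /(le_lt_trans (ler_normD _ _)).
    by rewrite addrA subrK.
  have h3 : `|iter n f x - iter n f z| <= e / 3 by near: z.
  have -> : phi x - phi z = (phi x - iter n f x) + (iter n f x - iter n f z) +
    (iter n f z - phi z) by rewrite subrKA addrA subrK.
  apply: (le_trans (ler_normD _ _)).
  have -> : e = e / 3 + e / 3 + e / 3 by lra.
  rewrite lerD//; apply: (le_trans (ler_normD _ _)); exact: lerD.
have tH := attracting_tan H.
have [d [K [s [d0 K0 s01 hd]]]] := attract_orbit tH ltr01.
have /nearP_norm [d' d'0 hd'] := attract_iter_tan H.
pose r := Num.min d d'; have r0 : 0 < r by rewrite lt_min d0.
(* Second component of the orbit estimate for the tangent system: on small vectors the differentials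
   of the iterates are uniformly Cauchy. *)
have dC x v : `|p - x| < r -> `|v| < r -> forall n m,
    `|'d (iter (n + m) f) x v - 'd (iter n f) x v| <= K * s ^+ n.
  rewrite !lt_min => /andP[x1 x2] /andP[v1 v2] n m.
  have xv : `|(p, 0) - (x, v)| < d.
    by apply: pair_norm_lt => //=; rewrite sub0r normrN.
  have [_ /(_ m)] := hd _ xv n; rewrite !hd'//.
  by apply: le_trans; exact: (pair_norm_snd (_ - _, _ - _)).
clearbody r.
pose psi x v := lim ('d (iter n f) x v @[n --> \oo]).
have dpsi1 x v : `|p - x| < r -> `|v| < r ->
    'd (iter n f) x v @[n --> \oo] --> psi x v.
  move=> px vr; have [l hl] := cV (fun n => 'd (iter n f) x v) K s s01 (dC x v px vr).
  by rewrite /psi (cvg_lim (@norm_hausdorff _ _) hl).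
have scal (v : V) : exists2 t : R, 0 < t & `|t *: v| < r.
  exists (r / 2 / (`|v| + 1)); first by rewrite !divr_gt0// ltr_wpDl.
  rewrite normrZ gtr0_norm ?divr_gt0 ?ltr_wpDl// mulrAC.
  rewrite ltr_pdivrMr ?ltr_wpDl//.
  have : 0 <= `|v| by [].
  have : 0 <= r / 2 * `|v| by rewrite mulr_ge0// divr_ge0// ltW.
  by nra.
have dpsi x (v : V) : `|p - x| < r -> 'd (iter n f) x v @[n --> \oo] --> psi x v.
  move=> px; have [t t0 tv] := scal v.
  have h : 'd (iter n f) x v @[n --> \oo] --> t^-1 *: psi x (t *: v).
    have h := cvgZl_tmp (k := t^-1) (dpsi1 x _ px tv).
    apply: cvg_near_eq (h _); near=> n.
    by rewrite /= linearZ /= scalerA mulVf ?scale1r// gt_eqF.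
  by rewrite /psi (cvg_lim (@norm_hausdorff _ _) h).
have psiZ x t (v : V) : `|p - x| < r -> psi x (t *: v) = t *: psi x v.
  move=> px; have h1 := dpsi x (t *: v) px.
  have h2 := cvgZl_tmp (k := t) (dpsi x v px).
  apply: (cvg_unique (@norm_hausdorff _ _) h1).
  by apply: cvg_near_eq (h2 _); near=> n; rewrite /= linearZ.
have dunif x n (v : V) : `|p - x| < r -> 
    `|'d (iter n f) x v - psi x v| <= K * s ^+ n * (2 / r) * `|v|.
  move=> px; apply: (@homogeneous_bound _ _ _ (fun v => 'd (iter n f) x v - psi x v)) => //.
    by move=> t u; rewrite psiZ// linearZ /= scalerBr.
  move=> u ur; rewrite distrC.
  apply: (@cvg_norm_le _ _ (fun m => 'd (iter m f) x u - 'd (iter n f) x u)).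
    by apply: cvgB; [exact: dpsi|exact: cvg_cst].
  by exists n => // m /= nm; rewrite -(subnKC nm); exact: dC.
have dphi : \forall x \near p, is_diff x phi (psi x).
  have /nearP_norm [e e0 he] := hphi.
  have /nearP_norm [e' e'0 he'] := attract_smooth_iter 1 H.
  pose q := Num.min r (Num.min e e').
  have q0 : 0 < q by rewrite !lt_min r0 e0.
  apply/nearP_norm; exists q => //.
  apply: (@diff_limit _ _ _ (fun n => iter n f)).
  - move=> n x; rewrite !lt_min => /and3P[_ _ xe].
    exact: smooth_at_diff (he' x xe n).
  - by move=> x; rewrite !lt_min => /and3P[_ xe _]; exact: he.
  - move=> eps eps0; near=> n => x; rewrite !lt_min => /and3P[xr _ _] v.
    apply: (le_trans (dunif _ _ _ xr)); apply: ler_wpM2r => //.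
    have -> : K * s ^+ n * (2 / r) = (2 / r * K) * s ^+ n by ring.
    near: n; exact: geom_small.
(* [Phi] is both the limit of the tangent orbits and the tangent map of [phi] near [p]; the
   induction hypothesis applies to it in the first role and is exploited in the second. *)
pose Phi (q : V * V) := (phi q.1, psi q.1 q.2).
have tphi : \forall q \near (p, 0 : V), iter n (tan1 f) q @[n --> \oo] --> Phi q.
  have K1 : \forall x \near p, [/\ iter n f x @[n --> \oo] --> phi x,
      `|p - x| < r & forall n v,
      iter n (tan1 f) (x, v) = (iter n f x, 'd (iter n f) x v)].
    near=> x; split; near: x => //; first by apply/nearP_norm; exists r.
    exact: attract_iter_tan H.
  apply: filterS (near_fst (0 : V) K1) => -[x v] /= [h1 h2 h3].
  have h : (iter n f x, 'd (iter n f) x v) @[n --> \oo] --> (Phi (x, v) : V * V).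
    exact: cvg_pair h1 (dpsi x v h2).
  by apply: cvg_near_eq h; near=> n; rewrite h3.
have cVV := geom_complete_pair cV cV.
have /nearP_norm [c c0 hc] := IH _ _ _ _ _ _ _ _ _ _ cVV tH tphi.
near=> x; split.
  have : \forall z \near x, is_diff z phi (psi z) by near: x; exact: near_join.
  by apply: filterS => z [].
move=> v.
have [t t0 tv] : exists2 t : R, 0 < t & `|t *: v| < c.
  exists (c / 2 / (`|v| + 1)); first by rewrite !divr_gt0// ltr_wpDl.
  rewrite normrZ gtr0_norm ?divr_gt0 ?ltr_wpDl// mulrAC.
  rewrite ltr_pdivrMr ?ltr_wpDl//.
  have : 0 <= `|v| by [].
  have : 0 <= c / 2 * `|v| by rewrite mulr_ge0// divr_ge0// ltW.
  by nra.
have px : `|p - x| < c by near: x; apply/nearP_norm; exists c.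
have SPhi : smooth_at k Phi (x, t *: v).
  by apply: hc; apply: pair_norm_lt => //=; rewrite sub0r normrN.
have near_x : \forall z \near x, is_diff z phi (psi z) /\ `|p - z| < r.
  near: x; apply: near_join; near=> z; split; near: z => //.
  by apply/nearP_norm; exists r.
apply: (@smooth_at_ext _ _ _ _ (fun q => t^-1 *: (Phi (q.1, t *: q.2)).2)).
  apply: filterS (near_fst v near_x) => -[z u] /= [[_ ->] pz].
  by rewrite psiZ// scalerA mulVf ?scale1r// gt_eqF.
apply: smooth_atZ.
apply: (@smooth_at_comp _ _ _ _ _ (fun q : V * V => Phi (q.1, t *: q.2)) snd).
  apply: (@smooth_at_comp _ _ _ _ _ (fun q : V * V => (q.1, t *: q.2)) Phi) => //.
  apply: smooth_at_pair; first exact: smooth_at_fst.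
  apply: smooth_atZ; exact: smooth_at_snd.
exact: smooth_at_snd.
Unshelve. all: by end_near. Qed.

End AttractingLimit.

(** * Smoothness of inverses and square roots *)

Section Implicit.
Variable R : realType.

(** The error may involve the increment of [s] itself. For [e] at most 1/2 that increment can be
    absorbed on the left and is then bounded by a multiple of [h], which leaves an ordinary
    differentiability estimate. *)
Lemma is_diff_implicit (X Z : normedModType R) (s : X -> Z) x (D : X -> Z) :
  linear D -> bounded_map D ->
  (forall e : R, 0 < e -> \forall h \near (0 : X),
    `|s (x + h) - s x - D h| <= e * (`|h| + `|s (x + h) - s x|)) ->
  is_diff x s D.
Proof.
move=> lD bD H; have [C C0 hC] := bounded_map_pos bD.
apply: is_diff_eps => // e e0.
(* The bound 1/2 allows the absorption and yields an increment of at most [2 * (C + 1) * |h|]; the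
   second bound brings the total error below [e * |h|]. *)
pose e' := Num.min (1 / 2) (e / (1 + 2 * (C + 1))).
have C10 : 0 < 1 + 2 * (C + 1) by lra.
have e'0 : 0 < e' by rewrite lt_min !divr_gt0.
near=> h.
have h1 : `|s (x + h) - s x - D h| <= e' * (`|h| + `|s (x + h) - s x|).
  by near: h; exact: H.
have h2 : `|s (x + h) - s x| <= 2 * (C + 1) * `|h|.
  have : `|s (x + h) - s x| <=
      e' * (`|h| + `|s (x + h) - s x|) + C * `|h|.
    rewrite -[X in `|X| <= _](subrK (D h)).
    by apply: (le_trans (ler_normD _ _)); rewrite lerD.
  have : e' * (`|h| + `|s (x + h) - s x|) <= 1 / 2 * (`|h| + `|s (x + h) - s x|).
    by rewrite ler_wpM2r ?addr_ge0// /e' ge_min lexx.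
  have : 0 <= `|h| by []; lra.
apply: (le_trans h1).
apply: (@le_trans _ _ (e' * ((1 + 2 * (C + 1)) * `|h|))).
  by rewrite ler_pM2l// mulrDl mul1r lerD.
rewrite mulrA ler_wpM2r// -ler_pdivlMr//.
by rewrite /e' ge_min lexx orbT.
Unshelve. all: by end_near. Qed.

Lemma near_shift0 (X : normedModType R) (x : X) (P : X -> Prop) :
  (\forall y \near x, P y) -> \forall h \near (0 : X), P (x + h).
Proof.
move=> /nearP_norm [d d0 hd]; apply/nearP_norm; exists d => // h hd'.
by apply: hd; rewrite opprD addrA subrr.
Qed.

(** [L] takes base point and argument as one pair, so that its smoothness can be stated jointly in
    both. *)
Definition inverse_at (X S Z : normedModType R) (B : S -> Z -> Z) (s : X -> S)
    (L : X * Z -> Z) (x : X) :=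
  [/\ forall z, L (x, B (s x) z) = z, forall h, B (s x) (L (x, h)) = h &
      bounded_map (fun h => L (x, h))].

Lemma inverse_at_linear (X S Z : normedModType R) (B : S -> Z -> Z) (s : X -> S)
    L (x : X) : bilinear_map B -> inverse_at B s L x ->
  linear (fun h => L (x, h)).
Proof.
move=> [_ lB _] [h1 h2 _] t u v.
by rewrite -[in LHS](h2 u) -[in LHS](h2 v) -lB h1.
Qed.

(** The formula comes from differentiating [B (s x) l = h]: the unknown [dl] solves
    [B (s x) dl = dh - B ds l]. *)
Lemma is_diff_inverse (X S Z : normedModType R) (B : S -> Z -> Z) (s : X -> S)
    L x h : bilinear_map B -> differentiable s x ->
  (\forall y \near x, inverse_at B s L y) ->
  is_diff (x, h) L (fun q => L (x, q.2 - B ('d s x q.1) (L (x, h)))).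
Proof.
move=> bB ds iL; have [CB CB0 hCB] := bilinear_map_pos bB.
have [lBl lBr _] := bB.
have iLx := nbhs_singleton iL.
have lL := inverse_at_linear bB iLx.
have [h1 h2 bL] := iLx; have [C C0 hC] := bounded_map_pos bL.
set l := L (x, h).
have [Cs Cs0 hCs] := bounded_map_pos (diff_bounded ds).
apply: is_diff_implicit.
- move=> t u v /=; rewrite -lL; congr (L (x, _)).
  by rewrite linearP lBl scalerBr opprD addrACA.
- exists (C * (1 + CB * Cs * `|l|)) => q.
  apply: (le_trans (hC _)); rewrite -mulrA ler_pM2l//.
  apply: (le_trans (ler_normB _ _)); rewrite mulrDl mul1r lerD//.
    exact: pair_norm_snd.
  apply: (le_trans (hCB _ _)); rewrite -!mulrA ler_pM2l// [`|l| * _]mulrC.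
  rewrite mulrA ler_wpM2r//; apply: (le_trans (hCs _)).
  by rewrite ler_pM2l//; exact: pair_norm_fst.
move=> e e0.
pose e1 := e / (C * CB * (`|l| + 1)).
have l1 : 0 < `|l| + 1 by rewrite ltr_wpDl.
have e10 : 0 < e1 by rewrite divr_gt0// !mulr_gt0.
have K : \forall xi \near (0 : X), [/\ inverse_at B s L (x + xi),
    `|s (x + xi) - s x - 'd s x xi| <= e1 * `|xi| &
    `|s (x + xi) - s x| <= e1].
  near=> xi; split.
  - near: xi; exact: near_shift0.
  - near: xi; exact: differentiable_eps.
  - near: xi; apply: (@near_shift0 _ x (fun z => `|s z - s x| <= e1)).
    have /cvgrPdist_le /(_ e1 e10) := differentiable_continuous ds.
    by apply: filterS => z; rewrite distrC.
apply: filterS (near_fst (0 : Z) K) => -[xi eta] /= [[i1 i2 _] k2 k3].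
rewrite -[L ((x, h) + (xi, eta))]/(L (x + xi, h + eta)) -/l.
move: k2 k3; set D := L (x + xi, h + eta) - l; set sg := s (x + xi) - s x.
move=> k2 k3.
have sE : s (x + xi) = s x + sg by rewrite [s x + _]addrC subrK.
have LE : L (x + xi, h + eta) = l + D by rewrite [l + _]addrC subrK.
clearbody D sg.
(* Expansion of [B (s x + sg) (l + D) = h + eta], less [B (s x) l = h]. *)
have etaE : eta = B sg l + B (s x) D + B sg D.
  have := i2 (h + eta); rewrite LE sE (linearmapD (lBl _)) !(linearmapD (lBr _)).
  rewrite [B (s x) l]h2 -addrA => /addrI <-.
  by rewrite addrCA addrA.
have DE : D - L (x, eta - B ('d s x xi) l) =
    - L (x, B (sg - 'd s x xi) l + B sg D).
  have {1}-> : D = L (x, eta - B sg l - B sg D).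
    by rewrite etaE addrAC addrK [B sg l + _]addrC addrK h1.
  rewrite -(linearmapB lL) -(linearmapN lL); congr (L (x, _)).
  rewrite (linearmapB (lBl _)) !opprD !opprK.
  by rewrite [LHS](AC (3*2) ((1*4)*(2*5*3)))/= subrr add0r.
rewrite DE normrN; apply: (le_trans (hC _)).
apply: (@le_trans _ _ (C * (CB * (e1 * `|xi|) * `|l| + CB * e1 * `|D|))).
  rewrite ler_pM2l//; apply: (le_trans (ler_normD _ _)); rewrite lerD//.
    by apply: (le_trans (hCB _ _)); rewrite ler_wpM2r// ler_pM2l.
  by apply: (le_trans (hCB _ _)); rewrite ler_wpM2r// ler_pM2l.
have -> : C * (CB * (e1 * `|xi|) * `|l| + CB * e1 * `|D|) =
  (C * CB * e1) * (`|xi| * `|l| + `|D|) by ring.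
have -> : e * (`|(xi, eta)| + `|D|) =
  (C * CB * e1) * ((`|(xi, eta)| + `|D|) * (`|l| + 1)).
  by rewrite /e1; field; rewrite !gt_eqF.
rewrite ler_pM2l; last by apply: mulr_gt0 => //; exact: mulr_gt0.
have := pair_norm_fst (xi, eta) => /= p1.
have l0 : 0 <= `|l| by [].
have D0 : 0 <= `|D| by [].
have A0 : 0 <= `|(xi, eta)| by [].
have : `|xi| * `|l| <= `|(xi, eta)| * `|l| by rewrite ler_wpM2r.
have : 0 <= `|D| * `|l| by rewrite mulr_ge0.
have -> : (`|(xi, eta)| + `|D|) * (`|l| + 1) =
  `|(xi, eta)| * `|l| + `|(xi, eta)| + `|D| * `|l| + `|D| by ring.
by lra.
Unshelve. all: by end_near. Qed.

(** The differential of [L] is expressed through [L], [s] and the differential of [s], so class k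
    for [L] gives class k for its differential. The induction starts from continuity, a perturbation
    estimate. *)
Lemma smooth_at_inverse k (X S Z : normedModType R) (B : S -> Z -> Z)
    (s : X -> S) L x h : bilinear_map B -> smooth_at k s x ->
  (\forall y \near x, inverse_at B s L y) -> smooth_at k L (x, h).
Proof.
move=> bB; elim: k x h => [|k IH] x h Ss iL.
  have [CB CB0 hCB] := bilinear_map_pos bB.
  have [lBl lBr _] := bB.
  have iLx := nbhs_singleton iL; have lL := inverse_at_linear bB iLx.
  have [h1 h2 bL] := iLx; have [C C0 hC] := bounded_map_pos bL.
  set l := L (x, h).
  have c0 : 0 < C * CB by rewrite mulr_gt0.
  (* Within this distance the perturbation of the operator costs at most half of the solution, so
     the norm of the inverse at most doubles. *)
  have e10 : 0 < 1 / 2 / (C * CB) by rewrite !divr_gt0.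
  have K : \forall y \near x, inverse_at B s L y /\
      `|s x - s y| <= 1 / 2 / (C * CB).
    near=> y; split; near: y => //.
    by have /cvgrPdist_le /(_ _ e10) := Ss.
  have bd : \forall y \near x, inverse_at B s L y /\
      forall u, `|L (y, u)| <= 2 * C * `|u|.
    apply: filterS K => y [iLy sy]; split=> // u.
    set z := L (y, u); have [_ k2 _] := iLy.
    have zE : z = L (x, u + B (s x - s y) z).
      by rewrite (linearmapB (lBl _)) [B (s y) _]k2 addrC subrK h1.
    have : `|z| <= C * (`|u| + CB * (1 / 2 / (C * CB)) * `|z|).
      rewrite {1}zE; apply: (le_trans (hC _)); rewrite ler_pM2l//.
      apply: (le_trans (ler_normD _ _)); rewrite lerD//.
      by apply: (le_trans (hCB _ _)); rewrite ler_wpM2r// ler_pM2l.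
    have -> : C * (`|u| + CB * (1 / 2 / (C * CB)) * `|z|) = C * `|u| + 1 / 2 * `|z|.
      by field; rewrite !gt_eqF.
    lra.
  have cF : {for (x, h), continuous (fun q : X * Z => q.2 - B (s q.1) l)}.
    apply: (@smooth_at_continuous _ 0); apply: smooth_atB; first exact: smooth_at_snd.
    apply: (@smooth_at_lin _ _ _ _ _ (B^~ l) (fun q : X * Z => s q.1)) => //.
      exists (CB * `|l|) => v; apply: (le_trans (hCB _ _)).
      by rewrite -!mulrA [`|l| * _]mulrC.
    apply: (@smooth_at_comp _ _ _ _ _ (fun q : X * Z => q.1) s) => //.
    exact: smooth_at_fst.
  apply/cvgrPdist_le => e e0.
  have e20 : 0 < e / (2 * C) by rewrite divr_gt0// mulr_gt0.
  have F0 : h - B (s x) l = 0 by rewrite h2 subrr.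
  have /cvgrPdist_le /(_ _ e20) := cF; rewrite /= F0 => cF'.
  near=> q.
  have [[k1 _ _] kb] : inverse_at B s L q.1 /\ 
      forall u, `|L (q.1, u)| <= 2 * C * `|u| by near: q; exact: (near_fst h bd).
  have iq : inverse_at B s L q.1 by near: q; exact: (near_fst h iL).
  have -> : L (x, h) - L q = - L (q.1, q.2 - B (s q.1) l).
    rewrite (linearmapB (inverse_at_linear bB iq)) k1 opprB.
    by rewrite -surjective_pairing.
  rewrite normrN; apply: (le_trans (kb _)); rewrite mulrC -ler_pdivlMr ?mulr_gt0//.
  rewrite -normrN -[X in `|X|]sub0r; near: q; exact: cF'.
have iL' := near_join iL.
have K : \forall y \near x, (\forall z \near y, inverse_at B s L z) /\
    differentiable s y.
  by near=> y; split; near: y => //; exact: smooth_at_near1 Ss.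
split.
  apply: filterS (near_fst h K) => -[y u] /= [k1 k2].
  by have [] := is_diff_inverse u bB k2 k1.
move=> [xi eta].
apply: (@smooth_at_ext _ _ _ _ (fun q : (X * Z) * (X * Z) =>
    L (q.1.1, q.2.2 - B ('d s (q.1.1) q.2.1) (L q.1)))).
  apply: filterS (near_fst (xi, eta) (near_fst h K)) => -[[y u] [v w]] /= [k1 k2].
  by have [_ ->] := is_diff_inverse u bB k2 k1.
have F1 := @smooth_at_fst R k (X * Z)%type (X * Z)%type ((x, h), (xi, eta)).
have F2 := @smooth_at_snd R k (X * Z)%type (X * Z)%type ((x, h), (xi, eta)).
have S1 : smooth_at k (fun q : (X * Z) * (X * Z) => q.1.1) ((x, h), (xi, eta)).
  exact: smooth_at_comp F1 (smooth_at_fst _ _).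
have S2 : smooth_at k (fun q : (X * Z) * (X * Z) => q.2.1) ((x, h), (xi, eta)).
  exact: smooth_at_comp F2 (smooth_at_fst _ _).
have S3 : smooth_at k (fun q : (X * Z) * (X * Z) => q.2.2) ((x, h), (xi, eta)).
  exact: smooth_at_comp F2 (smooth_at_snd _ _).
apply: (@smooth_at_comp _ _ _ _ _ (fun q : (X * Z) * (X * Z) =>
    (q.1.1, q.2.2 - B ('d s (q.1.1) q.2.1) (L q.1))) L); last first.
  by apply: IH => //; exact: smooth_at_pred.
apply: smooth_at_pair => //; apply: smooth_atB => //.
apply: smooth_at_bil => //.
  apply: (@smooth_at_comp _ _ _ _ _ (fun q : (X * Z) * (X * Z) => (q.1.1, q.2.1))
    (fun q => 'd s (q.1) q.2)); first exact: smooth_at_pair.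
  by case: Ss => _; apply.
apply: smooth_at_comp F1 _.
by apply: IH => //; exact: smooth_at_pred.
Unshelve. all: by end_near. Qed.

(** Differentiating [B (s y) (s y) = g y] shows that the differential of [s] is [L (y, 'd g y v)],
    with [L] inverse to [u -> B s u + B u s]. The quadratic remainder [B D D] is negligible by
    continuity of [s], and the regularity of [L] follows from that of [s] one order below. *)
Lemma smooth_at_sqrt k (X Z : normedModType R) (B : Z -> Z -> Z)
    (s g : X -> Z) L x : bilinear_map B -> smooth_at k g x ->
  (\forall y \near x, {for y, continuous s}) ->
  (\forall y \near x, B (s y) (s y) = g y) ->
  (\forall y \near x, inverse_at (fun u v => B u v + B v u) s L y) ->
  smooth_at k s x.
Proof.
move=> bB; have [CB CB0 hCB] := bilinear_map_pos bB.
have [lBl lBr _] := bB.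
have bB' : bilinear_map (fun u v => B u v + B v u).
  split.
  - by move=> v t u w /=; rewrite lBl lBr scalerDr addrACA.
  - by move=> v t u w /=; rewrite lBl lBr scalerDr addrACA.
  - exists (CB + CB) => u v; apply: (le_trans (ler_normD _ _)).
    rewrite !mulrDl lerD//; apply: (le_trans (hCB _ _)).
    by rewrite -!mulrA [`|u| * _]mulrC.
elim: k x => [|k IH] x Sg cs sg iL; first exact: nbhs_singleton cs.
have ds : \forall y \near x, is_diff y s (fun v => L (y, 'd g y v)).
  have cs' := near_join cs; have sg' := near_join sg; have iL' := near_join iL.
  near=> y.
  have dgy : differentiable g y by near: y; exact: smooth_at_near1 Sg.
  have csy : {for y, continuous s} by near: y.
  have iLy : inverse_at (fun u v => B u v + B v u) s L y by near: y.
  have sgy : \forall z \near y, B (s z) (s z) = g z by near: y.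
  have lL := inverse_at_linear bB' iLy.
  have [h1 h2 bL] := iLy; have [C C0 hC] := bounded_map_pos bL.
  have [Cg Cg0 hCg] := bounded_map_pos (diff_bounded dgy).
  apply: is_diff_implicit.
  - by move=> t u v; rewrite linearP lL.
  - exists (C * Cg) => v; apply: (le_trans (hC _)).
    by rewrite -mulrA ler_pM2l.
  move=> e e0.
  pose e1 := e / C; have e10 : 0 < e1 by rewrite divr_gt0.
  have e20 : 0 < e1 / CB by rewrite divr_gt0.
  near=> h.
  have k1 : `|g (y + h) - g y - 'd g y h| <= e1 * `|h|.
    by near: h; exact: differentiable_eps.
  have k2 : `|s (y + h) - s y| <= e1 / CB.
    near: h; apply: (@near_shift0 _ y (fun z => `|s z - s y| <= e1 / CB)).
    have /cvgrPdist_le /(_ _ e20) := csy.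
    by apply: filterS => z; rewrite distrC.
  have k3 : B (s (y + h)) (s (y + h)) = g (y + h).
    by near: h; exact: (@near_shift0 _ y (fun z => B (s z) (s z) = g z)).
  have k4 : B (s y) (s y) = g y by exact: nbhs_singleton sgy.
  move: k1 k2; set D := s (y + h) - s y => k1 k2.
  have sE : s (y + h) = s y + D by rewrite [s y + _]addrC subrK.
  clearbody D.
  have gE : g (y + h) - g y = (B (s y) D + B D (s y)) + B D D.
    rewrite -k3 -k4 sE (linearmapD (lBl _)) !(linearmapD (lBr _)).
    by rewrite [LHS](AC (2*2*1) ((1*5)*(2*3*4)))/= subrr add0r.
  have -> : D - L (y, 'd g y h) =
      L (y, (g (y + h) - g y - 'd g y h) - B D D).
    rewrite addrAC (linearmapB lL); congr (_ - _).
    by rewrite gE addrK h1.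
  apply: (le_trans (hC _)).
  apply: (@le_trans _ _ (C * (e1 * `|h| + e1 * `|D|))).
    rewrite ler_pM2l//; apply: (le_trans (ler_normB _ _)); rewrite lerD//.
    apply: (le_trans (hCB _ _)); rewrite ler_wpM2r//.
    by rewrite mulrC -ler_pdivlMr.
  by rewrite (_ : C * _ = e * (`|h| + `|D|))// /e1; field; rewrite gt_eqF.
split; first by apply: filterS ds => y [].
move=> v.
apply: (@smooth_at_ext _ _ _ _ (fun q : X * X => L (q.1, 'd g (q.1) q.2))).
  by apply: filterS (near_fst v ds) => -[y u] /= [_ ->].
have Ss : smooth_at k s x by apply: IH => //; exact: smooth_at_pred.
apply: (@smooth_at_comp _ _ _ _ _ (fun q : X * X => (q.1, 'd g (q.1) q.2)) L).
  apply: smooth_at_pair; first exact: smooth_at_fst.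
  by case: Sg => _; apply.
exact: (smooth_at_inverse _ bB' Ss iL).
Unshelve. all: by end_near. Qed.

End Implicit.

(** * Matrices over a closed field *)

Section Matrices.
Variables (C : numClosedFieldType) (r : nat).
Implicit Types A B S T U V Z : 'M[C]_r.

Lemma adjmxM A B : (A *m B) ^t* = B ^t* *m A ^t*.
Proof. by rewrite trmx_mul map_mxM. Qed.

Lemma adjmxD A B : (A + B) ^t* = A ^t* + B ^t*.
Proof. by rewrite linearD /= map_mxD. Qed.

Lemma adjmxB A B : (A - B) ^t* = A ^t* - B ^t*.
Proof. by rewrite linearB /= map_mxB. Qed.

Lemma unitmx_adj A : (A ^t* \in unitmx) = (A \in unitmx).
Proof. by rewrite unitmxE det_map_mx det_tr fmorph_unit -unitfE -unitmxE. Qed.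

Lemma entry_le_norm A i j : `|A i j| <= `|A|.
Proof.
rewrite [leRHS]/Num.norm/= mx_normE.
rewrite (_ : `|A i j| = `|A (i, j).1 (i, j).2|%:nng%:num)//.
by rewrite num_le; exact: (le_bigmax _ (fun ij => `|A ij.1 ij.2|%:nng)).
Qed.

Lemma mx_norm_le A (k : C) : 0 <= k -> (forall i j, `|A i j| <= k) -> `|A| <= k.
Proof.
move=> k0 H; rewrite [leLHS]/Num.norm/= mx_normE.
rewrite (_ : k = (NngNum k0)%:num)// num_le; apply/bigmax_leP; split=> //=.
by move=> [i j] _; rewrite -num_le /=; exact: H.
Qed.

Lemma norm_mulmx A B : `|A *m B| <= r%:R * `|A| * `|B|.
Proof.
apply: mx_norm_le => [|i j]; first by rewrite !mulr_ge0.
rewrite mxE; apply: (le_trans (ler_norm_sum _ _ _)).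
rewrite -mulrA mulr_natl -[X in _ *+ X]card_ord -sumr_const.
by apply: ler_sum => k _; rewrite normrM ler_pM// entry_le_norm.
Qed.

Lemma norm_adjmx A : `|A ^t*| = `|A|.
Proof.
have H B : `|B ^t*| <= `|B|.
  apply: mx_norm_le => // i j; rewrite !mxE norm_conjC; exact: entry_le_norm.
by apply/le_anti; rewrite H /= -{1}[A]trmxCK H.
Qed.

Lemma norm_mxtrace A : `|\tr A| <= r%:R * `|A|.
Proof.
apply: (le_trans (ler_norm_sum _ _ _)).
rewrite mulr_natl -[X in _ *+ X]card_ord -sumr_const.
by apply: ler_sum => k _; exact: entry_le_norm.
Qed.

Lemma mxtrace_gram Z : \tr (Z ^t* *m Z) = \sum_i \sum_j `|Z j i| ^+ 2.
Proof.
rewrite /mxtrace; apply: eq_bigr => i _; rewrite mxE; apply: eq_bigr => j _.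
by rewrite !mxE normCKC.
Qed.

(** The norm is the largest modulus of an entry, and its square is one term of the squared Frobenius
    norm. *)
Lemma sqr_norm_gram Z : `|Z| ^+ 2 <= \tr (Z ^t* *m Z).
Proof.
have g0 : 0 <= \tr (Z ^t* *m Z).
  by rewrite mxtrace_gram !sumr_ge0// => i _; rewrite sumr_ge0// => j _; rewrite exprn_ge0.
have [|s0] := boolP (`|Z| == 0); first by move=> /eqP ->; rewrite expr0n.
have [[i j] /= E] := mx_norm_neq0 s0; rewrite -[`|Z|]/(mx_norm Z) E.
rewrite mxtrace_gram (bigD1 j)//= (bigD1 i)//= -addrA lerDl addr_ge0//.
  by rewrite sumr_ge0// => k _; rewrite exprn_ge0.
by rewrite sumr_ge0// => k _; rewrite sumr_ge0// => l _; rewrite exprn_ge0.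
Qed.

Lemma psdmx_adj A : psdmx A -> A ^t* = A.
Proof. by move=> [/is_hermitianmxP + _]; rewrite expr0 scale1r. Qed.

Lemma psdmx_tr A Z : psdmx A -> 0 <= \tr (Z ^t* *m A *m Z).
Proof.
move=> [_ pA]; rewrite /mxtrace sumr_ge0// => i _.
have <- : (row i (Z ^t*) *m A *m (row i (Z ^t*)) ^t*) 0 0 =
    (Z ^t* *m A *m Z) i i.
  rewrite -row_mul [LHS]mxE [RHS]mxE; apply: eq_bigr => k _.
  by rewrite [in LHS]mxE; congr (_ * _); rewrite !mxE conjCK.
exact: pA.
Qed.

Lemma psdmx_gram' A Z : A ^t* = A -> \tr (Z ^t* *m (A *m A) *m Z) =
  \tr ((A *m Z) ^t* *m (A *m Z)).
Proof. by move=> hA; rewrite adjmxM hA !mulmxA. Qed.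

Lemma sqrtmx_unit A : psdmx A -> A \in unitmx -> sqrtmx A \in unitmx.
Proof.
move=> pA uA; have [_ sE] := sqrtmxP pA.
by move: uA; rewrite -{1}sE unitmx_mul => /andP[].
Qed.

(** With [A = S S] the trace is the squared Frobenius norm of [S Z], and [Z] is recovered from [S Z]
    by the inverse of [S]. *)
Lemma psdmx_coercive A : psdmx A -> A \in unitmx ->
  exists2 K : C, 0 < K & forall Z, `|Z| ^+ 2 <= K * \tr (Z ^t* *m A *m Z).
Proof.
move=> pA uA; have [pS SE] := sqrtmxP pA.
have uS := sqrtmx_unit pA uA; set S := sqrtmx A in pS SE uS.
pose k := r%:R * `|invmx S| + 1.
have k0 : 0 < k by rewrite ltr_wpDl// mulr_ge0.
exists (k ^+ 2); first by rewrite exprn_gt0.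
move=> Z; rewrite -{1}SE psdmx_gram' ?(psdmx_adj pS)//.
apply: (@le_trans _ _ (k ^+ 2 * `|S *m Z| ^+ 2)); last first.
  by rewrite ler_pM2l ?exprn_gt0// sqr_norm_gram.
have h : `|Z| <= k * `|S *m Z|.
  rewrite -[in leLHS](mulKmx uS Z); apply: (le_trans (norm_mulmx _ _)).
  by rewrite ler_wpM2r// /k lerDl.
by rewrite -exprMn; apply: lerXn2r h; rewrite nnegrE ?mulr_ge0// ltW.
Qed.

Lemma mxtrace_mul_norm A B : `|\tr (A *m B)| <= r%:R ^+ 2 * `|A| * `|B|.
Proof.
apply: (le_trans (norm_mxtrace _)); rewrite expr2 -!mulrA ler_wpM2l//.
by rewrite mulrA norm_mulmx.
Qed.

(* Pair [A *m Z + Z *m A] with [Z]: the two resulting traces are nonnegative and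
   the first one is coercive. *)
Lemma sylvester_bound A : psdmx A -> A \in unitmx ->
  exists2 K : C, 0 < K & forall Z, `|Z| <= K * `|A *m Z + Z *m A|.
Proof.
move=> pA uA; have [K K0 hK] := psdmx_coercive pA uA.
have K1 : 0 < K * r%:R ^+ 2 + 1 by rewrite ltr_wpDl// mulr_ge0 ?exprn_ge0// ltW.
exists (K * r%:R ^+ 2 + 1) => //.
move=> Z; have [->|Z0] := eqVneq Z 0.
  by rewrite normr0 mulr_ge0// ltW.
have nZ : 0 < `|Z| by rewrite normr_gt0.
rewrite -(ler_pM2l nZ) -expr2; apply: (le_trans (hK Z)).
apply: (@le_trans _ _ (K * `|\tr (Z ^t* *m (A *m Z + Z *m A))|)).
  rewrite ler_pM2l// mulmxDr mxtraceD.
  have h1 : 0 <= \tr (Z ^t* *m (A *m Z)) by rewrite mulmxA psdmx_tr.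
  have h2 : 0 <= \tr (Z ^t* *m (Z *m A)).
    by rewrite mxtrace_mulC; have := psdmx_tr (Z ^t*) pA; rewrite trmxCK.
  by rewrite -mulmxA ger0_norm ?addr_ge0// lerDl.
apply: (@le_trans _ _ (K * (r%:R ^+ 2 * `|Z| * `|A *m Z + Z *m A|))).
  rewrite ler_pM2l//; apply: (le_trans (mxtrace_mul_norm _ _)).
  by rewrite norm_adjmx.
have -> : K * (r%:R ^+ 2 * `|Z| * `|A *m Z + Z *m A|) =
  `|Z| * (K * r%:R ^+ 2 * `|A *m Z + Z *m A|) by ring.
by rewrite ler_pM2l// ler_wpM2r// lerDl.
Qed.

(* [Z = B - A] solves [B *m Z + Z *m A = B *m B - A *m A]; pair with [Z] again. *)
Lemma psdmx_sqr_lipschitz A : psdmx A -> A \in unitmx ->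
  exists2 K : C, 0 < K & forall B, psdmx B ->
    `|B - A| <= K * `|B *m B - A *m A|.
Proof.
move=> pA uA; have [K K0 hK] := psdmx_coercive pA uA.
have K1 : 0 < K * r%:R ^+ 2 + 1 by rewrite ltr_wpDl// mulr_ge0 ?exprn_ge0// ltW.
exists (K * r%:R ^+ 2 + 1) => //.
move=> B pB; set Z := B - A.
have [->|Z0] := eqVneq Z 0.
  by rewrite normr0 mulr_ge0// ltW.
have nZ : 0 < `|Z| by rewrite normr_gt0.
have hZ : Z ^t* = Z by rewrite /Z adjmxB !psdmx_adj.
have ZE : B *m B - A *m A = B *m Z + Z *m A.
  by rewrite /Z mulmxBr mulmxBl addrA subrK.
rewrite ZE -(ler_pM2l nZ) -expr2; apply: (le_trans (hK Z)).
apply: (@le_trans _ _ (K * `|\tr (Z ^t* *m (B *m Z + Z *m A))|)).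
  rewrite ler_pM2l// mulmxDr mxtraceD.
  have h1 : 0 <= \tr (Z ^t* *m (B *m Z)) by rewrite mulmxA psdmx_tr.
  have h2 : \tr (Z ^t* *m (Z *m A)) = \tr (Z ^t* *m A *m Z).
    by rewrite hZ mulmxA mxtrace_mulC mulmxA mxtrace_mulC mulmxA.
  rewrite h2 ger0_norm ?addr_ge0 ?psdmx_tr//.
  by rewrite lerDr.
apply: (@le_trans _ _ (K * (r%:R ^+ 2 * `|Z| * `|B *m Z + Z *m A|))).
  rewrite ler_pM2l//; apply: (le_trans (mxtrace_mul_norm _ _)).
  by rewrite norm_adjmx.
have -> : K * (r%:R ^+ 2 * `|Z| * `|B *m Z + Z *m A|) =
  `|Z| * (K * r%:R ^+ 2 * `|B *m Z + Z *m A|) by ring.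
by rewrite ler_pM2l// ler_wpM2r// lerDl.
Qed.

(** Uniqueness of the positive square root, read off the Lipschitz estimate. It is the only way in
    which roots are computed below, since [sqrtmx] rests on a chosen diagonalization. *)
Lemma psdmx_sqr_inj A B : psdmx A -> psdmx B -> A \in unitmx ->
  B *m B = A *m A -> B = A.
Proof.
move=> pA pB uA E; have [K _ /(_ B pB)] := psdmx_sqr_lipschitz pA uA.
by rewrite E subrr normr0 mulr0 normr_le0 subr_eq0 => /eqP.
Qed.

End Matrices.

(** * Polar decomposition and one step of the Aluthge transform *)

Section Polar.
Variables (C : numClosedFieldType) (r : nat).
Implicit Types A B S T U W X Z : 'M[C]_r.

(** The solution [Z] of [A Z + Z A = H], through the matrix of this operator on vectorized matrices.
    The value is meaningful when that matrix is invertible, as it is for [A] positive definite. *)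
Definition sylvester A H : 'M[C]_r :=
  vec_mx (mxvec H *m invmx (lin_mx (mulmx A \+ mulmxr A))).

Lemma sylvester_unit A : psdmx A -> A \in unitmx ->
  lin_mx (mulmx A \+ mulmxr A) \in unitmx.
Proof.
move=> pA uA; have [K K0 hK] := sylvester_bound pA uA.
rewrite -row_free_unit -kermx_eq0; apply/eqP/row_matrixP => i; rewrite row0.
set v := row i _.
have : v *m lin_mx (mulmx A \+ mulmxr A) = 0 by rewrite -row_mul mulmx_ker row0.
rewrite -[v]vec_mxK mul_vec_lin /= => /(congr1 vec_mx).
rewrite mxvecK linear0 => E; have := hK (vec_mx v).
by rewrite E normr0 mulr0 normr_le0 => /eqP ->; rewrite linear0.
Qed.

Lemma sylvesterK A Z : psdmx A -> A \in unitmx ->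
  sylvester A (A *m Z + Z *m A) = Z.
Proof.
move=> pA uA; have uL := sylvester_unit pA uA.
rewrite /sylvester.
have -> : mxvec (A *m Z + Z *m A) = mxvec Z *m lin_mx (mulmx A \+ mulmxr A).
  by rewrite mul_vec_lin.
by rewrite mulmxK// mxvecK.
Qed.

Lemma sylvesterVK A H : psdmx A -> A \in unitmx ->
  A *m sylvester A H + sylvester A H *m A = H.
Proof.
move=> pA uA; have uL := sylvester_unit pA uA.
apply: (can_inj mxvecK).
have := mul_vec_lin (mulmx A \+ mulmxr A) (sylvester A H) => /= <-.
by rewrite vec_mxK mulmxKV.
Qed.

Definition habsmx T := sqrtmx (absmx T).

Lemma absmx_psd T : psdmx (absmx T).
Proof. by have [] := sqrtmxP (psdmx_gram T). Qed.

Lemma absmx_sqr T : absmx T *m absmx T = T ^t* *m T.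
Proof. by have [] := sqrtmxP (psdmx_gram T). Qed.

Lemma absmx_unit T : T \in unitmx -> absmx T \in unitmx.
Proof.
move=> uT; apply: sqrtmx_unit; first exact: psdmx_gram.
by rewrite unitmx_mul unitmx_adj uT.
Qed.

Lemma habsmx_psd T : psdmx (habsmx T).
Proof. by have [] := sqrtmxP (absmx_psd T). Qed.

Lemma habsmx_sqr T : habsmx T *m habsmx T = absmx T.
Proof. by have [] := sqrtmxP (absmx_psd T). Qed.

Lemma habsmx_unit T : T \in unitmx -> habsmx T \in unitmx.
Proof. move=> uT; exact: sqrtmx_unit (absmx_psd T) (absmx_unit uT). Qed.

(** The unitary factor of an invertible matrix by an explicit formula, from which smoothness can be
    read, in place of the choice made by [polar_factor]. *)
Definition phasemx T := T *m invmx (absmx T).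

Lemma phasemxK T : T \in unitmx -> phasemx T *m absmx T = T.
Proof. by move=> uT; rewrite mulmxKV// absmx_unit. Qed.

Lemma polar_phase T : T \in unitmx -> polar_factor T = phasemx T.
Proof.
move=> uT; have [_ E] := polar_factorP uT.
by rewrite /phasemx [X in _ = X *m _]E mulmxK// absmx_unit.
Qed.

Lemma phasemx_unit T : T \in unitmx -> phasemx T \in unitmx.
Proof. by move=> uT; rewrite unitmx_mul uT unitmx_inv absmx_unit. Qed.

Lemma phasemx_unitary T : T \in unitmx -> phasemx T \is unitarymx.
Proof. by move=> uT; rewrite -polar_phase//; have [] := polar_factorP uT. Qed.

Lemma phasemx_inv T : T \in unitmx -> invmx (phasemx T) = (phasemx T) ^t*.
Proof. by move=> uT; rewrite invmx_unitary// phasemx_unitary. Qed.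

Lemma aluthgeE T : T \in unitmx ->
  aluthge T = habsmx T *m phasemx T *m habsmx T.
Proof. by move=> uT; rewrite /aluthge polar_phase. Qed.

(** From T = U h h one gets U h = T h^-1. The transform is thus a similarity, which preserves
    eigenvalues along orbits. *)
Lemma aluthge_conj T : T \in unitmx ->
  aluthge T = habsmx T *m T *m invmx (habsmx T).
Proof.
move=> uT; have := habsmx_sqr T; have := phasemxK uT; have := habsmx_unit uT.
rewrite aluthgeE//.
move: (habsmx T) (phasemx T) (absmx T) => h U P uh <- <-.
by rewrite !mulmxA mulmxK.
Qed.

Lemma aluthge_unit T : T \in unitmx -> aluthge T \in unitmx.
Proof.
move=> uT; rewrite aluthge_conj//; move: (habsmx T) (habsmx_unit uT) => h uh.
by rewrite !unitmx_mul unitmx_inv uT uh.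
Qed.

Lemma iter_aluthge_unit T n : T \in unitmx -> iter n (@aluthge C r) T \in unitmx.
Proof. by move=> uT; elim: n => //= n IH; exact: aluthge_unit. Qed.

Lemma iter_aluthge_conj T n : T \in unitmx ->
  exists2 G, G \in unitmx & iter n (@aluthge C r) T *m G = G *m T.
Proof.
move=> uT; elim: n => [|n [G uG E]].
  by exists 1%:M; rewrite ?unitmx1//= mulmx1 mul1mx.
have uTn := iter_aluthge_unit n uT.
rewrite iterS aluthge_conj//; move: (habsmx _) (habsmx_unit uTn) => h uh.
exists (h *m G); first by rewrite unitmx_mul uh.
by rewrite -!mulmxA (mulKmx uh) E.
Qed.

Lemma phasemx_adjK T : T \in unitmx ->
  (phasemx T) ^t* *m phasemx T = 1%:M /\ phasemx T *m (phasemx T) ^t* = 1%:M.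
Proof.
by move=> uT; rewrite -phasemx_inv// mulVmx ?mulmxV// phasemx_unit.
Qed.

(** The self-commutator, which vanishes exactly on the normal matrices. *)
Definition defect T := T ^t* *m T - T *m T ^t*.
Definition phase_comm T := absmx T *m phasemx T - phasemx T *m absmx T.

(** Since T = U P, multiplying the self-commutator by U on the right gives P^2 U - U P^2, and this
    is P q + q P for q = P U - U P. *)
Lemma defectE T : T \in unitmx ->
  absmx T *m phase_comm T + phase_comm T *m absmx T = defect T *m phasemx T.
Proof.
move=> uT; rewrite /defect /phase_comm -absmx_sqr.
have := psdmx_adj (absmx_psd T); have [+ _] := phasemx_adjK uT.
have := phasemxK uT.
move: (phasemx T) (absmx T) => U P TE UU hP.
rewrite -TE adjmxM hP.
rewrite mulmxBl mulmxBr mulmxBl -!mulmxA UU mulmx1.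
by rewrite addrA subrK.
Qed.

Lemma defect_aluthge T : T \in unitmx ->
  defect (aluthge T) = habsmx T *m (invmx (phasemx T) *m phase_comm T +
    phase_comm T *m invmx (phasemx T)) *m habsmx T.
Proof.
move=> uT; rewrite /defect /phase_comm aluthgeE// phasemx_inv// -habsmx_sqr.
have := psdmx_adj (habsmx_psd T); have [] := phasemx_adjK uT.
move: (phasemx T) (habsmx T) => U h UU UV hh; rewrite !adjmxM hh.
have -> : U ^t* *m (h *m h *m U - U *m (h *m h)) +
    (h *m h *m U - U *m (h *m h)) *m U ^t* =
    U ^t* *m (h *m h) *m U - U *m (h *m h) *m U ^t*.
  rewrite mulmxBr mulmxBl !mulmxA UU mul1mx -[_ *m U *m U ^t*]mulmxA UV mulmx1.
  by rewrite addrA subrK.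
by rewrite mulmxBr mulmxBl !mulmxA.
Qed.

(** With P = h h, the commutator of P and U is h c + c h for c = h U - U h, while h U h - T = c
    h. *)
Lemma aluthge_sub T : T \in unitmx ->
  aluthge T - T = sylvester (habsmx T) (phase_comm T) *m habsmx T.
Proof.
move=> uT; rewrite /phase_comm aluthgeE// -habsmx_sqr.
have := phasemxK uT; rewrite -habsmx_sqr.
have := habsmx_psd T; have := habsmx_unit uT.
move: (phasemx T) (habsmx T) => U h uh ph TE.
have -> : h *m h *m U - U *m (h *m h) = h *m (h *m U - U *m h) + (h *m U - U *m h) *m h.
  by rewrite mulmxBr mulmxBl !mulmxA addrA subrK.
by rewrite sylvesterK// mulmxBl -[U *m h *m h]mulmxA TE.
Qed.

Lemma defect_tr T X : T *m X = X *m T -> \tr (defect T *m X) = 0.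
Proof.
move=> E; rewrite /defect mulmxBl linearB /=.
by rewrite -!mulmxA E [X in _ - X]mxtrace_mulC mulmxA subrr.
Qed.

(** On expansion, unitarity turns both square terms into the trace of P^2, the squared Frobenius
    norm of T; by cyclicity both cross terms equal the squared Frobenius norm of the transform. *)
Lemma phase_comm_gram T : T \in unitmx ->
  \tr ((phase_comm T) ^t* *m phase_comm T) =
  2 * (\tr (T ^t* *m T) - \tr ((aluthge T) ^t* *m aluthge T)).
Proof.
move=> uT; rewrite /phase_comm aluthgeE// -absmx_sqr -habsmx_sqr.
have := psdmx_adj (habsmx_psd T); have [] := phasemx_adjK uT.
move: (phasemx T) (habsmx T) => U h UU UV hh; rewrite !adjmxM.
have -> : \tr (h ^t* *m (U ^t* *m h ^t*) *m (h *m U *m h)) =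
    \tr (U ^t* *m (h *m h) *m U *m (h *m h)).
  by rewrite hh -[h *m _ *m _]mulmxA mxtrace_mulC !mulmxA.
rewrite adjmxB !adjmxM hh mulmxBr !mulmxBl !linearB /= !mulmxA.
have -> : \tr (U ^t* *m h *m h *m h *m h *m U) = \tr (h *m h *m h *m h).
  by rewrite mxtrace_mulC !mulmxA UV mul1mx.
have -> : \tr (h *m h *m U ^t* *m h *m h *m U) =
    \tr (U ^t* *m h *m h *m U *m h *m h).
  by rewrite -!mulmxA [LHS]mxtrace_mulC -!mulmxA [LHS]mxtrace_mulC -!mulmxA.
have -> : \tr (h *m h *m U ^t* *m U *m h *m h) = \tr (h *m h *m h *m h).
  by rewrite -[_ *m U ^t* *m U]mulmxA UU mulmx1.
ring.
Qed.

End Polar.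

(** * Equivariance under unitary conjugation *)

Section Equivariance.
Variables (C : numClosedFieldType) (r : nat).
Implicit Types A B S T U W X Z : 'M[C]_r.

Lemma psdmx_conj A W : psdmx A -> psdmx (W *m A *m W ^t*).
Proof.
move=> pA; have [pS <-] := sqrtmxP pA.
rewrite -{1}(psdmx_adj pS); move: (sqrtmx A) => S.
have -> : W *m (S ^t* *m S) *m W ^t* = (S *m W ^t*) ^t* *m (S *m W ^t*).
  by rewrite adjmxM trmxCK !mulmxA.
exact: psdmx_gram.
Qed.

Section Unitary.
Variable W : 'M[C]_r.
Hypothesis uW : W \is unitarymx.

Let WW : W *m W ^t* = 1%:M. Proof. exact/unitarymxP. Qed.
Let VW : W ^t* *m W = 1%:M. Proof. exact: mulmx1C. Qed.

Lemma conj_mul A B : W *m A *m W ^t* *m (W *m B *m W ^t*) = W *m (A *m B) *m W ^t*.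
Proof. by rewrite !mulmxA -(mulmxA _ (W ^t*) W) VW mulmx1. Qed.

Lemma conj_adj A : (W *m A *m W ^t*) ^t* = W *m A ^t* *m W ^t*.
Proof. by rewrite !adjmxM trmxCK mulmxA. Qed.

Lemma conj_unit A : (W *m A *m W ^t* \in unitmx) = (A \in unitmx).
Proof.
rewrite !unitmx_mul unitmx_adj unitarymx_unit//= andbT.
by [].
Qed.

(** Both sides are positive roots of the same invertible matrix, hence equal by uniqueness. *)
Lemma sqrtmx_conj A : psdmx A -> A \in unitmx ->
  sqrtmx (W *m A *m W ^t*) = W *m sqrtmx A *m W ^t*.
Proof.
move=> pA uA; have [pS SE] := sqrtmxP pA.
have [pS' SE'] := sqrtmxP (psdmx_conj W pA).
symmetry; apply: psdmx_sqr_inj => //; first exact: psdmx_conj.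
  by apply: sqrtmx_unit; [exact: psdmx_conj|rewrite conj_unit].
by rewrite SE' conj_mul SE.
Qed.

Lemma absmx_conj T : T \in unitmx ->
  absmx (W *m T *m W ^t*) = W *m absmx T *m W ^t*.
Proof.
move=> uT; rewrite {1}/absmx conj_adj conj_mul sqrtmx_conj//.
  exact: psdmx_gram.
by rewrite unitmx_mul unitmx_adj uT.
Qed.

Lemma habsmx_conj T : T \in unitmx ->
  habsmx (W *m T *m W ^t*) = W *m habsmx T *m W ^t*.
Proof.
move=> uT; rewrite {1}/habsmx absmx_conj// sqrtmx_conj//.
  exact: absmx_psd.
exact: absmx_unit.
Qed.

Lemma aluthge_unitary_conj T : T \in unitmx ->
  aluthge (W *m T *m W ^t*) = W *m aluthge T *m W ^t*.
Proof.
move=> uT; have uT' : W *m T *m W ^t* \in unitmx by rewrite conj_unit.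
rewrite !aluthge_conj// habsmx_conj//.
move: (habsmx T) (habsmx_unit uT) => h uh.
have -> : invmx (W *m h *m W ^t*) = W *m invmx h *m W ^t*.
  have uh' : W *m h *m W ^t* \in unitmx by rewrite conj_unit.
  apply: (can_inj (mulKmx uh')); rewrite mulmxV// conj_mul mulmxV// mulmx1.
  by rewrite WW.
by rewrite !conj_mul.
Qed.

Lemma iter_aluthge_unitary_conj n T : T \in unitmx ->
  iter n (@aluthge C r) (W *m T *m W ^t*) = W *m iter n (@aluthge C r) T *m W ^t*.
Proof.
move=> uT; elim: n => //= n ->; apply: aluthge_unitary_conj.
exact: iter_aluthge_unit.
Qed.

End Unitary.
End Equivariance.

(** * The linear maps of the system and their form at a diagonal matrix *)

Section Diagonal.
Variables (C : numClosedFieldType) (r : nat).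
Implicit Types (A T w Z : 'M[C]_r) (d e : 'rV[C]_r).

Lemma psdmx_diag e : (forall j, 0 <= e 0 j) -> psdmx (diag_mx e).
Proof.
move=> e0; have -> : diag_mx e =
  (diag_mx (map_mx sqrtC e)) ^t* *m diag_mx (map_mx sqrtC e).
  rewrite tr_diag_mx map_diag_mx mulmx_diag; congr diag_mx.
  apply/rowP => j; rewrite !mxE.
  have cE : (sqrtC (e 0 j))^* = sqrtC (e 0 j) by rewrite geC0_conj ?sqrtC_ge0.
  by rewrite [X in _ = X * _]cE -expr2 sqrtCK.
exact: psdmx_gram.
Qed.

Lemma diag_mx_unit e : (forall j, e 0 j != 0) -> diag_mx e \in unitmx.
Proof.
move=> e0; rewrite unitmxE det_diag unitfE; apply/prodf_neq0 => j _; exact: e0.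
Qed.

Lemma absmx_diag d : (forall j, d 0 j != 0) ->
  absmx (diag_mx d) = diag_mx (\row_j `|d 0 j|).
Proof.
move=> d0; apply: psdmx_sqr_inj.
- by apply: psdmx_diag => j; rewrite mxE.
- exact: absmx_psd.
- by apply: diag_mx_unit => j; rewrite mxE normr_eq0.
rewrite absmx_sqr tr_diag_mx map_diag_mx !mulmx_diag; congr diag_mx.
by apply/rowP => j; rewrite !mxE -expr2 normCKC.
Qed.

Lemma habsmx_diag d : (forall j, d 0 j != 0) ->
  habsmx (diag_mx d) = diag_mx (\row_j sqrtC `|d 0 j|).
Proof.
move=> d0; apply: psdmx_sqr_inj.
- by apply: psdmx_diag => j; rewrite mxE sqrtC_ge0.
- exact: habsmx_psd.
- by apply: diag_mx_unit => j; rewrite mxE sqrtC_eq0 normr_eq0.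
rewrite habsmx_sqr absmx_diag// mulmx_diag; congr diag_mx.
by apply/rowP => j; rewrite !mxE -expr2 sqrtCK.
Qed.

Lemma phasemx_diag d : (forall j, d 0 j != 0) ->
  phasemx (diag_mx d) = diag_mx (\row_j (d 0 j / `|d 0 j|)).
Proof.
move=> d0; have ud := diag_mx_unit d0; have uP := absmx_unit ud.
apply: (can_inj (mulmxK uP)); rewrite phasemxK// absmx_diag// mulmx_diag.
congr diag_mx; apply/rowP => j; rewrite !mxE divfK// normr_eq0; exact: d0.
Qed.

Lemma invmx_diag e : (forall j, e 0 j != 0) ->
  invmx (diag_mx e) = diag_mx (\row_j (e 0 j)^-1).
Proof.
move=> e0; have ue := diag_mx_unit e0.
apply: (can_inj (mulKmx ue)); rewrite mulmxV// mulmx_diag.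
apply/matrixP => i j; rewrite !mxE mulfV//.
Qed.

Lemma sylvester_diag e H : (forall j, 0 < e 0 j) ->
  sylvester (diag_mx e) H = \matrix_(i, j) (H i j / (e 0 i + e 0 j)).
Proof.
move=> e0; set Z := \matrix_(i, j) _.
have -> : H = diag_mx e *m Z + Z *m diag_mx e.
  apply/matrixP => i j; rewrite mxE mul_diag_mx mul_mx_diag !mxE.
  by rewrite mulrC -mulrDr divfK// gt_eqF// addr_gt0.
apply: sylvesterK; first by apply: psdmx_diag => j; exact: ltW.
by apply: diag_mx_unit => j; rewrite gt_eqF.
Qed.

Variable d : 'rV[C]_r.

(* At [T = diag_mx d] these are the coordinate projections; in general they
   commute with [T], so they are orthogonal to the self-commutator of [T]. *)
Definition lagrange (i : 'I_r) (T : 'M[C]_r) : 'M[C]_r :=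
  foldr (fun j M => (d 0 i - d 0 j)^-1 *: ((T - (d 0 j)%:M) *m M)) 1%:M
    [seq j <- enum 'I_r | j != i].

(** Fixes the self-commutator of [T], so inserting it changes nothing along orbits; at
    [T = diag_mx d] it erases the diagonal of [w]. *)
Definition strip (T w : 'M[C]_r) : 'M[C]_r :=
  w - \sum_i \tr (w *m lagrange i T) *: delta_mx i i.

(** The commutator q with an arbitrary [w] in place of the self-commutator. The maps a and b of the
    overview are [aluthge_shift] and [defect_map], built from it. *)
Definition strip_phase T w : 'M[C]_r :=
  sylvester (absmx T) (strip T w *m phasemx T).

Definition aluthge_shift T w : 'M[C]_r :=
  sylvester (habsmx T) (strip_phase T w) *m habsmx T.

Definition defect_map T w : 'M[C]_r :=
  habsmx T *m (invmx (phasemx T) *m strip_phase T w +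
    strip_phase T w *m invmx (phasemx T)) *m habsmx T.

Lemma lagrange_comm i T : T *m lagrange i T = lagrange i T *m T.
Proof.
rewrite /lagrange; elim: [seq _ <- _ | _] => [|j s IH] /=; first by rewrite mulmx1 mul1mx.
rewrite -scalemxAl -scalemxAr; congr (_ *: _).
have E : T *m (T - (d 0 j)%:M) = (T - (d 0 j)%:M) *m T.
  by rewrite mulmxBr mulmxBl scalar_mxC.
by rewrite mulmxA E -!mulmxA IH.
Qed.

Lemma strip_defect T : strip T (defect T) = defect T.
Proof.
rewrite /strip big1 ?subr0// => i _.
by rewrite defect_tr ?scale0r// lagrange_comm.
Qed.

Lemma strip_phase_defect T : T \in unitmx ->
  strip_phase T (defect T) = phase_comm T.
Proof.
move=> uT; rewrite /strip_phase strip_defect -defectE// sylvesterK//.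
  exact: absmx_psd.
exact: absmx_unit.
Qed.

Lemma aluthge_shiftE T : T \in unitmx ->
  aluthge T = T + aluthge_shift T (defect T).
Proof.
move=> uT; rewrite /aluthge_shift strip_phase_defect// -aluthge_sub//.
by rewrite addrC subrK.
Qed.

Lemma defect_mapE T : T \in unitmx ->
  defect (aluthge T) = defect_map T (defect T).
Proof. by move=> uT; rewrite /defect_map strip_phase_defect// defect_aluthge. Qed.

Hypothesis d0 : forall j, d 0 j != 0.
Hypothesis dinj : injective (d 0).

(** Lagrange interpolation: at the entry [k] different from [i] the factor [j = k] vanishes, and at
    [k = i] all factors are 1. *)
Lemma lagrange_diag i : lagrange i (diag_mx d) = delta_mx i i.
Proof.
have H (s : seq 'I_r) : foldr (fun j M => (d 0 i - d 0 j)^-1 *: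
    ((diag_mx d - (d 0 j)%:M) *m M)) 1%:M s =
  diag_mx (\row_k \prod_(j <- s) ((d 0 i - d 0 j)^-1 * (d 0 k - d 0 j))).
  elim: s => [|j s IH] /=.
    by apply/matrixP => k l; rewrite !mxE big_nil.
  have -> : diag_mx d - (d 0 j)%:M = diag_mx (\row_k (d 0 k - d 0 j)).
    by apply/matrixP => k l; rewrite !mxE -mulrnBl.
  rewrite IH mulmx_diag; apply/matrixP => k l; rewrite !mxE big_cons.
  by rewrite mulrnAr mulrA.
rewrite /lagrange H; apply/matrixP => k l; rewrite !mxE.
have [->|kl] := eqVneq k l; last first.
  by rewrite mulr0n; case: (k =P i) => //= <-; rewrite eq_sym (negbTE kl).
rewrite mulr1n andbb; have [->|li] := eqVneq l i.
  rewrite big_seq big1// => j; rewrite mem_filter => /andP[/= ji _].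
  rewrite mulVf// subr_eq0; apply/eqP => /dinj /eqP; rewrite eq_sym.
  by rewrite (negbTE ji).
rewrite (big_rem l)/=; last by rewrite mem_filter /= li mem_enum.
by rewrite subrr mulr0 mul0r.
Qed.

Lemma strip_diag w i j : strip (diag_mx d) w i j = w i j *+ (i != j).
Proof.
rewrite /strip !mxE summxE.
have E k : (\tr (w *m lagrange k (diag_mx d)) *: delta_mx k k) i j =
    (w k k *+ ((i == k) && (j == k)) : C).
  rewrite lagrange_diag !mxE /mxtrace (bigD1 k)//= big1 ?addr0.
    rewrite !mxE (bigD1 k)//= big1 ?addr0.
      by rewrite mxE !eqxx mulr1 mulr_natr.
    by move=> l lk; rewrite mxE (negbTE lk) mulr0.
  move=> l lk; rewrite !mxE big1// => m _.
  by rewrite mxE (negbTE lk) andbF mulr0.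
under eq_bigr do rewrite E.
rewrite (bigD1 i)//= big1 ?addr0; last first.
  by move=> k ki; rewrite eq_sym (negbTE ki).
by rewrite eqxx eq_sym; case: eqP => [->|_]; rewrite ?subrr ?mulr0n ?subr0.
Qed.

(** Combines |u + v| <= 2 with 2 x y <= x^2 + y^2. If u = v then the moduli differ and the second
    inequality is strict; otherwise the first one is. *)
Lemma abs_mul_phase_lt (a b : C) : a != 0 -> b != 0 -> a != b ->
  sqrtC `|a| * sqrtC `|b| * `|a / `|a| + b / `|b| | < `|a| + `|b|.
Proof.
move=> a0 b0 ab.
have na : 0 < `|a| by rewrite normr_gt0.
have nb : 0 < `|b| by rewrite normr_gt0.
set u := a / `|a|; set v := b / `|b|.
have nu : `|u| = 1 by rewrite normrM normfV normr_id divff// gt_eqF.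
have nv : `|v| = 1 by rewrite normrM normfV normr_id divff// gt_eqF.
set x := sqrtC `|a|; set y := sqrtC `|b|.
have x0 : 0 < x by rewrite sqrtC_gt0.
have y0 : 0 < y by rewrite sqrtC_gt0.
have xE : `|a| = x ^+ 2 by rewrite sqrtCK.
have yE : `|b| = y ^+ 2 by rewrite sqrtCK.
have uv2 : `|u + v| <= 2.
  by apply: (le_trans (ler_normD _ _)); rewrite nu nv.
have sq : `|a| + `|b| = 2 * (x * y) + (x - y) ^+ 2 by rewrite xE yE; ring.
have xyr : x - y \is Num.real by rewrite realB ?gtr0_real.
have xy2 : 0 <= (x - y) ^+ 2 by rewrite real_exprn_even_ge0.
rewrite sq mulrC.
have [uvE|uvN] := eqVneq u v.
  apply: (@le_lt_trans _ _ (2 * (x * y))).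
    by rewrite ler_pM2r// mulr_gt0.
  rewrite ltrDl lt_def xy2 andbT expf_eq0/= subr_eq0; apply/eqP => xy.
  have abE : `|a| = `|b| by rewrite xE yE xy.
  move/eqP: ab; apply.
  by rewrite -(divfK (lt0r_neq0 na) a) -/u uvE abE /v divfK// gt_eqF.
apply: (@lt_le_trans _ _ (2 * (x * y))); last by rewrite lerDl.
rewrite ltr_pM2r ?mulr_gt0// lt_neqAle uv2 andbT; apply/eqP => E.
(* Parallelogram law: for unit vectors, |u + v| = 2 forces u = v. *)
have : `|u + v| ^+ 2 + `|u - v| ^+ 2 = 2 * `|u| ^+ 2 + 2 * `|v| ^+ 2.
  rewrite !normCK rmorphD rmorphB; ring.
rewrite E nu nv expr1n mulr1 -natrD => /(canRL (addKr _)).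
rewrite (_ : - 2 ^+ 2 + (2 + 2)%:R = 0); last by ring.
by move/eqP; rewrite expf_eq0/= normr_eq0 subr_eq0 (negbTE uvN).
Qed.

(** The map acts entrywise, by finitely many multipliers of modulus less than 1. The rate is the
    largest modulus, obtained as the norm of the matrix [B] that collects them. *)
Lemma defect_map_diag_contr :
  exists2 rho : C, 0 <= rho < 1 &
    forall w, `|defect_map (diag_mx d) w| <= rho * `|w|.
Proof.
pose B : 'M[C]_r := \matrix_(i, j) ((sqrtC `|d 0 i| * sqrtC `|d 0 j| *
  `|d 0 i / `|d 0 i| + d 0 j / `|d 0 j| | / (`|d 0 i| + `|d 0 j|)) *+ (i != j)).
have na j : 0 < `|d 0 j| by rewrite normr_gt0.
exists `|B|.
  rewrite normr_ge0/=; have [->|B0] := eqVneq `|B| 0; first exact: ltr01.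
  have [[i j] /= E] := mx_norm_neq0 B0; rewrite -[`|B|]/(mx_norm B) E mxE.
  have [_|ij] /= := eqVneq i j; first by rewrite mulr0n normr0 ltr01.
  rewrite mulr1n ger0_norm; last first.
    by rewrite !mulr_ge0 ?sqrtC_ge0 ?invr_ge0 ?addr_ge0.
  rewrite ltr_pdivrMr ?addr_gt0// mul1r; apply: abs_mul_phase_lt => //.
  by apply/eqP => /dinj /eqP; rewrite (negbTE ij).
move=> w; apply: mx_norm_le => [|i j]; first by rewrite mulr_ge0.
have u0 k : (\row_j (d 0 j / `|d 0 j|)) 0 k != 0 :> C.
  by rewrite mxE mulf_neq0// invr_eq0 normr_eq0.
rewrite /defect_map /strip_phase habsmx_diag// phasemx_diag// invmx_diag//.
rewrite absmx_diag// sylvester_diag; last by move=> k; rewrite mxE.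
have dl (e : 'rV[C]_r) X : (diag_mx e *m X) i j = e 0 i * X i j.
  by rewrite mul_diag_mx mxE.
have dr (e : 'rV[C]_r) X : (X *m diag_mx e) i j = X i j * e 0 j.
  by rewrite mul_mx_diag mxE.
have da (X Y : 'M[C]_r) : (X + Y) i j = X i j + Y i j by rewrite mxE.
have dm (F : 'I_r -> 'I_r -> C) : (\matrix_(i, j) F i j) i j = F i j by rewrite mxE.
rewrite dr dl da dl dr !dm dr strip_diag !mxE.
have [_|ij] /= := eqVneq i j.
  by rewrite mulr0n !(mul0r, mulr0, addr0) normr0 mulr_ge0.
rewrite mulr1n.
apply: (@le_trans _ _ (`|B i j| * `|w i j|)); last by rewrite ler_pM// entry_le_norm.
rewrite mxE ij mulr1n.
have ui0 : d 0 i / `|d 0 i| != 0 by rewrite mulf_neq0// invr_eq0 normr_eq0.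
have uj0 : d 0 j / `|d 0 j| != 0 by rewrite mulf_neq0// invr_eq0 normr_eq0.
have nui : `|d 0 i / `|d 0 i| | = 1 by rewrite normrM normfV normr_id divff// gt_eqF.
have s0 : `|d 0 i| + `|d 0 j| != 0 by rewrite gt_eqF// addr_gt0.
move: (d 0 i / `|d 0 i|) (d 0 j / `|d 0 j|) (sqrtC `|d 0 i|) (sqrtC `|d 0 j|)
  (`|d 0 i| + `|d 0 j|)
  ui0 uj0 nui s0 => ui uj hi hj s ui0 uj0 nui s0.
(* The remaining division by [ui] is by a number of modulus 1. *)
have -> : hi * (ui^-1 * (w i j * uj / s) + w i j * uj / s / uj) * hj =
  hi * hj * (ui + uj) / s * w i j / ui by field; rewrite s0 ui0 uj0.
by rewrite [leLHS]normrM normfV nui invr1 mulr1 !normrM normr_id.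
Qed.

End Diagonal.

(** * The real form of the matrix space *)

Section RealForm.
Variables (R : realType) (r : nat).
Local Notation MC := 'M[R[i]]_r.
Local Notation MR := ('M[R]_r * 'M[R]_r)%type.
Implicit Types (X Y : MR) (S T Z : MC).

Lemma reim_mxK T : mx_of_reim (reim_mx T) = T.
Proof. by apply/matrixP => i j; rewrite !mxE; case: (T i j). Qed.

Lemma mx_of_reimK X : reim_mx (mx_of_reim X) = X.
Proof. by case: X => A B; congr pair; apply/matrixP => i j; rewrite !mxE. Qed.

Lemma mx_of_reimE t X Y :
  mx_of_reim (t *: X + Y) = t%:C%C *: mx_of_reim X + mx_of_reim Y.
Proof.
apply/matrixP => i j; rewrite !mxE; apply/eqP; rewrite eq_complex /=.
by rewrite !mul0r subr0 addr0 !eqxx.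
Qed.

Lemma reim_mxD S T : reim_mx (S + T) = reim_mx S + reim_mx T.
Proof.
by congr pair; apply/matrixP => i j; rewrite !mxE; case: (S i j) (T i j) => [? ?] [].
Qed.

Lemma reim_mxN T : reim_mx (- T) = - reim_mx T.
Proof. by congr pair; apply/matrixP => i j; rewrite !mxE; case: (T i j). Qed.

Lemma reim_mxB S T : reim_mx (S - T) = reim_mx S - reim_mx T.
Proof. by rewrite reim_mxD reim_mxN. Qed.

Lemma reim_mxZ t T : reim_mx (t%:C%C *: T) = t *: reim_mx T.
Proof.
by congr pair; apply/matrixP => i j; rewrite !mxE; case: (T i j) => a b /=;
  rewrite mul0r ?subr0 ?addr0.
Qed.

Lemma mx_of_reimB X Y : mx_of_reim (X - Y) = mx_of_reim X - mx_of_reim Y.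
Proof. by apply: (can_inj reim_mxK); rewrite reim_mxB !mx_of_reimK. Qed.

(** The norm of a complex matrix takes its values in [R[i]]; this is the same number as an element
    of [R]. *)
Definition modmx T : R := complex.Re `|T|.

Lemma modmxE T : `|T| = (modmx T)%:C%C.
Proof. by rewrite /modmx RRe_real// normr_real. Qed.

Lemma modmx_ge0 T : 0 <= modmx T.
Proof. by rewrite -ler0c -modmxE. Qed.

Lemma norm_reim_le T : `|reim_mx T| <= modmx T.
Proof.
have H (f : R[i] -> R) : (forall z, `|f z|%:C%C <= `|z|) ->
    `|map_mx f T| <= modmx T.
  move=> hf; rewrite [leLHS]/Num.norm /= mx_normrE; apply/bigmax_leP; split.
    exact: modmx_ge0.
  move=> [i j] _ /=; rewrite mxE -lecR -modmxE.
  exact: le_trans (hf _) (entry_le_norm _ _ _).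
rewrite prod_normE ge_max /= !H// => -[a b]; rewrite normc_def lecR /=;
  by rewrite -sqrtr_sqr ler_sqrt ?addr_ge0 ?sqr_ge0// ?lerDl ?lerDr sqr_ge0.
Qed.

Lemma modmx_le_norm X : modmx (mx_of_reim X) <= 2 * `|X|.
Proof.
rewrite -lecR -modmxE; apply: mx_norm_le => [|i j].
  by rewrite lecR mulr_ge0.
rewrite mxE normc_def lecR /=.
have ha : `|X.1 i j| <= `|X|.
  apply: le_trans (pair_norm_fst X); rewrite [leRHS]/Num.norm /= mx_normrE.
  exact: (le_bigmax _ (fun ij => `|X.1 ij.1 ij.2|) (i, j)).
have hb : `|X.2 i j| <= `|X|.
  apply: le_trans (pair_norm_snd X); rewrite [leRHS]/Num.norm /= mx_normrE.
  exact: (le_bigmax _ (fun ij => `|X.2 ij.1 ij.2|) (i, j)).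
rewrite -[leRHS]ger0_norm ?mulr_ge0// -sqrtr_sqr ler_sqrt ?sqr_ge0//.
rewrite -[X.1 i j ^+ 2]real_normK ?num_real// -[X.2 i j ^+ 2]real_normK ?num_real//.
have h0 : 0 <= `|X| by []. have a0 : 0 <= `|X.1 i j| by [].
have b0 : 0 <= `|X.2 i j| by [].
nra.
Qed.

Lemma modmxD S T : modmx (S + T) <= modmx S + modmx T.
Proof. by rewrite -lecR rmorphD /= -!modmxE ler_normD. Qed.

Lemma modmxM S T : modmx (S *m T) <= r%:R * modmx S * modmx T.
Proof.
rewrite -lecR !rmorphM /= rmorph_nat -!modmxE; exact: norm_mulmx.
Qed.

Lemma bounded_map_real (A : MC -> MC) (K : R[i]) :
  (forall T, `|A T| <= K * `|T|) -> 0 <= K ->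
  bounded_map (fun X : MR => reim_mx (A (mx_of_reim X))).
Proof.
move=> hA K0; exists (complex.Re K * 2) => X.
have KE : K = (complex.Re K)%:C%C by rewrite RRe_real// ger0_real.
apply: (le_trans (norm_reim_le _)).
apply: (@le_trans _ _ (complex.Re K * modmx (mx_of_reim X))).
  by rewrite -lecR rmorphM /= -!modmxE -KE.
by rewrite -mulrA ler_wpM2l ?modmx_le_norm// -lecR -KE.
Qed.

Definition mulV X Y : MR := reim_mx (mx_of_reim X *m mx_of_reim Y).

Lemma mulV_bilinear : bilinear_map mulV.
Proof.
split.
- move=> Y t X X' /=; rewrite /mulV mx_of_reimE mulmxDl -scalemxAl.
  by rewrite reim_mxD reim_mxZ.
- move=> Y t X X' /=; rewrite /mulV mx_of_reimE mulmxDr -scalemxAr.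
  by rewrite reim_mxD reim_mxZ.
- exists (r%:R * 2 * 2) => X Y; apply: (le_trans (norm_reim_le _)).
  apply: (le_trans (modmxM _ _)).
  have -> : r%:R * 2 * 2 * `|X| * `|Y| = r%:R * ((2 * `|X|) * (2 * `|Y|)) by ring.
  by rewrite -mulrA ler_wpM2l// ler_pM ?modmx_ge0 ?modmx_le_norm.
Qed.

(** The left kernel [Z] of [T] satisfies [Z = Z (S - T) S^-1], so its norm is at most a factor below
    1 times itself. *)
Lemma unitmx_perturb S T : S \in unitmx ->
  r%:R * r%:R * `|S - T| * `|invmx S| < 1 -> T \in unitmx.
Proof.
move=> uS h; rewrite -row_free_unit -kermx_eq0; set Z := kermx T.
have ZE : Z = Z *m (S - T) *m invmx S.
  by rewrite mulmxBr mulmx_ker subr0 mulmxK.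
apply/negPn/negP => Z0; have nZ : 0 < `|Z| by rewrite normr_gt0.
have : `|Z| <= r%:R * r%:R * `|S - T| * `|invmx S| * `|Z|.
  rewrite {1}ZE; apply: (le_trans (norm_mulmx _ _)).
  have -> : r%:R * r%:R * `|S - T| * `|invmx S| * `|Z| =
    r%:R * (r%:R * `|Z| * `|S - T|) * `|invmx S| by ring.
  by rewrite ler_wpM2r// ler_wpM2l// norm_mulmx.
by rewrite -[leLHS]mul1r ler_pM2r// => /le_lt_trans /(_ h); rewrite ltxx.
Qed.

End RealForm.

(** * Smoothness of the matrix constructions *)

Section SmoothMatrix.
Variables (R : realType) (r : nat).
Local Notation MC := 'M[R[i]]_r.
Local Notation MR := ('M[R]_r * 'M[R]_r)%type.

Definition smoothmx k (V : normedModType R) (F : V -> MC) (x : V) :=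
  smooth_at k (fun y => reim_mx (F y)) x.

Section Rules.
Variables (k : nat) (V : normedModType R).
Implicit Types (F G H : V -> MC) (x : V).

Lemma smoothmx_ext F G x : (\forall y \near x, F y = G y) ->
  smoothmx k F x -> smoothmx k G x.
Proof. by move=> FG; apply: smooth_at_ext; apply: filterS FG => y ->. Qed.

Lemma smoothmx_cst (A : MC) x : smoothmx k (fun=> A) x.
Proof. exact: smooth_at_cst. Qed.

Lemma smoothmx_of (f : V -> MR) x : smooth_at k f x ->
  smoothmx k (fun y => mx_of_reim (f y)) x.
Proof.
by apply: smooth_at_ext; near=> y; rewrite mx_of_reimK.
Unshelve. all: by end_near. Qed.

Lemma smoothmxM F G x : smoothmx k F x -> smoothmx k G x ->
  smoothmx k (fun y => F y *m G y) x.
Proof.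
move=> SF SG; have := smooth_at_bil (@mulV_bilinear R r) SF SG.
by apply: smooth_at_ext; near=> y; rewrite /mulV !reim_mxK.
Unshelve. all: by end_near. Qed.

Lemma smoothmxD F G x : smoothmx k F x -> smoothmx k G x ->
  smoothmx k (fun y => F y + G y) x.
Proof.
move=> SF SG; have := smooth_atD SF SG.
by apply: smooth_at_ext; near=> y; rewrite reim_mxD.
Unshelve. all: by end_near. Qed.

Lemma smoothmxB F G x : smoothmx k F x -> smoothmx k G x ->
  smoothmx k (fun y => F y - G y) x.
Proof.
move=> SF SG; have := smooth_atB SF SG.
by apply: smooth_at_ext; near=> y; rewrite reim_mxB.
Unshelve. all: by end_near. Qed.

Lemma smoothmx_sum I (s : seq I) (F : I -> V -> MC) x :
  (forall i, smoothmx k (F i) x) ->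
  smoothmx k (fun y => \sum_(i <- s) F i y) x.
Proof.
move=> SF; elim: s => [|i s IH].
  by apply: smoothmx_ext (smoothmx_cst 0 x); near=> y; rewrite big_nil.
by apply: smoothmx_ext (smoothmxD (SF i) IH); near=> y; rewrite big_cons.
Unshelve. all: by end_near. Qed.

(** Additivity and homogeneity are asked over real scalars only, which admits the adjoint. *)
Lemma smoothmx_lin (A : MC -> MC) (K : R[i]) F x :
  (forall t S T, A (t%:C%C *: S + T) = t%:C%C *: A S + A T) ->
  0 <= K -> (forall T, `|A T| <= K * `|T|) ->
  smoothmx k F x -> smoothmx k (fun y => A (F y)) x.
Proof.
move=> lA K0 hA SF.
have lA' : linear (fun X : MR => reim_mx (A (mx_of_reim X))).
  by move=> t X Y; rewrite mx_of_reimE lA reim_mxD reim_mxZ.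
have := smooth_at_lin lA' (bounded_map_real hA K0) SF.
by apply: smooth_at_ext; near=> y; rewrite reim_mxK.
Unshelve. all: by end_near. Qed.

Lemma smoothmxZ (a : R[i]) F x : smoothmx k F x ->
  smoothmx k (fun y => a *: F y) x.
Proof.
apply: (@smoothmx_lin ( *:%R a) `|a|) => //.
- by move=> t S T; rewrite scalerDr !scalerA mulrC.
- by move=> T; rewrite normrZ.
Qed.

Lemma smoothmx_adj F x : smoothmx k F x -> smoothmx k (fun y => (F y) ^t*) x.
Proof.
apply: (@smoothmx_lin (fun T => T ^t*) 1) => //.
- move=> t S T; rewrite adjmxD; congr (_ + _).
  by apply/matrixP => i j; rewrite !mxE rmorphM; congr (_ * _); apply: conjc_real.
- by move=> T; rewrite mul1r norm_adjmx.
Qed.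

Lemma smoothmx_trace (A : MC) F x : smoothmx k F x ->
  smoothmx k (fun y => \tr (F y) *: A) x.
Proof.
apply: (@smoothmx_lin (fun T => \tr T *: A) (r%:R * `|A|)) => //.
- by move=> t S T; rewrite linearD linearZ /= scalerDl scalerA.
- move=> T; rewrite normrZ mulrAC ler_wpM2r//; exact: norm_mxtrace.
Qed.

Lemma smoothmx_near_unit F x : smoothmx k F x -> F x \in unitmx ->
  \forall y \near x, F y \in unitmx.
Proof.
move=> /smooth_at_continuous /cvgrPdist_lt cF uF.
(* Makes the quantity in [unitmx_perturb] at most [(K - 1) / K] when [F y] is within [K^-1] of [F x]
   in real form. *)
pose K := r%:R * r%:R * 2 * modmx (invmx (F x)) + 1.
have K0 : 0 < K by rewrite ltr_wpDl// !mulr_ge0 ?modmx_ge0.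
have K1 : 0 < K^-1 by rewrite invr_gt0.
have := cF _ K1; apply: filterS => y hy; apply: unitmx_perturb uF _.
have h1 : modmx (F x - F y) <= 2 * `|reim_mx (F x) - reim_mx (F y)|.
  by have := modmx_le_norm (reim_mx (F x - F y)); rewrite reim_mxK reim_mxB.
have -> : r%:R * r%:R * `|F x - F y| * `|invmx (F x)| =
    (r%:R * r%:R * modmx (F x - F y) * modmx (invmx (F x)))%:C%C.
  by rewrite !rmorphM /= rmorph_nat -!modmxE.
rewrite -[ltRHS]/(1%:C%C) ltcR.
apply: (@le_lt_trans _ _ (r%:R * r%:R * 2 * modmx (invmx (F x)) * K^-1)).
  have -> : r%:R * r%:R * 2 * modmx (invmx (F x)) * K^-1 =
    r%:R * r%:R * (2 * K^-1) * modmx (invmx (F x)) by ring.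
  rewrite ler_wpM2r ?modmx_ge0// ler_wpM2l ?mulr_ge0//.
  by apply: (le_trans h1); rewrite ler_pM2l// ltW.
by rewrite ltr_pdivrMr// mul1r /K ltrDl.
Qed.

Lemma smoothmxV F x : smoothmx k F x -> F x \in unitmx ->
  smoothmx k (fun y => invmx (F y)) x.
Proof.
move=> SF uF; have nF := smoothmx_near_unit SF uF.
pose L (q : V * MR) := reim_mx (invmx (F q.1) *m mx_of_reim q.2).
have iL : \forall y \near x, inverse_at (@mulV R r) (fun y => reim_mx (F y)) L y.
  apply: filterS nF => y uFy; split.
  - by move=> z; rewrite /L /mulV /= !reim_mxK mulKmx// mx_of_reimK.
  - by move=> z; rewrite /L /mulV /= !reim_mxK mulKVmx// mx_of_reimK.
  - apply: (@bounded_map_real _ _ (mulmx (invmx (F y))) (r%:R * `|invmx (F y)|)).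
      by move=> T; exact: norm_mulmx.
    by rewrite mulr_ge0.
have := @smooth_at_inverse _ k _ _ _ _ _ L x (reim_mx 1%:M) (@mulV_bilinear R r) SF iL.
move=> SL.
have : smooth_at k (fun y => L (y, reim_mx 1%:M)) x.
  apply: (@smooth_at_comp _ _ _ _ _ (fun y => (y, reim_mx 1%:M)) L) => //.
  by apply: smooth_at_pair; [exact: smooth_at_id|exact: smooth_at_cst].
by apply: smooth_at_ext; near=> y; rewrite /L /= reim_mxK mulmx1.
Unshelve. all: by end_near. Qed.

(** Serves twice: for fixed [u] it is the Sylvester operator of [u], and it is the polarization of
    squaring, whose inverse [smooth_at_sqrt] asks for. *)
Let sylB (u v : MR) : MR := mulV u v + mulV v u.

Let sylB_bilinear : bilinear_map sylB.
Proof.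
have [lBl lBr [CB hCB]] := @mulV_bilinear R r; split.
- by move=> v t u w; rewrite /sylB lBl lBr scalerDr addrACA.
- by move=> v t u w; rewrite /sylB lBl lBr scalerDr addrACA.
- exists (CB + CB) => u v; apply: (le_trans (ler_normD _ _)).
  rewrite !mulrDl lerD//; apply: (le_trans (hCB _ _)).
  by rewrite -!mulrA [`|u| * _]mulrC.
Qed.

Let sylL (S : V -> MC) (q : V * MR) : MR :=
  reim_mx (sylvester (S q.1) (mx_of_reim q.2)).

Let sylL_inverse (S : V -> MC) y : psdmx (S y) -> S y \in unitmx ->
  inverse_at sylB (fun z => reim_mx (S z)) (sylL S) y.
Proof.
move=> pS uS; split.
- move=> z; rewrite /sylL /sylB /mulV /= reim_mxK -reim_mxD reim_mxK.
  by rewrite sylvesterK// mx_of_reimK.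
- move=> z; rewrite /sylL /sylB /mulV /= !reim_mxK -reim_mxD.
  by rewrite sylvesterVK// mx_of_reimK.
- have [K K0 hK] := sylvester_bound pS uS.
  apply: (@bounded_map_real _ _ (sylvester (S y)) K); last exact: ltW.
  by move=> T; rewrite -[in leRHS](sylvesterVK T pS uS); exact: hK.
Qed.

Lemma smoothmx_sylvester (S H : V -> MC) x : smoothmx k S x -> smoothmx k H x ->
  (\forall y \near x, psdmx (S y) /\ S y \in unitmx) ->
  smoothmx k (fun y => sylvester (S y) (H y)) x.
Proof.
move=> SS SH nS.
have iL : \forall y \near x, inverse_at sylB (fun y => reim_mx (S y)) (sylL S) y.
  by apply: filterS nS => y [pS uS]; exact: sylL_inverse.
have SL := @smooth_at_inverse _ k _ _ _ _ _ (sylL S) x (reim_mx (H x))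
  sylB_bilinear SS iL.
have : smooth_at k (fun y => sylL S (y, reim_mx (H y))) x.
  apply: (@smooth_at_comp _ _ _ _ _ (fun y => (y, reim_mx (H y))) (sylL S)) => //.
  by apply: smooth_at_pair; [exact: smooth_at_id|].
by apply: smooth_at_ext; near=> y; rewrite /sylL /= reim_mxK.
Unshelve. all: by end_near. Qed.

Let sqrt_continuous (S G : V -> MC) x :
  {for x, continuous (fun z => reim_mx (G z))} ->
  (\forall y \near x, [/\ psdmx (S y), S y \in unitmx & S y *m S y = G y]) ->
  {for x, continuous (fun z => reim_mx (S z))}.
Proof.
move=> cG nS; have [pS uS SE] := nbhs_singleton nS.
have [K K0 hK] := psdmx_sqr_lipschitz pS uS.
have KE : K = (complex.Re K)%:C%C by rewrite RRe_real// gtr0_real.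
have KR : 0 < complex.Re K by rewrite -ltcR -KE.
apply/cvgrPdist_le => e e0.
have e'0 : 0 < e / (complex.Re K * 2) by rewrite divr_gt0// mulr_gt0.
have /cvgrPdist_le /(_ _ e'0) cG' := cG.
near=> z.
have hG : `|reim_mx (G x) - reim_mx (G z)| <= e / (complex.Re K * 2) by near: z.
have [pz uz zE] : [/\ psdmx (S z), S z \in unitmx & S z *m S z = G z] by near: z.
rewrite distrC -reim_mxB; apply: (le_trans (norm_reim_le _)).
apply: (@le_trans _ _ (complex.Re K * modmx (G z - G x))).
  by rewrite -lecR rmorphM /= -!modmxE -KE -zE -SE; exact: hK.
have h1 : modmx (G z - G x) <= 2 * `|reim_mx (G z) - reim_mx (G x)|.
  by have := modmx_le_norm (reim_mx (G z - G x)); rewrite reim_mxK reim_mxB.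
rewrite mulrC -ler_pdivlMr//; apply: (le_trans h1); rewrite mulrC -ler_pdivlMr//.
by rewrite distrC -mulrA -invfM.
Unshelve. all: by end_near. Qed.

Lemma smoothmx_sqrt (S G : V -> MC) x : smoothmx k G x ->
  (\forall y \near x, [/\ psdmx (S y), S y \in unitmx & S y *m S y = G y]) ->
  smoothmx k S x.
Proof.
move=> SG nS.
(* For [k = 0] the map [G] is known to be continuous only at [x], whereas [smooth_at_sqrt] asks for
   continuity of the root at all nearby points. *)
have [k0|k0] := posnP k.
  by move: SG; rewrite /smoothmx k0 => SG; exact: sqrt_continuous SG nS.
apply: (@smooth_at_sqrt _ _ _ _ (@mulV R r) _ _ (sylL S) x (@mulV_bilinear R r) SG).
- have nG : \forall y \near x, {for y, continuous (fun z => reim_mx (G z))}.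
    move: SG; rewrite /smoothmx -(prednK k0) => /smooth_at_near1.
    by apply: filterS => y; exact: differentiable_continuous.
  have nS' := near_join nS; near=> y.
  by apply: sqrt_continuous; near: y; [exact: nG|exact: nS'].
- by apply: filterS nS => y [_ _ E]; rewrite /mulV !reim_mxK E.
- by apply: filterS nS => y [pS uS _]; exact: sylL_inverse.
Unshelve. all: by end_near. Qed.

Lemma smoothmx_abs F x : smoothmx k F x -> F x \in unitmx ->
  smoothmx k (fun y => absmx (F y)) x.
Proof.
move=> SF uF.
apply: (@smoothmx_sqrt _ (fun y => (F y) ^t* *m F y)).
  by apply: smoothmxM => //; exact: smoothmx_adj.
apply: filterS (smoothmx_near_unit SF uF) => y uy; split.
- exact: absmx_psd.
- exact: absmx_unit.
- exact: absmx_sqr.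
Qed.

Lemma smoothmx_habs F x : smoothmx k F x -> F x \in unitmx ->
  smoothmx k (fun y => habsmx (F y)) x.
Proof.
move=> SF uF; apply: (@smoothmx_sqrt _ (fun y => absmx (F y))).
  exact: smoothmx_abs.
apply: filterS (smoothmx_near_unit SF uF) => y uy; split.
- exact: habsmx_psd.
- exact: habsmx_unit.
- exact: habsmx_sqr.
Qed.

Lemma smoothmx_phase F x : smoothmx k F x -> F x \in unitmx ->
  smoothmx k (fun y => phasemx (F y)) x.
Proof.
move=> SF uF; apply: smoothmxM => //; apply: smoothmxV.
  exact: smoothmx_abs.
exact: absmx_unit.
Qed.

Lemma smoothmx_aluthge F x : smoothmx k F x -> F x \in unitmx ->
  smoothmx k (fun y => aluthge (F y)) x.
Proof.
move=> SF uF.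
apply: (@smoothmx_ext (fun y => habsmx (F y) *m phasemx (F y) *m habsmx (F y))).
  by apply: filterS (smoothmx_near_unit SF uF) => y uy; rewrite aluthgeE.
have Sh := smoothmx_habs SF uF.
by apply: smoothmxM => //; apply: smoothmxM => //; exact: smoothmx_phase.
Qed.

Lemma smoothmx_defect F x : smoothmx k F x ->
  smoothmx k (fun y => defect (F y)) x.
Proof.
by move=> SF; apply: smoothmxB; apply: smoothmxM => //; exact: smoothmx_adj.
Qed.

Lemma smoothmx_lagrange (d : 'rV[R[i]]_r) i F x : smoothmx k F x ->
  smoothmx k (fun y => lagrange d i (F y)) x.
Proof.
move=> SF; rewrite /lagrange; elim: [seq _ <- _ | _] => [|j s IH] /=.
  exact: smoothmx_cst.
apply: smoothmxZ; apply: smoothmxM => //; apply: smoothmxB => //.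
exact: smoothmx_cst.
Qed.

Lemma smoothmx_strip_phase (d : 'rV[R[i]]_r) F G x : smoothmx k F x ->
  F x \in unitmx -> smoothmx k G x ->
  smoothmx k (fun y => strip_phase d (F y) (G y)) x.
Proof.
move=> SF uF SG; apply: smoothmx_sylvester.
- exact: smoothmx_abs.
- apply: smoothmxM; last exact: smoothmx_phase.
  apply: smoothmxB => //; apply: smoothmx_sum => i; apply: smoothmx_trace.
  by apply: smoothmxM => //; exact: smoothmx_lagrange.
- apply: filterS (smoothmx_near_unit SF uF) => y uy; split.
    exact: absmx_psd.
  exact: absmx_unit.
Qed.

Lemma smoothmx_aluthge_shift (d : 'rV[R[i]]_r) F G x : smoothmx k F x ->
  F x \in unitmx -> smoothmx k G x ->
  smoothmx k (fun y => aluthge_shift d (F y) (G y)) x.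
Proof.
move=> SF uF SG; apply: smoothmxM; last exact: smoothmx_habs.
apply: smoothmx_sylvester.
- exact: smoothmx_habs.
- exact: smoothmx_strip_phase.
- apply: filterS (smoothmx_near_unit SF uF) => y uy; split.
    exact: habsmx_psd.
  exact: habsmx_unit.
Qed.

Lemma smoothmx_defect_map (d : 'rV[R[i]]_r) F G x : smoothmx k F x ->
  F x \in unitmx -> smoothmx k G x ->
  smoothmx k (fun y => defect_map d (F y) (G y)) x.
Proof.
move=> SF uF SG.
have SU : smoothmx k (fun y => invmx (phasemx (F y))) x.
  by apply: smoothmxV; [exact: smoothmx_phase|exact: phasemx_unit].
have Sq := smoothmx_strip_phase d SF uF SG.
have Sh := smoothmx_habs SF uF.
by apply: smoothmxM => //; apply: smoothmxM => //; apply: smoothmxD; apply: smoothmxM.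
Qed.

End Rules.
End SmoothMatrix.

(** * The Aluthge transform near a diagonal matrix as an attracting system *)

Section DiagonalAttracting.
Variables (R : realType) (r : nat).
Local Notation MC := 'M[R[i]]_r.
Local Notation MR := ('M[R]_r * 'M[R]_r)%type.

Definition aluthgeV (X : MR) : MR := reim_mx (aluthge (mx_of_reim X)).

Lemma iter_aluthgeV n X :
  iter n aluthgeV X = reim_mx (iter n (@aluthge R[i] r) (mx_of_reim X)).
Proof.
elim: n => [|n IH]; first by rewrite /= mx_of_reimK.
by rewrite iterS IH /aluthgeV reim_mxK.
Qed.

Lemma sylvester_linear (C : numClosedFieldType) (A : 'M[C]_r) :
  linear (sylvester A).
Proof.
by move=> t S T; rewrite /sylvester linearP mulmxDl linearD -scalemxAl linearZ.
Qed.

Section Linear.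
Variables (C : numClosedFieldType) (d : 'rV[C]_r) (T : 'M[C]_r).

Lemma strip_linear : linear (strip d T).
Proof.
move=> t w w'; rewrite /strip scalerBr addrACA -opprD; congr (_ - _).
rewrite scaler_sumr -big_split /=; apply: eq_bigr => i _.
by rewrite mulmxDl -scalemxAl linearD linearZ /= scalerDl scalerA.
Qed.

Lemma strip_phase_linear : linear (strip_phase d T).
Proof.
move=> t w w'; rewrite /strip_phase strip_linear mulmxDl -scalemxAl.
exact: sylvester_linear.
Qed.

Lemma aluthge_shift_linear : linear (aluthge_shift d T).
Proof.
move=> t w w'; rewrite /aluthge_shift strip_phase_linear sylvester_linear.
by rewrite mulmxDl -scalemxAl.
Qed.

Lemma defect_map_linear : linear (defect_map d T).
Proof.
move=> t w w'; rewrite /defect_map strip_phase_linear.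
move: (habsmx T) (invmx _) (strip_phase d T w) (strip_phase d T w') => h V s s'.
have -> : V *m (t *: s + s') + (t *: s + s') *m V =
    t *: (V *m s + s *m V) + (V *m s' + s' *m V).
  by rewrite mulmxDr mulmxDl -scalemxAr -scalemxAl addrACA -scalerDr.
by rewrite mulmxDr mulmxDl -scalemxAr -scalemxAl.
Qed.
End Linear.

Variable d : 'rV[R[i]]_r.
Hypothesis d0 : forall j, d 0 j != 0.
Hypothesis dinj : injective (d 0).

Let p : MR := reim_mx (diag_mx d).
Let aV (q : MR * MR) : MR :=
  reim_mx (aluthge_shift d (mx_of_reim q.1) (mx_of_reim q.2)).
Let bV (q : MR * MR) : MR :=
  reim_mx (defect_map d (mx_of_reim q.1) (mx_of_reim q.2)).
Let yV (X : MR) : MR := reim_mx (defect (mx_of_reim X)).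

Lemma smoothmx_mx_of_reim k (X : MR) : smoothmx k (@mx_of_reim R r) X.
Proof. apply: smoothmx_of; exact: smooth_at_id. Qed.

Lemma near_unit_mx (X : MR) : mx_of_reim X \in unitmx ->
  \forall Y \near X, mx_of_reim Y \in unitmx.
Proof. exact: (smoothmx_near_unit (smoothmx_mx_of_reim 0 X)). Qed.

(** All identities hold on the open set of invertible matrices. The auxiliary norm is the maximal
    complex modulus, for which the multipliers contract; it is equivalent to the norm of the pair of
    real matrices, but differs from it. *)
Lemma attracting_diag : exists rho : R,
  attracting aluthgeV yV aV bV p (fun w => modmx (mx_of_reim w)) rho.
Proof.
have ud : mx_of_reim p \in unitmx by rewrite reim_mxK diag_mx_unit.
have np := near_unit_mx ud.
have [rho /andP[rho0 rho1] hrho] := defect_map_diag_contr d0 dinj.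
have rhoE : rho = (complex.Re rho)%:C%C by rewrite RRe_real// ger0_real.
have S1 k (q : MR * MR) : smoothmx k (fun q : MR * MR => mx_of_reim q.1) q.
  by apply: smoothmx_of; exact: smooth_at_fst.
have S2 k (q : MR * MR) : smoothmx k (fun q : MR * MR => mx_of_reim q.2) q.
  by apply: smoothmx_of; exact: smooth_at_snd.
exists (complex.Re rho); split.
- move=> k; apply: filterS np => X uX; apply: smoothmx_aluthge => //.
  exact: smoothmx_mx_of_reim.
- move=> k; apply: filterS np => X uX; apply: smoothmx_defect => //.
  exact: smoothmx_mx_of_reim.
- move=> k; apply: filterS np => X uX w.
  exact: (smoothmx_aluthge_shift d (S1 k (X, w)) uX (S2 k (X, w))).
- move=> k; apply: filterS np => X uX w.
  exact: (smoothmx_defect_map d (S1 k (X, w)) uX (S2 k (X, w))).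
- apply: filterS np => X uX; rewrite /aV /yV /aluthgeV /= reim_mxK.
  by rewrite {1}(aluthge_shiftE d uX) reim_mxD mx_of_reimK.
- apply: filterS np => X uX; rewrite /bV /yV /aluthgeV /= !reim_mxK.
  by rewrite (defect_mapE d uX).
- near=> X => t u v; rewrite /aV /= mx_of_reimE aluthge_shift_linear.
  by rewrite reim_mxD reim_mxZ.
- near=> X => t u v; rewrite /bV /= mx_of_reimE defect_map_linear.
  by rewrite reim_mxD reim_mxZ.
- rewrite /yV /p reim_mxK (_ : defect _ = 0 - 0) ?reim_mxB ?subrr//.
  rewrite /defect tr_diag_mx map_diag_mx !mulmx_diag.
  by apply/matrixP => i j; rewrite !mxE mulrC !subrr.
- by move=> w; rewrite -{1}[w]mx_of_reimK norm_reim_le.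
- by exists 2 => w; exact: modmx_le_norm.
- move=> u v; have := mx_of_reimE 1 u v; rewrite !scale1r => ->.
  exact: modmxD.
- by rewrite -ltcR -rhoE rho1 andbT -ler0c -rhoE.
- move=> w; rewrite /bV /p /= !reim_mxK -lecR rmorphM /= -!modmxE -rhoE.
  exact: hrho.
Unshelve. all: by end_near. Qed.

Lemma geom_complete_MR : geom_complete MR.
Proof.
have cM : geom_complete 'M[R]_r.
  by apply: geom_complete_cauchy => F FF; exact: (@cauchy_cvg 'M[R]_r F FF).
exact: geom_complete_pair.
Qed.

Definition limV (X : MR) : MR :=
  @lim (MR : normedModType R) (iter n aluthgeV X @[n --> \oo]).

Lemma limV_near : exists (e K s : R), [/\ 0 < e, 0 <= s < 1 &
  forall X, `|p - X| < e ->
    forall n, `|limV X - iter n aluthgeV X| <= K * s ^+ n].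
Proof.
have [rho H] := attracting_diag.
have [e [K [s [e0 K0 s01 he]]]] := attract_orbit H ltr01.
suff /(attract_limit H) : \forall X \near p,
  iter n aluthgeV X @[n --> \oo] --> limV X by [].
apply/nearP_norm; exists e => // X pX.
have [l hl] : exists l : MR, iter n aluthgeV X @[n --> \oo] --> l.
  apply: (geom_complete_MR s01) => n m; have [_] := he X pX n; exact.
by rewrite /limV (cvg_lim (@norm_hausdorff _ _) hl).
Qed.

Lemma limV_smooth k : \forall X \near p, smooth_at k limV X.
Proof.
have [rho H] := attracting_diag.
suff h : \forall X \near p, iter n aluthgeV X @[n --> \oo] --> limV X.
  exact: (attract_smooth k geom_complete_MR H h).
have [e [K [s [e0 s01 he]]]] := limV_near.
apply/nearP_norm; exists e => // X pX; apply/cvgrPdist_le => eps eps0.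
near=> n; apply: (le_trans (he _ pX n)); near: n; exact: geom_small.
Unshelve. all: by end_near. Qed.

End DiagonalAttracting.

(** * Global behaviour of orbits *)

Section OrbitCluster.
Variables (R : realType) (r : nat).
Local Notation MC := 'M[R[i]]_r.
Local Notation MR := ('M[R]_r * 'M[R]_r)%type.

(** A product of segments is compact in row vectors, and reshaping carries it to matrices. *)
Lemma compact_box (B : R) : exists2 A : set MR, compact A &
  forall X : MR, `|X| <= B -> A X.
Proof.
pose box := [set v : 'rV[R]_(r * r) | forall i, v ord0 i \in `[(- B), B]].
have cbox : compact box.
  apply: (@rV_compact _ _ (fun=> `[(- B), B]%classic)).
  by move=> _; apply: segment_compact.
have cvec : continuous (@vec_mx R r r).
  apply: bounded_map_continuous; first exact: linearP.
  exists 1 => v; rewrite mul1r [leLHS]/Num.norm /= mx_normrE.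
  apply/bigmax_leP; split=> // -[i j] _ /=; rewrite mxE.
  rewrite [leRHS]/Num.norm /= mx_normrE.
  exact: (le_bigmax _ (fun ij => `|v ij.1 ij.2|) (0, mxvec_index i j)).
have cA : compact (@vec_mx R r r @` box).
  by apply: continuous_compact cbox; exact: continuous_subspaceT.
exists ((@vec_mx R r r @` box) `*` (@vec_mx R r r @` box)).
  exact: compact_setX.
have H (M : 'M[R]_r) : `|M| <= B -> (@vec_mx R r r @` box) M.
  move=> MB; exists (mxvec M); last exact: mxvecK.
  move=> k; case/mxvec_indexP: k => i j; rewrite mxvecE in_itv /= -ler_norml.
  apply: le_trans MB; rewrite [leRHS]/Num.norm /= mx_normrE.
  exact: (le_bigmax _ (fun ij => `|M ij.1 ij.2|) (i, j)).
move=> X XB; split; apply: H; apply: le_trans XB.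
  exact: pair_norm_fst.
exact: pair_norm_snd.
Qed.

Variable T : MC.
Hypothesis uT : T \in unitmx.
Let Tn n := iter n (@aluthge R[i] r) T.
Let uTn n : Tn n \in unitmx. Proof. exact: iter_aluthge_unit. Qed.
(** The squared Frobenius norm of the iterates, a Lyapunov function of the orbit. *)
Let fr n := complex.Re (\tr ((Tn n) ^t* *m Tn n)).

Let frE n : \tr ((Tn n) ^t* *m Tn n) = (fr n)%:C%C.
Proof.
rewrite /fr RRe_real// ger0_real//; apply: le_trans (sqr_norm_gram _).
by rewrite exprn_ge0.
Qed.

Let sqr_modmx_gram (S : MC) (a : R) : \tr (S ^t* *m S) = a%:C%C -> modmx S ^+ 2 <= a.
Proof.
by move=> E; rewrite -lecR -E rmorphXn /= -modmxE; exact: sqr_norm_gram.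
Qed.

Let fr_phase n : modmx (phase_comm (Tn n)) ^+ 2 <= 2 * (fr n - fr n.+1).
Proof.
apply: sqr_modmx_gram; rewrite (phase_comm_gram (uTn n)) frE.
by rewrite -[aluthge _]/(Tn n.+1) frE rmorphM rmorphB rmorph_nat.
Qed.

Let fr_ge0 n : 0 <= fr n.
Proof. by rewrite -ler0c -frE; apply: le_trans (sqr_norm_gram _); rewrite exprn_ge0. Qed.

Let fr_noninc n : fr n.+1 <= fr n.
Proof.
have := le_trans (sqr_ge0 _) (fr_phase n).
by rewrite pmulr_rge0// subr_ge0.
Qed.

Let fr_le n : fr n <= fr 0.
Proof. by elim: n => // n; apply: le_trans; exact: fr_noninc. Qed.

Let le_of_sqr (x a : R) : 0 <= a -> x ^+ 2 <= a -> x <= a + 1.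
Proof. by move=> a0 xa; nra. Qed.

Let modmx_Tn n : modmx (Tn n) <= fr 0 + 1.
Proof.
apply: le_of_sqr => //; apply: le_trans (fr_le n).
by apply: sqr_modmx_gram; rewrite frE.
Qed.

Let modmx_abs n : modmx (absmx (Tn n)) <= fr 0 + 1.
Proof.
apply: le_of_sqr => //; apply: le_trans (fr_le n).
apply: sqr_modmx_gram; rewrite (psdmx_adj (absmx_psd _)) absmx_sqr; exact: frE.
Qed.

Let modmx_phase n : modmx ((phasemx (Tn n)) ^t*) <= r%:R + 1.
Proof.
apply: le_of_sqr => //; apply: sqr_modmx_gram.
rewrite trmxCK; have [_ ->] := phasemx_adjK (uTn n).
by rewrite mxtrace1 rmorph_nat.
Qed.

Lemma fr_small (e : R) : 0 < e -> \forall n \near \oo, fr n - fr n.+1 <= e.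
Proof.
move=> e0.
have [l hl] : exists l : R, fr n @[n --> \oo] --> l.
  suff : cvgn fr by move=> h; exists (lim (fr @ \oo)).
  apply: nonincreasing_is_cvgn.
    by apply/nonincreasing_seqP => n; exact: fr_noninc.
  by exists 0 => _ [n _ <-]; exact: fr_ge0.
have hl' : fr n.+1 @[n --> \oo] --> l by rewrite (cvg_shiftS fr).
have h0 : (fr n - fr n.+1) @[n --> \oo] --> (0 : R).
  by rewrite -(subrr l); exact: cvgB hl hl'.
have /cvgrPdist_le /(_ e e0) := h0.
by apply: filterS => n; rewrite sub0r normrN; apply: le_trans; exact: ler_norm.
Qed.

(** The self-commutator is (P q + q P) times the adjoint of U. Here P and U stay bounded along the
    orbit, and q tends to 0 because its square is controlled by the decrements of [fr]. *)
Lemma defect_small (e : R) : 0 < e ->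
  \forall n \near \oo, modmx (defect (Tn n)) <= e.
Proof.
move=> e0; pose K := r%:R * (2 * r%:R * (fr 0 + 1)) * (r%:R + 1) + 1.
have B0 : 0 < fr 0 + 1 by rewrite ltr_wpDl.
have K0 : 0 < K by rewrite ltr_wpDl// !mulr_ge0// ltW// ltr_wpDl.
have e'0 : 0 < (e / K) ^+ 2 / 2 by rewrite divr_gt0// exprn_gt0// divr_gt0.
near=> n.
have h1 : fr n - fr n.+1 <= (e / K) ^+ 2 / 2 by near: n; exact: fr_small.
have hq : modmx (phase_comm (Tn n)) <= e / K.
  have : modmx (phase_comm (Tn n)) ^+ 2 <= (e / K) ^+ 2.
    by apply: (le_trans (fr_phase n)); rewrite mulrC -ler_pdivlMr.
  rewrite ler_pXn2r// nnegrE; first exact: modmx_ge0.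
  by rewrite divr_ge0// ltW.
have -> : defect (Tn n) = (absmx (Tn n) *m phase_comm (Tn n) +
    phase_comm (Tn n) *m absmx (Tn n)) *m (phasemx (Tn n)) ^t*.
  have [_ E] := phasemx_adjK (uTn n).
  by rewrite (defectE (uTn n)) -mulmxA E mulmx1.
move: hq (modmx_abs n) (modmx_phase n).
move: (absmx _) (phase_comm _) (_ ^t*) => P q V hq hP hV.
have q0 := modmx_ge0 q; have P0 := modmx_ge0 P; have V0 := modmx_ge0 V.
apply: (le_trans (modmxM _ _)).
have h2 : modmx (P *m q + q *m P) <= 2 * r%:R * (fr 0 + 1) * modmx q.
  apply: (le_trans (modmxD _ _)).
  have -> : 2 * r%:R * (fr 0 + 1) * modmx q =
    r%:R * (fr 0 + 1) * modmx q + r%:R * modmx q * (fr 0 + 1) by ring.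
  rewrite lerD//; apply: (le_trans (modmxM _ _)).
    by rewrite ler_wpM2r// ler_wpM2l.
  by rewrite ler_wpM2l// mulr_ge0.
apply: (@le_trans _ _ (r%:R * (2 * r%:R * (fr 0 + 1) * modmx q) * (r%:R + 1))).
  rewrite -!mulrA ler_wpM2l// !mulrA ler_pM//; first exact: modmx_ge0.
apply: (@le_trans _ _ (K * modmx q)).
  have -> : r%:R * (2 * r%:R * (fr 0 + 1) * modmx q) * (r%:R + 1) =
    (K - 1) * modmx q by rewrite /K; ring.
  by rewrite ler_wpM2r// gerBl.
by rewrite mulrC -ler_pdivlMr.
Unshelve. all: by end_near. Qed.

(** Bounded orbits cluster by compactness, and continuity of the self-commutator makes the cluster
    point normal. Eigenvalues survive because invertibility of [S - l] is an open condition that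
    would pass to some iterate, hence by similarity to [T - l]. *)
Lemma orbit_cluster : exists S : MC, [/\
  forall e : R, 0 < e -> forall N, exists2 n, (N <= n)%N & modmx (S - Tn n) <= e,
  defect S = 0 &
  forall l, T - l%:M \notin unitmx -> S - l%:M \notin unitmx].
Proof.
pose X n : MR := reim_mx (Tn n).
have [A cA hA] := compact_box (fr 0 + 1).
have XA n : A (X n).
  by apply: hA; apply: (le_trans (norm_reim_le _)); exact: modmx_Tn.
have FA : (X @ \oo) A by exists 0%N => // n _ /=; exact: XA.
have [Y [_ clY]] := cA (X @ \oo) _ FA.
have near_Y (P : MR -> Prop) : (\forall Z \near Y, P Z) ->
    forall N, exists2 n, (N <= n)%N & P (X n).
  move=> hP N.
  have FN : (X @ \oo) (X @` [set n | (N <= n)%N]).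
    by exists N => // n /= Nn; exists n.
  by have [_ [[n /= Nn <-] Pn]] := clY _ _ FN hP; exists n.
exists (mx_of_reim Y); split.
- move=> e e0 N.
  have e20 : 0 < e / 2 by rewrite divr_gt0.
  have hP : \forall Z \near Y, `|Y - Z| < e / 2 by apply/nearP_norm; exists (e / 2).
  have [n Nn hn] := near_Y _ hP N; exists n => //.
  have := modmx_le_norm (Y - X n); rewrite mx_of_reimB reim_mxK => /le_trans; apply.
  by rewrite mulrC -ler_pdivlMr// ltW.
- suff : `|reim_mx (defect (mx_of_reim Y))| <= 0.
    rewrite normr_le0 => /eqP E; apply: (can_inj (@reim_mxK R r)); rewrite E.
    by rewrite -[in RHS](subrr 0) reim_mxB subrr.
  apply/ler_addgt0Pr => e e0; rewrite add0r.
  have e20 : 0 < e / 2 by rewrite divr_gt0.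
  have /smooth_at_continuous/cvgrPdist_le/(_ _ e20) cd :=
    smoothmx_defect (smoothmx_mx_of_reim 0 Y).
  have [N _ hN] := defect_small e20.
  have [n Nn hn] := near_Y _ cd N.
  have h2 : `|reim_mx (defect (Tn n))| <= e / 2.
    by apply: (le_trans (norm_reim_le _)); exact: hN.
  rewrite -(subrK (reim_mx (defect (mx_of_reim (X n)))) (reim_mx _)).
  apply: (le_trans (ler_normD _ _)); rewrite [leRHS]splitr.
  have XE : mx_of_reim (X n) = Tn n by exact: reim_mxK.
  apply: lerD; first exact: hn.
  by rewrite XE; exact: h2.
- move=> l; apply: contra => uS.
  have Sl : smoothmx 0 (fun Z : MR => mx_of_reim Z - l%:M) Y.
    by apply: smoothmxB; [exact: smoothmx_mx_of_reim|exact: smoothmx_cst].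
  have [n _] := near_Y _ (smoothmx_near_unit Sl uS) 0%N.
  rewrite /X reim_mxK => uTl.
  have [G uG E] := iter_aluthge_conj n uT.
  have EG : (Tn n - l%:M) *m G = G *m (T - l%:M).
    by rewrite mulmxBl mulmxBr -/(Tn n) E scalar_mxC.
  have : G *m (T - l%:M) \in unitmx by rewrite -EG unitmx_mul uTl.
  by rewrite unitmx_mul uG.
Qed.

End OrbitCluster.

(** * From the diagonal case to all of [Dstar] *)

Section Global.
Variables (R : realType) (r : nat).
Local Notation MC := 'M[R[i]]_r.
Local Notation MR := ('M[R]_r * 'M[R]_r)%type.

Lemma eigenvalue_notin_unitmx (F : fieldType) (A : 'M[F]_r) (a : F) :
  eigenvalue A a -> A - a%:M \notin unitmx.
Proof.
move=> /eigenvalueP [v vA v0]; apply/negP => uA; move/eqP: v0; apply.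
rewrite -(mulmxK uA v) mulmxBr vA mul_mx_scalar subrr mul0mx.
by [].
Qed.

(** The spectral theorem diagonalizes the normal cluster point unitarily. Its diagonal inherits the
    r distinct nonzero eigenvalues of [T], as the local analysis demands. *)
Lemma Dstar_cluster (T : MC) : Dstar T -> exists (d : 'rV[R[i]]_r) (W : MC),
  [/\ forall j, d 0 j != 0, injective (d 0), W \is unitarymx &
    forall e : R, 0 < e -> exists n,
      `|reim_mx (diag_mx d) - reim_mx (W *m iter n (@aluthge R[i] r) T *m W ^t*)| < e].
Proof.
move=> [_ uT [s [sr us hs]]].
have [S [clS defS eigS]] := orbit_cluster uT.
have nS : S \is normalmx.
  by apply/normalmxP; apply/eqP; rewrite eq_sym -subr_eq0; apply/eqP.
have /orthomx_spectralP SE := nS.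
have uW := spectral_unitarymx S; have uuW := spectral_unit S.
move: (spectralmx S) (spectral_diag S) SE uW uuW => W d SE uW uuW.
have WV : invmx W = W ^t* by rewrite invmx_unitary.
(* The shift by an eigenvalue of [T] is singular at [S], and diag(d) - a is singular only if [a] is
   an entry of [d]. *)
have sub a : a \in s -> a \in codom (d 0).
  move=> /hs /eigenvalue_notin_unitmx /eigS Sa; apply/codomP.
  apply: contrapT => na; move/negP: Sa; apply.
  have -> : S - a%:M = invmx W *m diag_mx (\row_j (d 0 j - a)) *m W.
    have -> : diag_mx (\row_j (d 0 j - a)) = diag_mx d - a%:M.
      by apply/matrixP => i j; rewrite !mxE -mulrnBl.
    by rewrite mulmxBr mulmxBl -SE mul_mx_scalar -scalemxAl mulVmx// scalemx1.
  rewrite !unitmx_mul unitmx_inv uuW diag_mx_unit// => j.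
  rewrite mxE subr_eq0; apply/eqP => E; apply: na; by exists j.
(* Cardinality: r distinct eigenvalues among r diagonal entries exhaust them, so [d] has no
   repetition. *)
have sc : (size (codom (d 0%R)) <= size s)%N by rewrite size_codom card_ord sr.
have [_ sE] := uniq_min_size us sub sc.
exists d, W; split => //.
- move=> j; apply/eqP => dj0.
  have := hs (d 0 j); rewrite sE codom_f => /(_ isT) /eigenvalue_notin_unitmx.
  by rewrite dj0 (_ : 0%:M = 0) ?subr0 ?uT// -scalemx1 scale0r.
- by apply/injectiveP; rewrite /injectiveb /dinjectiveb; exact: leq_size_uniq us sub sc.
move=> e e0; pose K := r%:R * r%:R * modmx W * modmx (W ^t*) + 1.
have K0 : 0 < K by rewrite ltr_wpDl// !mulr_ge0// modmx_ge0.
have e'0 : 0 < e / K / 2 by rewrite !divr_gt0.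
have [n _ hn] := clS _ e'0 0%N; exists n.
have -> : diag_mx d = W *m S *m W ^t*.
  by rewrite SE WV !mulmxA -WV mulmxV// mul1mx mulmxK.
rewrite -reim_mxB -mulmxBl -mulmxBr; apply: (le_lt_trans (norm_reim_le _)).
apply: (@le_lt_trans _ _ (K * (e / K / 2))); last first.
  have -> : K * (e / K / 2) = e / 2 by field; rewrite gt_eqF.
  by rewrite ltr_pdivrMr// ltr_pMr// ltr1n.
apply: (le_trans (modmxM _ _)).
apply: (@le_trans _ _ (r%:R * (r%:R * modmx W * (e / K / 2)) * modmx (W ^t*))).
  rewrite ler_wpM2r ?modmx_ge0// ler_wpM2l//.
  by apply: (le_trans (modmxM _ _)); rewrite ler_wpM2l// mulr_ge0// modmx_ge0.
have -> : r%:R * (r%:R * modmx W * (e / K / 2)) * modmx (W ^t*) =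
  (K - 1) * (e / K / 2) by rewrite /K; ring.
by rewrite ler_wpM2r ?gerBl// ltW.
Qed.

Definition mulLR (A B : MC) (X : MR) : MR := reim_mx (A *m mx_of_reim X *m B).

Lemma mulLR_linear A B : linear (mulLR A B).
Proof.
move=> t X Y; rewrite /mulLR mx_of_reimE mulmxDr mulmxDl -scalemxAr -scalemxAl.
by rewrite reim_mxD reim_mxZ.
Qed.

Lemma mulLR_bounded A B : bounded_map (mulLR A B).
Proof.
apply: (@bounded_map_real _ _ (fun T => A *m T *m B) (r%:R * (r%:R * `|A|) * `|B|)).
  move=> T; apply: (le_trans (norm_mulmx _ _)).
  have -> : r%:R * (r%:R * `|A|) * `|B| * `|T| = r%:R * (r%:R * `|A| * `|T|) * `|B|.
    by ring.
  by rewrite ler_wpM2r// ler_wpM2l// norm_mulmx.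
by rewrite !mulr_ge0.
Qed.

Lemma smoothmx_iter_aluthge k n (X : MR) : mx_of_reim X \in unitmx ->
  smoothmx k (fun Y : MR => iter n (@aluthge R[i] r) (mx_of_reim Y)) X.
Proof.
move=> uX; elim: n => [|n IH]; first exact: smoothmx_mx_of_reim.
by apply: smoothmx_aluthge => //; exact: iter_aluthge_unit.
Qed.

(** After [n] steps and conjugation by [W], the orbit of [X0] is in the neighbourhood of diag(d)
    where [limV] is smooth; by continuity the same [n] and [W] serve for all nearby [X]. Conjugating
    [limV] back gives [Phi], and [n] may depend on [k] since that neighbourhood does. *)
Lemma aluthge_local (k : nat) (X0 : MR) : Dstar (mx_of_reim X0) ->
  exists (K s : R) (n : nat) (Phi : MR -> MR), [/\ smooth_at k Phi X0,
    0 <= s < 1 & \forall X \near X0, forall m,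
    `|Phi X - reim_mx (iter (n + m) (@aluthge R[i] r) (mx_of_reim X))| <= K * s ^+ m].
Proof.
move=> D0; have [_ uX0 _] := D0.
have [d [W [d0 dinj uW cl]]] := Dstar_cluster D0.
have [e [K [s [e0 s01 he]]]] := limV_near d0 dinj.
have /nearP_norm [e' e'0 he'] := limV_smooth d0 dinj k.
have m0 : 0 < Num.min e e' by rewrite lt_min e0.
have [n hn] := cl _ m0.
pose A (X : MR) := mulLR W (W ^t*) (reim_mx (iter n (@aluthge R[i] r) (mx_of_reim X))).
have SA j : smooth_at j A X0.
  apply: smooth_at_lin; [exact: mulLR_linear|exact: mulLR_bounded|].
  exact: smoothmx_iter_aluthge.
have A0 : `|reim_mx (diag_mx d) - A X0| < Num.min e e'.
  by rewrite /A /mulLR reim_mxK.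
have [C C0 hC] := bounded_map_pos (mulLR_bounded (W ^t*) W).
have VW : W ^t* *m W = 1%:M by apply: mulmx1C; exact/unitarymxP.
exists (C * K), s, n, (fun X => mulLR (W ^t*) W (limV (A X))); split => //.
  apply: smooth_at_lin; [exact: mulLR_linear|exact: mulLR_bounded|].
  apply: (@smooth_at_comp _ _ _ _ _ A (@limV R r)) => //; apply: he'.
  by move: A0; rewrite lt_min => /andP[].
have nA : \forall X \near X0, `|reim_mx (diag_mx d) - A X| < e.
  have cA : {for X0, continuous A} := smooth_at_continuous (SA 0%N).
  have : \forall Y \near A X0, `|reim_mx (diag_mx d) - Y| < e.
    apply/nearP_norm; exists (e - `|reim_mx (diag_mx d) - A X0|).
      by rewrite subr_gt0; move: A0; rewrite lt_min => /andP[].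
    move=> Y; rewrite ltrBrDl => /(le_lt_trans (ler_normD _ _)).
    by rewrite addrA subrK.
  exact: cA.
have nu := near_unit_mx uX0.
near=> X => m.
have uX : mx_of_reim X \in unitmx by near: X.
have AX : `|reim_mx (diag_mx d) - A X| < e by near: X.
have -> : reim_mx (iter (n + m) (@aluthge R[i] r) (mx_of_reim X)) =
    mulLR (W ^t*) W (iter m (@aluthgeV R r) (A X)).
  rewrite iter_aluthgeV /A /mulLR !reim_mxK iter_aluthge_unitary_conj//.
    rewrite -iterD addnC; congr reim_mx.
    by rewrite !mulmxA VW mul1mx -mulmxA VW mulmx1.
  exact: iter_aluthge_unit.
rewrite -(linearmapB (@mulLR_linear _ _)); apply: (le_trans (hC _)).
by rewrite -mulrA ler_pM2l//; exact: he.
Unshelve. all: by end_near. Qed.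

Lemma cvg_modmx (u : nat -> MC) (l : MC) :
  (forall e : R, 0 < e -> \forall n \near \oo, modmx (l - u n) <= e) ->
  u n @[n --> \oo] --> l.
Proof.
move=> H; apply/cvgrPdist_le => e e0.
have eE : e = (complex.Re e)%:C%C by rewrite RRe_real// gtr0_real.
have e1 : 0 < complex.Re e by rewrite -ltcR -eE.
by apply: filterS (H _ e1) => n hn; rewrite modmxE eE lecR.
Qed.

(** [Phi] is the limit of the orbits near [X0], so it agrees there with [aluthge_lim] by uniqueness
    of limits, whatever [k] it was built for. *)
Lemma aluthge_lim_local (k : nat) (X0 : MR) : Dstar (mx_of_reim X0) ->
  smooth_at k (fun X : MR => reim_mx (aluthge_lim (mx_of_reim X))) X0 /\
  exists (K s : R) (n : nat), 0 <= s < 1 /\ \forall X \near X0, forall m,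
    modmx (aluthge_lim (mx_of_reim X) -
      iter (n + m) (@aluthge R[i] r) (mx_of_reim X)) <= K * s ^+ m.
Proof.
move=> D0; have [K [s [n [Phi [SPhi s01 hPhi]]]]] := aluthge_local k D0.
have hm : \forall X \near X0, forall m, modmx (mx_of_reim (Phi X) -
    iter (n + m) (@aluthge R[i] r) (mx_of_reim X)) <= 2 * K * s ^+ m.
  apply: filterS hPhi => X hX m; rewrite -mulrA.
  apply: (@le_trans _ _ (2 * `|Phi X - reim_mx (iter (n + m) (@aluthge R[i] r) (mx_of_reim X))|)).
    have := modmx_le_norm (Phi X - reim_mx (iter (n + m) (@aluthge R[i] r) (mx_of_reim X))).
    by rewrite mx_of_reimB reim_mxK.
  by rewrite ler_pM2l.
have limE : \forall X \near X0, aluthge_lim (mx_of_reim X) = mx_of_reim (Phi X).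
  apply: filterS hm => X hX.
  rewrite /aluthge_lim; apply: cvg_lim; first exact: norm_hausdorff.
  apply: cvg_modmx => e e0; have [N _ hN] := geom_small (2 * K) s01 e0.
  exists (n + N)%N => // j /= nj.
  have nj' : (n <= j)%N by apply: leq_trans nj; exact: leq_addr.
  rewrite -(subnKC nj'); apply: (le_trans (hX _)); apply: hN => /=.
  by rewrite leq_subRL// (leq_trans (leq_addr _ _) nj).
split.
  by apply: smooth_at_ext SPhi; apply: filterS limE => X ->; rewrite mx_of_reimK.
exists (2 * K), s, n; split=> //.
by apply: filterS2 hm limE => X h1 h2 m; rewrite h2; exact: h1.
Qed.

End Global.

(** Carries neighbourhoods of the real form, where the local estimates live, back to the complex
    matrices, where compact sets are taken. *)
Lemma reim_mx_continuous (R : realType) (r : nat) :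
  continuous (@reim_mx R r).
Proof.
move=> T; suff : @reim_mx R r @ T --> reim_mx T by [].
have FT : Filter (nbhs T) by exact: nbhs_filter.
apply: (iffRL (@cvgrPdist_lt _ _ _ _ FT _ _)) => e e0.
apply/nbhs_ballP; exists e%:C%C; first by rewrite /= ltcR.
move=> S; rewrite -ball_normE /= modmxE ltcR => h.
rewrite -reim_mxB; exact: le_lt_trans (norm_reim_le _) h.
Qed.

Unset Implicit Arguments.

Theorem proposition3p2p2 (R : realType) (r : nat) :
  real_smooth_on (@Dstar R r) (@aluthge_lim R r) /\
  (forall K : set 'M[R[i]]_r, compact K -> K `<=` @Dstar R r ->
    {uniform K, (fun n : nat => iter n (@aluthge R[i] r)) @ \oo -->
      @aluthge_lim R r}).
Proof.
split.
  move=> k; apply: smooth_at_Ck_on => X DX.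
  by have [] := aluthge_lim_local k DX.
move=> K cK KD P /uniform_nbhs [E [entE subP]].
move: entE; rewrite -entourage_ballE => -[e /= e0 heE].
have eE : e = (complex.Re e)%:C%C by rewrite RRe_real// gtr0_real.
have e1 : 0 < complex.Re e by rewrite -ltcR -eE.
have e2 : 0 < complex.Re e / 2 by rewrite divr_gt0.
have /compact_near_coveringP cov := cK.
(* The local geometric estimate gives each point of [K] a neighbourhood and a rank valid on all of
   it; compactness, in the form of near coverings, then yields one rank for [K]. *)
have H T : K T -> \forall T' \near T & n \near \oo,
    modmx (aluthge_lim T' - iter n (@aluthge R[i] r) T') < complex.Re e.
  move=> KT; have DT := KD _ KT; rewrite -[T]reim_mxK in DT.
  have [_ [C [s [n [s01 hX]]]]] := aluthge_lim_local 0 DT.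
  have [N _ hN] := geom_small C s01 e2.
  have hT := reim_mx_continuous hX.
  exists ([set T' : 'M[R[i]]_r | forall m, modmx (aluthge_lim T' -
      iter (n + m) (@aluthge R[i] r) T') <= C * s ^+ m],
      [set j | (n + N <= j)%N]) => /=.
    split; last by exists (n + N)%N.
    apply: (@filterS _ (nbhs T) (nbhs_filter T) _ _ _ hT) => T' /= h m.
    by have := h m; rewrite reim_mxK.
  move=> [T' j] /= [h nj].
  have nj' : (n <= j)%N by apply: leq_trans nj; exact: leq_addr.
  rewrite -(subnKC nj'); apply: (le_lt_trans (h _)).
  apply: (@le_lt_trans _ _ (complex.Re e / 2)); last first.
    by rewrite ltr_pdivrMr// ltr_pMr// ltr1n.
  by apply: hN => /=; rewrite leq_subRL.
have hK := cov nat \oo (fun n T => modmx (aluthge_lim T -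
  iter n (@aluthge R[i] r) T) < complex.Re e) _ H.
suff : \forall n \near \oo, P (iter n (@aluthge R[i] r)) by [].
near=> n; apply: subP => T KT /=.
apply: heE => /=; rewrite -ball_normE /= modmxE eE ltcR.
have : K `<=` (fun T => modmx (aluthge_lim T - iter n (@aluthge R[i] r) T) <
  complex.Re e) by near: n; exact: hK.
by apply.
Unshelve. all: by end_near. Qed.
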